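(* Let $S$ be a finite cyclic group of order $N:=2l+1$ with $l\ge1$ (equipped with a linear character $\chi:S\to\mathbb{C}^\times$). Then: (1) The Lie algebra $\widehat{A}_S$ is isomorphic to the affine Lie algebra $\widehat{\mathfrak{gl}_N}$. (2) The Lie algebra $\widehat{B}_S$ is isomorphic to $(\widehat{\mathfrak{gl}_N})^{\hat\tau}$. Furthermore, $(\widehat{\mathfrak{gl}_N})^{\hat\tau}$ is isomorphic to the quotient algebra of the direct sum $\mathfrak{g}'(A_{2l}^{(2)})\oplus(\widehat{\mathfrak h})^{\hat\tau}$ modulo the one-dimensional central ideal $\mathbb{C}(\mathbf{k},-\mathbf{k})$. (3) The Lie algebra $\widehat{D}_S$ is isomorphic to the affine Kac-Moody algebra $\mathfrak{g}'(B_l^{(1)})$.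
   Context: All Lie algebras are over $\mathbb{C}$; $S$ is written additively. $\widehat{A}_S$ is the Lie algebra generated by $\mathbf{c}$ and $A_{\alpha,m}$ ($\alpha\in S$, $m\in\mathbb{Z}$) subject to the relations that $\mathbf{c}$ is central and $$[A_{\alpha,m},A_{\beta,n}]=(\chi(m\beta-n\alpha)-\chi(n\alpha-m\beta))A_{\alpha+\beta,m+n}+m\delta_{\alpha+\beta,0}\delta_{m+n,0}\mathbf{c};$$ these generators form a basis. $\widehat{B}_S$ and $\widehat{D}_S$ are the fixed-point subalgebras of $\widehat{A}_S$ under the order-2 automorphisms $\tau_B$, $\tau_D$ given by $\tau_B(\mathbf{c})=\mathbf{c}=\tau_D(\mathbf{c})$, $\tau_B(A_{\alpha,m})=-(-1)^mA_{-\alpha,m}$, $\tau_D(A_{\alpha,m})=-\chi(2\alpha)A_{-\alpha,m}$. For a Lie algebra $\mathfrak g$ with symmetric invariant bilinear form, $\widehat{\mathfrak g}=\mathfrak g\otimes\mathbb{C}[t,t^{-1}]\oplus\mathbb{C}\mathbf{k}$ with $\mathbf{k}$ central and $[a\otimes t^m,b\otimes t^n]=[a,b]\otimes t^{m+n}+m\langle a,b\rangle\delta_{m+n,0}\mathbf{k}$. The form on $\mathfrak{gl}_N$ is the trace form $\langle E_{i,j},E_{p,q}\rangle=\delta_{i,q}\delta_{j,p}$. $\hat\tau$ is the automorphism of $\widehat{\mathfrak{gl}_N}$ with $\hat\tau(\mathbf{k})=\mathbf{k}$ and $\hat\tau(E_{i,j}\otimes t^m)=-(-1)^m(E_{j,i}\otimes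 t^m)$; a superscript $\hat\tau$ denotes the fixed-point subalgebra. $\mathfrak h=\mathbb{C}I\subset\mathfrak{gl}_N$ ($I$ the identity matrix, $\langle I,I\rangle=N$), and $\widehat{\mathfrak h}\subset\widehat{\mathfrak{gl}_N}$ is its affine Lie algebra, on which $\hat\tau(I\otimes t^m)=-(-1)^mI\otimes t^m$, so $(\widehat{\mathfrak h})^{\hat\tau}=\mathfrak h\otimes t\mathbb{C}[t^2,t^{-2}]+\mathbb{C}\mathbf{k}$. For a generalized Cartan matrix $A$, $\mathfrak g'(A)$ denotes the derived subalgebra of the Kac-Moody algebra $\mathfrak g(A)$. In (2), $\mathfrak g'(A_{2l}^{(2)})$ is realized as the fixed-point subalgebra $(\widehat{\mathfrak{sl}_N})^{\hat\tau}$ of $\widehat{\mathfrak{sl}_N}\subset\widehat{\mathfrak{gl}_N}$, and $\mathbf{k}$ in the first summand denotes the element corresponding to $\mathbf{k}\in(\widehat{\mathfrak{sl}_N})^{\hat\tau}$. $B_l^{(1)}$ is the untwisted affine type of the simple Lie algebra of type $B_l$.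
   Formalization: The linear character χ is additionally assumed injective; for non-injective χ the isomorphisms fail (e.g. for trivial χ all structure constants vanish and Â_S is 2-step nilpotent, unlike the affine algebra of gl_N). *)

(* Defs.v *)
From HB Require Import structures.
From mathcomp Require Import all_boot all_order all_algebra.
From mathcomp Require Import generic_quotient ring_quotient.
From mathcomp Require Import boolp classical_sets functions cardinality fsbigop.
From mathcomp Require Import reals complex.
From mathcomp Require Import finmap ring.

Set Implicit Arguments.
Unset Strict Implicit.
Unset Printing Implicit Defensive.
Import Order.TTheory GRing.Theory Num.Theory.
Local Open Scope quotient_scope.
Local Open Scope ring_scope.

Reserved Notation "[ 'lie' x , y ]" (at level 0, x, y at level 200,
  format "[ 'lie'  x ,  y ]").
Reserved Notation "L ~=L M" (at level 70).

HB.mixin Record isLieAlgebra (F : fieldType) V of GRing.Lmodule F V := {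
  bracket : V -> V -> V;
  bracket_linl : forall (a : F) (x y z : V),
    bracket (a *: x + y) z = a *: bracket x z + bracket y z;
  bracket_linr : forall (a : F) (x y z : V),
    bracket z (a *: x + y) = a *: bracket z x + bracket z y;
  bracketxx : forall x : V, bracket x x = 0;
  jacobi : forall x y z : V,
    bracket x (bracket y z) + bracket y (bracket z x) + bracket z (bracket x y)
      = 0
}.

#[short(type="lieType")]
HB.structure Definition LieAlgebra (F : fieldType) :=
  { V of isLieAlgebra F V & GRing.Lmodule F V }.

Notation "[ 'lie' x , y ]" := (bracket x y) : ring_scope.

Section LieTheory.
Variables (F : fieldType) (L : lieType F).
Implicit Types x y z : L.

Lemma bracketDl x y z : [lie x + y, z] = [lie x, z] + [lie y, z].
Proof. by have := bracket_linl 1 x y z; rewrite !scale1r. Qed.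
Lemma bracketDr x y z : [lie z, x + y] = [lie z, x] + [lie z, y].
Proof. by have := bracket_linr 1 x y z; rewrite !scale1r. Qed.
Lemma bracket0x z : [lie 0, z] = 0.
Proof. by apply: (addrI [lie 0, z]); rewrite -bracketDl !addr0. Qed.
Lemma bracketx0 z : [lie z, 0] = 0.
Proof. by apply: (addrI [lie z, 0]); rewrite -bracketDr !addr0. Qed.
Lemma bracketZl a x z : [lie a *: x, z] = a *: [lie x, z].
Proof. by have := bracket_linl a x 0 z; rewrite bracket0x !addr0. Qed.
Lemma bracketZr a x z : [lie z, a *: x] = a *: [lie z, x].
Proof. by have := bracket_linr a x 0 z; rewrite bracketx0 !addr0. Qed.
Lemma bracketNl x z : [lie - x, z] = - [lie x, z].
Proof. by rewrite -scaleN1r bracketZl scaleN1r. Qed.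
Lemma bracketNr x z : [lie z, - x] = - [lie z, x].
Proof. by rewrite -scaleN1r bracketZr scaleN1r. Qed.
Lemma bracketC x y : [lie y, x] = - [lie x, y].
Proof.
have := bracketxx (x + y); rewrite bracketDl !bracketDr !bracketxx add0r addr0.
by move=> /eqP; rewrite addrC addr_eq0 => /eqP.
Qed.

Definition lie_central z := forall x, [lie z, x] = 0.

End LieTheory.

Record lieHom (F : fieldType) (L M : lieType F) := LieHom {
  hom_fun :> {linear L -> M};
  hom_bracket : forall x y, hom_fun [lie x, y] = [lie hom_fun x, hom_fun y]
}.

Record lieIso (F : fieldType) (L M : lieType F) := LieIso {
  iso_hom :> lieHom L M;
  iso_inv : M -> L;
  iso_homK : cancel iso_hom iso_inv;
  iso_invK : cancel iso_inv iso_hom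
}.

Notation "L ~=L M" := (inhabited (lieIso L M)) : type_scope.

Section DirectSum.
Variables (F : fieldType) (L M : lieType F).
Local Notation T := (L * M)%type.

Definition dsum_bracket (x y : T) : T := ([lie x.1, y.1], [lie x.2, y.2]).

Fact dsum_linl (a : F) x y z :
  dsum_bracket (a *: x + y) z = a *: dsum_bracket x z + dsum_bracket y z.
Proof. by congr pair; rewrite bracket_linl. Qed.
Fact dsum_linr (a : F) x y z :
  dsum_bracket z (a *: x + y) = a *: dsum_bracket z x + dsum_bracket z y.
Proof. by congr pair; rewrite bracket_linr. Qed.
Fact dsum_xx x : dsum_bracket x x = 0.
Proof. by congr pair; rewrite bracketxx. Qed.
Fact dsum_jacobi x y z :
  dsum_bracket x (dsum_bracket y z) + dsum_bracket y (dsum_bracket z x)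
    + dsum_bracket z (dsum_bracket x y) = 0.
Proof. by congr pair; rewrite jacobi. Qed.

HB.instance Definition _ :=
  isLieAlgebra.Build F T dsum_linl dsum_linr dsum_xx dsum_jacobi.

End DirectSum.

Record subalg (F : fieldType) (L : lieType F) := Subalg {
  subalg_pred : {pred L};
  subalg_submod : submod_closed subalg_pred;
  subalg_bracket : {in subalg_pred &, forall x y, [lie x, y] \in subalg_pred}
}.

Definition sub_lie (F : fieldType) (L : lieType F) (P : subalg L) : Type :=
  {x : L | subalg_pred P x}.

Section SubLie.
Variables (F : fieldType) (L : lieType F) (P : subalg L).
Local Notation T := (sub_lie P).

HB.instance Definition _ := GRing.isSubmodClosed.Build F L (subalg_pred P)
  (GRing.submod_closed_semi (subalg_submod P)).
HB.instance Definition _ := [isSub of T for @sval _ _].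
HB.instance Definition _ := [Choice of T by <:].
HB.instance Definition _ := [SubChoice_isSubLmodule of T by <:].

Definition sub_bracket (x y : T) : T :=
  exist _ [lie val x, val y] (subalg_bracket (valP x) (valP y)).

Fact sub_linl (a : F) x y z :
  sub_bracket (a *: x + y) z = a *: sub_bracket x z + sub_bracket y z.
Proof. by apply: val_inj; rewrite /= bracket_linl. Qed.
Fact sub_linr (a : F) x y z :
  sub_bracket z (a *: x + y) = a *: sub_bracket z x + sub_bracket z y.
Proof. by apply: val_inj; rewrite /= bracket_linr. Qed.
Fact sub_xx x : sub_bracket x x = 0.
Proof. by apply: val_inj; rewrite /= bracketxx. Qed.
Fact sub_jacobi x y z :
  sub_bracket x (sub_bracket y z) + sub_bracket y (sub_bracket z x)
    + sub_bracket z (sub_bracket x y) = 0.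
Proof. by apply: val_inj; rewrite /= jacobi. Qed.

HB.instance Definition _ :=
  isLieAlgebra.Build F T sub_linl sub_linr sub_xx sub_jacobi.

End SubLie.

Section SubalgConstructions.
Variables (F : fieldType) (L : lieType F).

Section Fixed.
Variable tau : lieHom L L.
Definition fixed_pred : {pred L} := [pred x | tau x == x].
Fact fixed_submod : submod_closed fixed_pred.
Proof.
split; first by rewrite inE linear0.
by move=> a x y; rewrite !inE => /eqP hx /eqP hy; rewrite linearP hx hy.
Qed.
Fact fixed_bracket : {in fixed_pred &, forall x y, [lie x, y] \in fixed_pred}.
Proof. by move=> x y; rewrite !inE => /eqP hx /eqP hy; rewrite hom_bracket hx hy. Qed.
Definition fixed_subalg := Subalg fixed_submod fixed_bracket.
End Fixed.

Section Cap.
Variables P Q : subalg L.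
Definition cap_pred : {pred L} :=
  [pred x | (x \in subalg_pred P) && (x \in subalg_pred Q)].
Fact cap_submod : submod_closed cap_pred.
Proof.
split; first by rewrite inE !rpred0.
by move=> a x y; rewrite !inE => /andP[? ?] /andP[? ?]; rewrite !rpredD ?rpredZ.
Qed.
Fact cap_bracket : {in cap_pred &, forall x y, [lie x, y] \in cap_pred}.
Proof.
by move=> x y; rewrite !inE => /andP[? ?] /andP[? ?]; rewrite !subalg_bracket.
Qed.
Definition cap_subalg := Subalg cap_submod cap_bracket.
End Cap.

Definition derived_pred : {pred L} :=
  [pred x : L | `[< exists s : seq (L * L), x = \sum_(p <- s) [lie p.1, p.2] >]].
Fact derived_submod : submod_closed derived_pred.
Proof.
split; first by apply/asboolP; exists [::]; rewrite big_nil.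
move=> a x y /asboolP[s ->] /asboolP[t ->]; apply/asboolP.
exists ([seq (a *: p.1, p.2) | p <- s] ++ t).
rewrite big_cat big_map scaler_sumr; congr (_ + _).
by apply: eq_bigr => p _; rewrite bracketZl.
Qed.
Fact derived_bracket : {in derived_pred &, forall x y, [lie x, y] \in derived_pred}.
Proof.
by move=> x y _ _; apply/asboolP; exists [:: (x, y)]; rewrite big_seq1.
Qed.
Definition derived_subalg := Subalg derived_submod derived_bracket.

End SubalgConstructions.

Record ideal (F : fieldType) (L : lieType F) := Ideal {
  ideal_pred : {pred L};
  ideal_submod : submod_closed ideal_pred;
  ideal_bracket : forall x, {in ideal_pred, forall y, [lie x, y] \in ideal_pred}
}.

HB.instance Definition _ (F : fieldType) (L : lieType F) (I : ideal L) :=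
  GRing.isSubmodClosed.Build F L (ideal_pred I)
    (GRing.submod_closed_semi (ideal_submod I)).

Definition quot_lie (F : fieldType) (L : lieType F) (I : ideal L) : Type :=
  Quotient.quot (ideal_pred I).

Section QuotLie.
Variables (F : fieldType) (L : lieType F) (I : ideal L).
Local Notation Q := (quot_lie I).

HB.instance Definition _ := GRing.Zmodule.on Q.

Definition quot_pi (x : L) : Q := \pi_(Quotient.quot (ideal_pred I)) x.

Lemma quot_piP x y : reflect (quot_pi x = quot_pi y) (x - y \in ideal_pred I).
Proof. by rewrite Quotient.idealrBE; apply: eqP. Qed.
Lemma quot_piK (q : Q) : quot_pi (repr (q : Quotient.quot (ideal_pred I))) = q.
Proof. exact: reprK. Qed.
Lemma quot_piD x y : quot_pi (x + y) = quot_pi x + quot_pi y.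
Proof. exact: (Quotient.pi_add (ideal_pred I)). Qed.

Definition quot_scale (a : F) (q : Q) : Q :=
  quot_pi (a *: repr (q : Quotient.quot (ideal_pred I))).
Definition quot_bracket (p q : Q) : Q :=
  quot_pi [lie repr (p : Quotient.quot (ideal_pred I)),
               repr (q : Quotient.quot (ideal_pred I))].

Lemma quot_piZ a x : quot_pi (a *: x) = quot_scale a (quot_pi x).
Proof.
apply/quot_piP; rewrite -scalerBr rpredZ //.
by apply/quot_piP; rewrite quot_piK.
Qed.
Lemma quot_pi_bracket x y :
  quot_pi [lie x, y] = quot_bracket (quot_pi x) (quot_pi y).
Proof.
apply/quot_piP; set x' := repr _; set y' := repr _.
have hx : x - x' \in ideal_pred I by apply/quot_piP; rewrite quot_piK.
have hy : y - y' \in ideal_pred I by apply/quot_piP; rewrite quot_piK.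
have -> : [lie x, y] - [lie x', y'] = [lie x, y - y'] - [lie y', x - x'].
  rewrite (bracketC (x - x')) opprK bracketDr bracketDl bracketNr bracketNl.
  by rewrite addrA addrNK.
by rewrite rpredB ?ideal_bracket.
Qed.

Local Ltac lift q := rewrite -[q]quot_piK; move: (repr _) => {}q.

Fact quot_scaleA a b q : quot_scale a (quot_scale b q) = quot_scale (a * b) q.
Proof. by lift q; rewrite -!quot_piZ scalerA. Qed.
Fact quot_scale1 : left_id 1 quot_scale.
Proof. by move=> q; lift q; rewrite -!quot_piZ scale1r. Qed.
Fact quot_scaleDr : right_distributive quot_scale +%R.
Proof. by move=> a p q; lift p; lift q; rewrite -!(quot_piZ, quot_piD) scalerDr. Qed.
Fact quot_scaleDl q : {morph quot_scale^~ q : a b / a + b}.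
Proof. by move=> a b; lift q; rewrite -!(quot_piZ, quot_piD) scalerDl. Qed.
HB.instance Definition _ := GRing.Zmodule_isLmodule.Build F Q
  quot_scaleA quot_scale1 quot_scaleDr quot_scaleDl.

Fact quot_linl (a : F) x y z :
  quot_bracket (a *: x + y) z = a *: quot_bracket x z + quot_bracket y z.
Proof.
lift x; lift y; lift z; rewrite -[a *: _]quot_piZ -quot_piD -!quot_pi_bracket.
by rewrite -[a *: _]quot_piZ -quot_piD bracket_linl.
Qed.
Fact quot_linr (a : F) x y z :
  quot_bracket z (a *: x + y) = a *: quot_bracket z x + quot_bracket z y.
Proof.
lift x; lift y; lift z; rewrite -[a *: _]quot_piZ -quot_piD -!quot_pi_bracket.
by rewrite -[a *: _]quot_piZ -quot_piD bracket_linr.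
Qed.
Lemma quot_pi0 : quot_pi 0 = 0.
Proof. by apply: (addrI (quot_pi 0)); rewrite -quot_piD !addr0. Qed.
Fact quot_xx x : quot_bracket x x = 0.
Proof. by lift x; rewrite -quot_pi_bracket bracketxx quot_pi0. Qed.
Fact quot_jacobi x y z :
  quot_bracket x (quot_bracket y z) + quot_bracket y (quot_bracket z x)
    + quot_bracket z (quot_bracket x y) = 0.
Proof.
lift x; lift y; lift z.
by rewrite -!quot_pi_bracket -!quot_piD jacobi quot_pi0.
Qed.

HB.instance Definition _ :=
  isLieAlgebra.Build F Q quot_linl quot_linr quot_xx quot_jacobi.

End QuotLie.

Section IdealConstructions.
Variables (F : fieldType) (L : lieType F).

Section CentralLine.
Variables (z : L) (hz : lie_central z).
Definition line_pred : {pred L} := [pred x | `[< exists a : F, x = a *: z >]].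
Fact line_submod : submod_closed line_pred.
Proof.
split; first by apply/asboolP; exists 0; rewrite scale0r.
move=> a x y /asboolP[b ->] /asboolP[c ->]; apply/asboolP.
by exists (a * b + c); rewrite scalerDl scalerA.
Qed.
Fact line_bracket x : {in line_pred, forall y, [lie x, y] \in line_pred}.
Proof.
move=> y /asboolP[a ->]; apply/asboolP; exists 0.
by rewrite scale0r bracketC bracketZl hz scaler0 oppr0.
Qed.
Definition central_line := Ideal line_submod line_bracket.
End CentralLine.

Section IdealSum.
Variable C : ideal L -> Prop.
Definition ideal_sum_pred : {pred L} :=
  [pred x | `[< exists s : seq L, x = \sum_(y <- s) y /\
     forall y, y \in s -> exists2 I : ideal L, C I & y \in ideal_pred I >]].
Fact ideal_sum_submod : submod_closed ideal_sum_pred.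
Proof.
split; first by apply/asboolP; exists [::]; rewrite big_nil.
move=> a x y /asboolP[s [-> hs]] /asboolP[t [-> ht]]; apply/asboolP.
exists ([seq a *: u | u <- s] ++ t); split.
  by rewrite big_cat big_map scaler_sumr.
move=> u; rewrite mem_cat => /orP[/mapP[v vs ->]|/ht//].
by have [I CI vI] := hs v vs; exists I => //; rewrite rpredZ.
Qed.
Fact ideal_sum_bracket x :
  {in ideal_sum_pred, forall y, [lie x, y] \in ideal_sum_pred}.
Proof.
move=> y /asboolP[s [-> hs]]; apply/asboolP.
exists [seq [lie x, u] | u <- s]; split.
  rewrite big_map; elim: (s) => [|u r IH]; first by rewrite !big_nil bracketx0.
  by rewrite !big_cons bracketDr IH.
move=> u /mapP[v vs ->]; have [I CI vI] := hs v vs.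
by exists I => //; rewrite ideal_bracket.
Qed.
Definition ideal_sum := Ideal ideal_sum_submod ideal_sum_bracket.
End IdealSum.

End IdealConstructions.

Section Terms.
Variables (F : fieldType) (X : Type).

Inductive lterm : Type :=
| LVar of X
| LZero
| LAdd of lterm & lterm
| LScale of F & lterm
| LBr of lterm & lterm.

HB.instance Definition _ := gen_eqMixin lterm.
HB.instance Definition _ := gen_choiceMixin lterm.

(* The least congruence that contains [rel] and makes the quotient a Lie
   algebra. *)
Inductive lcong (rel : lterm -> lterm -> Prop) : lterm -> lterm -> Prop :=
| lc_rel s t : rel s t -> lcong rel s t
| lc_refl s : lcong rel s s
| lc_sym s t : lcong rel s t -> lcong rel t s
| lc_trans t s u : lcong rel s t -> lcong rel t u -> lcong rel s u
| lc_add s s' t t' : lcong rel s s' -> lcong rel t t' ->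
    lcong rel (LAdd s t) (LAdd s' t')
| lc_scale a s s' : lcong rel s s' -> lcong rel (LScale a s) (LScale a s')
| lc_br s s' t t' : lcong rel s s' -> lcong rel t t' ->
    lcong rel (LBr s t) (LBr s' t')
| lc_addA s t u : lcong rel (LAdd s (LAdd t u)) (LAdd (LAdd s t) u)
| lc_addC s t : lcong rel (LAdd s t) (LAdd t s)
| lc_add0 s : lcong rel (LAdd LZero s) s
| lc_addN s : lcong rel (LAdd (LScale (-1) s) s) LZero
| lc_scaleA a b s : lcong rel (LScale a (LScale b s)) (LScale (a * b) s)
| lc_scale1 s : lcong rel (LScale 1 s) s
| lc_scaleDr a s t :
    lcong rel (LScale a (LAdd s t)) (LAdd (LScale a s) (LScale a t))
| lc_scaleDl a b s :
    lcong rel (LScale (a + b) s) (LAdd (LScale a s) (LScale b s))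
| lc_linl a s t u : lcong rel (LBr (LAdd (LScale a s) t) u)
    (LAdd (LScale a (LBr s u)) (LBr t u))
| lc_linr a s t u : lcong rel (LBr u (LAdd (LScale a s) t))
    (LAdd (LScale a (LBr u s)) (LBr u t))
| lc_xx s : lcong rel (LBr s s) LZero
| lc_jacobi s t u : lcong rel
    (LAdd (LAdd (LBr s (LBr t u)) (LBr t (LBr u s))) (LBr u (LBr s t))) LZero.

Fixpoint leval (M : lieType F) (f : X -> M) (t : lterm) : M :=
  match t with
  | LVar x => f x
  | LZero => 0
  | LAdd s u => leval f s + leval f u
  | LScale a s => a *: leval f s
  | LBr s u => [lie leval f s, leval f u]
  end.

Variable rel : lterm -> lterm -> Prop.

Definition lcongb (s t : lterm) : bool := `[< lcong rel s t >].
Fact lcongb_equiv : equiv_class_of lcongb.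
Proof.
split.
- by move=> s; apply/asboolP/lc_refl.
- by move=> s t; apply/asboolP/asboolP; apply: lc_sym.
- by move=> t s u /asboolP st /asboolP tu; apply/asboolP/(lc_trans st tu).
Qed.
Canonical lcong_equiv := EquivRelPack lcongb_equiv.
Canonical lcong_encModRel := defaultEncModRel lcongb.

Definition pres_quot := {eq_quot lcongb}.
HB.instance Definition _ : EqQuotient _ lcongb pres_quot := EqQuotient.on pres_quot.
HB.instance Definition _ := Choice.on pres_quot.

End Terms.

Arguments LZero {F X}.
Arguments LVar {F X} _.
Arguments LScale {F X} _ _.

Definition presented (F : fieldType) (X : Type)
  (rel : lterm F X -> lterm F X -> Prop) : Type := pres_quot rel.

Section Presented.
Variables (F : fieldType) (X : Type) (rel : lterm F X -> lterm F X -> Prop).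
Local Notation T := (lterm F X).
Local Notation P := (presented rel).

HB.instance Definition _ := Choice.on P.

Definition pres_pi (t : T) : P := \pi_(pres_quot rel) t.

Lemma pres_piP s t : pres_pi s = pres_pi t <-> lcong rel s t.
Proof. by split => [/eqmodP/asboolP|h] //; apply/eqmodP/asboolP. Qed.
Lemma pres_piK (p : P) : pres_pi (repr (p : pres_quot rel)) = p.
Proof. exact: reprK. Qed.
Lemma pres_reprK t : lcong rel (repr (pres_pi t : pres_quot rel)) t.
Proof. by apply/pres_piP; rewrite pres_piK. Qed.

Definition pres_gen (x : X) : P := pres_pi (LVar x).

Definition pres_add (p q : P) : P :=
  pres_pi (LAdd (repr (p : pres_quot rel)) (repr (q : pres_quot rel))).
Definition pres_scale (a : F) (p : P) : P :=
  pres_pi (LScale a (repr (p : pres_quot rel))).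
Definition pres_br (p q : P) : P :=
  pres_pi (LBr (repr (p : pres_quot rel)) (repr (q : pres_quot rel))).

Lemma pres_piD s t : pres_add (pres_pi s) (pres_pi t) = pres_pi (LAdd s t).
Proof. by apply/pres_piP/lc_add; apply: pres_reprK. Qed.
Lemma pres_piZ a s : pres_scale a (pres_pi s) = pres_pi (LScale a s).
Proof. by apply/pres_piP/lc_scale; apply: pres_reprK. Qed.
Lemma pres_piB s t : pres_br (pres_pi s) (pres_pi t) = pres_pi (LBr s t).
Proof. by apply/pres_piP/lc_br; apply: pres_reprK. Qed.

Local Ltac lift q := rewrite -[q]pres_piK; move: (repr _) => {}q.
Local Notation piE := (pres_piD, pres_piZ, pres_piB).

Fact pres_addA : associative pres_add.
Proof.
by move=> p q r; lift p; lift q; lift r; rewrite !piE; apply/pres_piP/lc_addA.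
Qed.
Fact pres_addC : commutative pres_add.
Proof. by move=> p q; lift p; lift q; rewrite !piE; apply/pres_piP/lc_addC. Qed.
Fact pres_add0 : left_id (pres_pi LZero) pres_add.
Proof. by move=> p; lift p; rewrite !piE; apply/pres_piP/lc_add0. Qed.
Fact pres_addN : left_inverse (pres_pi LZero) (pres_scale (-1)) pres_add.
Proof. by move=> p; lift p; rewrite !piE; apply/pres_piP/lc_addN. Qed.
HB.instance Definition _ :=
  GRing.isZmodule.Build P pres_addA pres_addC pres_add0 pres_addN.

Fact pres_scaleA a b p : pres_scale a (pres_scale b p) = pres_scale (a * b) p.
Proof. by lift p; rewrite !piE; apply/pres_piP/lc_scaleA. Qed.
Fact pres_scale1 : left_id 1 pres_scale.
Proof. by move=> p; lift p; rewrite !piE; apply/pres_piP/lc_scale1. Qed.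
Fact pres_scaleDr : right_distributive pres_scale +%R.
Proof.
by move=> a p q; lift p; lift q; rewrite /+%R /= !piE; apply/pres_piP/lc_scaleDr.
Qed.
Fact pres_scaleDl p : {morph pres_scale^~ p : a b / a + b}.
Proof.
move=> a b; lift p; rewrite -[RHS]/(pres_add _ _) !piE.
exact/pres_piP/lc_scaleDl.
Qed.
HB.instance Definition _ := GRing.Zmodule_isLmodule.Build F P
  pres_scaleA pres_scale1 pres_scaleDr pres_scaleDl.

Lemma pres_pi_add s t : pres_pi (LAdd s t) = pres_pi s + pres_pi t.
Proof. by rewrite -pres_piD. Qed.
Lemma pres_pi_scale a s : pres_pi (LScale a s) = a *: pres_pi s.
Proof. by rewrite -pres_piZ. Qed.
Lemma pres_pi_zero : pres_pi LZero = 0.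
Proof. by []. Qed.

Fact pres_linl (a : F) x y z :
  pres_br (a *: x + y) z = a *: pres_br x z + pres_br y z.
Proof.
lift x; lift y; lift z.
have -> : a *: pres_pi x + pres_pi y = pres_pi (LAdd (LScale a x) y).
  by rewrite pres_pi_add pres_pi_scale.
rewrite !pres_piB -pres_pi_scale -pres_pi_add; exact/pres_piP/lc_linl.
Qed.
Fact pres_linr (a : F) x y z :
  pres_br z (a *: x + y) = a *: pres_br z x + pres_br z y.
Proof.
lift x; lift y; lift z.
have -> : a *: pres_pi x + pres_pi y = pres_pi (LAdd (LScale a x) y).
  by rewrite pres_pi_add pres_pi_scale.
rewrite !pres_piB -pres_pi_scale -pres_pi_add; exact/pres_piP/lc_linr.
Qed.
Fact pres_xx x : pres_br x x = 0.
Proof. by lift x; rewrite pres_piB; apply/pres_piP/lc_xx. Qed.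
Fact pres_jacobi x y z :
  pres_br x (pres_br y z) + pres_br y (pres_br z x) + pres_br z (pres_br x y) = 0.
Proof.
lift x; lift y; lift z; rewrite !pres_piB -!pres_pi_add.
exact/pres_piP/lc_jacobi.
Qed.
HB.instance Definition _ :=
  isLieAlgebra.Build F P pres_linl pres_linr pres_xx pres_jacobi.

Lemma pres_pi_br s t : pres_pi (LBr s t) = [lie pres_pi s, pres_pi t].
Proof. by rewrite -pres_piB. Qed.

Lemma pres_rel s t : rel s t -> leval pres_gen s = leval pres_gen t.
Proof.
have pi_eval u : leval pres_gen u = pres_pi u.
  elim: u => //= [u -> v ->|a u ->|u -> v ->].
  - by rewrite pres_pi_add.
  - by rewrite pres_pi_scale.
  - by rewrite pres_pi_br.
by move=> st; rewrite !pi_eval; apply/pres_piP/lc_rel.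
Qed.

Section Lift.
Variables (M : lieType F) (f : X -> M).
Hypothesis f_rel : forall s t, rel s t -> leval f s = leval f t.

Lemma leval_lcong s t : lcong rel s t -> leval f s = leval f t.
Proof.
elim=> //= {s t}.
- by move=> s t u _ -> _ ->.
- by move=> s s' t t' _ -> _ ->.
- by move=> a s s' _ ->.
- by move=> s s' t t' _ -> _ ->.
- by move=> s t u; rewrite addrA.
- by move=> s t; rewrite addrC.
- by move=> s; rewrite add0r.
- by move=> s; rewrite scaleN1r addNr.
- by move=> a b s; rewrite scalerA.
- by move=> s; rewrite scale1r.
- by move=> a s t; rewrite scalerDr.
- by move=> a b s; rewrite scalerDl.
- by move=> a s t u; rewrite bracket_linl.
- by move=> a s t u; rewrite bracket_linr.
- by move=> s; rewrite bracketxx.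
- by move=> s t u; rewrite jacobi.
Qed.

Definition pres_lift_fun (p : P) : M := leval f (repr (p : pres_quot rel)).

Lemma pres_lift_pi t : pres_lift_fun (pres_pi t) = leval f t.
Proof. exact/leval_lcong/pres_reprK. Qed.

Fact pres_lift_linear : linear pres_lift_fun.
Proof.
move=> a p q; lift p; lift q.
by rewrite -pres_pi_scale -pres_pi_add !pres_lift_pi.
Qed.
HB.instance Definition _ :=
  GRing.isLinear.Build F P M _ pres_lift_fun pres_lift_linear.

Fact pres_lift_br (p q : P) :
  pres_lift_fun [lie p, q] = [lie pres_lift_fun p, pres_lift_fun q].
Proof. by lift p; lift q; rewrite -pres_pi_br !pres_lift_pi. Qed.

Definition pres_lift : lieHom P M :=
  @LieHom F P M pres_lift_fun pres_lift_br.

Lemma pres_liftE x : pres_lift (pres_gen x) = f x.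
Proof. exact: pres_lift_pi. Qed.

End Lift.
End Presented.

HB.mixin Record hasInvariantForm (F : fieldType) g of LieAlgebra F g := {
  iform : g -> g -> F;
  iform_linl : forall (a : F) (x y z : g),
    iform (a *: x + y) z = a * iform x z + iform y z;
  iform_sym : forall x y : g, iform x y = iform y x;
  iform_inv : forall x y z : g, iform [lie x, y] z = iform x [lie y, z]
}.

#[short(type="quadLieType")]
HB.structure Definition QuadLie (F : fieldType) :=
  { g of hasInvariantForm F g & LieAlgebra F g }.

Section Loop.
Variables (F : fieldType) (V : lmodType F).

Definition finsupp_pred : {pred (int -> V)} :=
  [pred f : int -> V | `[< finite_set [set m | f m != 0] >]].
Fact finsupp_submod : submod_closed finsupp_pred.
Proof.
split.
  apply/asboolP; rewrite (_ : mkset _ = set0) //.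
  by apply/seteqP; split=> // m /=; rewrite eqxx.
move=> a f g /asboolP hf /asboolP hg; apply/asboolP.
apply: (@sub_finite_set _ _ ([set m | f m != 0] `|` [set m | g m != 0])%classic).
  move=> m /=; have [fm0|] := eqVneq (f m) 0; last by left.
  have [gm0|] := eqVneq (g m) 0; last by right.
  by rewrite !fctE fm0 gm0 scaler0 addr0 eqxx.
by rewrite finite_setU.
Qed.
HB.instance Definition _ := GRing.isSubmodClosed.Build F (int -> V) finsupp_pred
  (GRing.submod_closed_semi finsupp_submod).

(* V (x) F[t, t^-1]: the family [f] stands for \sum_m f m (x) t^m. *)
Definition loop : Type := {f : int -> V | finsupp_pred f}.
HB.instance Definition _ := [isSub of loop for @sval _ _].
HB.instance Definition _ := [Choice of loop by <:].
HB.instance Definition _ := [SubChoice_isSubLmodule of loop by <:].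

Definition lcoef (f : loop) (m : int) : V := val f m.

Lemma lcoefP (f g : loop) : lcoef f =1 lcoef g -> f = g.
Proof. by move=> fg; apply: val_inj; apply/funext. Qed.
Lemma lcoefD f g m : lcoef (f + g) m = lcoef f m + lcoef g m.
Proof. by []. Qed.
Lemma lcoefZ a f m : lcoef (a *: f) m = a *: lcoef f m.
Proof. by []. Qed.
Lemma lcoef0 m : lcoef 0 m = 0.
Proof. by []. Qed.

Definition lsupp (f : loop) : {fset int} := fset_set [set m | lcoef f m != 0].
Lemma lsuppP (f : loop) m : m \notin lsupp f -> lcoef f m = 0.
Proof.
have /asboolP hf := valP f.
rewrite in_fset_set // => h; apply/eqP; apply: contraNT h => h.
exact/mem_set.
Qed.

Fact mono_finsupp (v : V) (m : int) :
  finsupp_pred (fun k => if k == m then v else 0).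
Proof.
apply/asboolP; apply: (@sub_finite_set _ _ [set m]%classic) => // k /=.
by case: (k =P m) => // _; rewrite eqxx.
Qed.

(* v (x) t^m *)
Definition mono (v : V) (m : int) : loop :=
  exist (fun f => finsupp_pred f) _ (mono_finsupp v m).

Lemma lcoef_mono v m k : lcoef (mono v m) k = if k == m then v else 0.
Proof. by []. Qed.

Lemma loop_sum (f : loop) : f = \sum_(m <- lsupp f) mono (lcoef f m) m.
Proof.
apply: lcoefP => k.
rewrite (big_morph (lcoef^~ k) (id1 := 0) (op1 := +%R)) //.
have [kf|kf] := boolP (k \in lsupp f).
  rewrite (big_fsetD1 k) //= lcoef_mono eqxx big1_seq ?addr0 // => m /andP[_].
  by rewrite in_fsetD1 => /andP[mk _]; rewrite lcoef_mono eq_sym (negPf mk).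
rewrite lsuppP // big1_seq // => m /andP[_ mf].
by rewrite lcoef_mono; case: eqP => // km; rewrite km mf in kf.
Qed.

Lemma loop_ind (P : loop -> Prop) : P 0 ->
  (forall f g, P f -> P g -> P (f + g)) -> (forall v m, P (mono v m)) ->
  forall f, P f.
Proof.
by move=> P0 PD Pm f; rewrite (loop_sum f); elim/big_ind: _.
Qed.

End Loop.

Section Convolution.
Variables (F : fieldType) (V W : lmodType F) (B : int -> V -> V -> W).
Hypothesis Bl : forall m a x y z, B m (a *: x + y) z = a *: B m x z + B m y z.
Hypothesis Br : forall m a x y z, B m z (a *: x + y) = a *: B m z x + B m z y.

Definition conv (f g : loop V) (k : int) : W :=
  (\sum_(m \in [set: int]) B m (lcoef f m) (lcoef g (k - m)))%R.

Let B0x m z : B m 0 z = 0.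
Proof. by have := Bl m (-1) 0 0 z; rewrite !scaleN1r oppr0 addr0 addNr. Qed.
Let Bx0 m z : B m z 0 = 0.
Proof. by have := Br m (-1) 0 0 z; rewrite !scaleN1r oppr0 addr0 addNr. Qed.

Lemma convE (A : {fset int}) f g k :
  (forall m, m \notin A -> lcoef f m = 0) ->
  conv f g k = \sum_(m <- A) B m (lcoef f m) (lcoef g (k - m)).
Proof. by move=> hA; apply: fsbigTE => m mA; rewrite hA. Qed.

Lemma conv_linl a f g h k : conv (a *: f + g) h k = a *: conv f h k + conv g h k.
Proof.
pose A := (lsupp f `|` lsupp g)%fset.
have hf m : m \notin A -> lcoef f m = 0.
  by rewrite inE negb_or => /andP[/lsuppP].
have hg m : m \notin A -> lcoef g m = 0.
  by rewrite inE negb_or => /andP[_ /lsuppP].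
rewrite !(@convE A) //; last by move=> m mA; rewrite lcoefD lcoefZ hf // hg // scaler0 addr0.
by rewrite scaler_sumr -big_split; apply: eq_bigr => m _ /=; rewrite -Bl.
Qed.

Lemma conv_linr a f g h k : conv h (a *: f + g) k = a *: conv h f k + conv h g k.
Proof.
rewrite !(@convE (lsupp h)); try by move=> m /lsuppP.
by rewrite scaler_sumr -big_split; apply: eq_bigr => m _ /=; rewrite -Br.
Qed.

Lemma conv_mono v m w n k :
  conv (mono v m) (mono w n) k = if k == m + n then B m v w else 0.
Proof.
rewrite (@convE [fset m]%fset); last by move=> p; rewrite inE lcoef_mono => /negPf->.
rewrite big_seq_fset1 !lcoef_mono eqxx subr_eq (addrC n).
by case: eqP => _; rewrite ?Bx0.
Qed.

Lemma conv_finsupp f g : finsupp_pred (conv f g).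
Proof.
pose A := [fset (m + n)%R | m in lsupp f, n in lsupp g]%fset.
apply/asboolP; apply: (@sub_finite_set _ _ [set` A]%classic); last exact: finite_fset.
move=> k /=; apply: contraR => kA; apply/eqP.
rewrite (@convE (lsupp f)); last by move=> m /lsuppP.
rewrite big1_seq // => m /andP[_ mf]; rewrite [lcoef g _]lsuppP ?Bx0 //.
apply: contra kA => kg; apply/imfset2P; exists m => //; exists (k - m) => //.
by rewrite addrC subrK.
Qed.

End Convolution.

(* The affine Lie algebra g (x) F[t, t^-1] + F k; the pair (f, c) stands for
   f + c k. *)
Definition affine (F : fieldType) (g : quadLieType F) : Type :=
  (loop g * F^o)%type.

Section Affine.
Variables (F : fieldType) (g : quadLieType F).
Local Notation T := (affine g).

HB.instance Definition _ := GRing.Lmodule.copy T (loop g * F^o)%type.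

Lemma affineP (x y : T) : x.1 = y.1 -> x.2 = y.2 -> x = y.
Proof. by case: x y => [? ?] [? ?] /= -> ->. Qed.

Definition affine_brcoef (_ : int) (x y : g) : g := [lie x, y].
Definition affine_cocoef (m : int) (x y : g) : F^o := m%:~R * iform x y.
Local Notation brB := affine_brcoef.
Local Notation coB := affine_cocoef.

Let brB_l m a x y z : brB m (a *: x + y) z = a *: brB m x z + brB m y z.
Proof. exact: bracket_linl. Qed.
Let brB_r m a x y z : brB m z (a *: x + y) = a *: brB m z x + brB m z y.
Proof. exact: bracket_linr. Qed.
Let coB_l m a x y z : coB m (a *: x + y) z = a *: coB m x z + coB m y z.
Proof. by rewrite /affine_cocoef iform_linl mulrDr; congr (_ + _); rewrite mulrCA. Qed.
Let coB_r m a x y z : coB m z (a *: x + y) = a *: coB m z x + coB m z y.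
Proof.
by rewrite /affine_cocoef !(iform_sym z) iform_linl mulrDr; congr (_ + _); rewrite mulrCA.
Qed.

Definition affine_loop_bracket (f h : loop g) : loop g :=
  exist (fun f => finsupp_pred f) (conv affine_brcoef f h)
    (conv_finsupp brB_l brB_r f h).

Fact loop_bracket_linl a f f' h : affine_loop_bracket (a *: f + f') h =
  a *: affine_loop_bracket f h + affine_loop_bracket f' h.
Proof. by apply: lcoefP => k; rewrite lcoefD lcoefZ; exact: (conv_linl brB_l). Qed.
Fact loop_bracket_linr a f f' h : affine_loop_bracket h (a *: f + f') =
  a *: affine_loop_bracket h f + affine_loop_bracket h f'.
Proof.
by apply: lcoefP => k; rewrite lcoefD lcoefZ; exact: (conv_linr brB_l brB_r).
Qed.

Definition affine_cocycle (f h : loop g) : F^o :=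
  conv affine_cocoef f h 0.

Definition affine_bracket (x y : T) : T :=
  (affine_loop_bracket x.1 y.1, affine_cocycle x.1 y.1).

Fact affine_linl (a : F) x y z :
  affine_bracket (a *: x + y) z = a *: affine_bracket x z + affine_bracket y z.
Proof.
apply: affineP; last exact: (conv_linl coB_l).
exact: loop_bracket_linl.
Qed.
Fact affine_linr (a : F) x y z :
  affine_bracket z (a *: x + y) = a *: affine_bracket z x + affine_bracket z y.
Proof.
apply: affineP; last exact: (conv_linr coB_l coB_r).
exact: loop_bracket_linr.
Qed.

Let affineDl x y z :
  affine_bracket (x + y) z = affine_bracket x z + affine_bracket y z.
Proof. by have := affine_linl 1 x y z; rewrite !scale1r. Qed.
Let affineDr x y z :
  affine_bracket z (x + y) = affine_bracket z x + affine_bracket z y.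
Proof. by have := affine_linr 1 x y z; rewrite !scale1r. Qed.
Let affine0l z : affine_bracket 0 z = 0.
Proof. by apply: (addrI (affine_bracket 0 z)); rewrite -affineDl !addr0. Qed.
Let affine0r z : affine_bracket z 0 = 0.
Proof. by apply: (addrI (affine_bracket z 0)); rewrite -affineDr !addr0. Qed.

(* a (x) t^m and the central element k *)
Definition amono (a : g) (m : int) : T := (mono a m, 0).
Definition kk : T := (0, 1).

Lemma affine_ind (P : T -> Prop) : P 0 -> (forall x y, P x -> P y -> P (x + y)) ->
  (forall a m, P (amono a m)) -> (forall c : F, P (c *: kk)) -> forall x, P x.
Proof.
move=> P0 PD Pm Pk [f c]; have -> : (f, c) = (f, 0) + c *: kk :> T.
  apply: affineP; first by rewrite /= scaler0 addr0.
  by rewrite /= add0r /GRing.scale /= mulr1.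
apply: (PD) => //; elim/(@loop_ind F g): f => [|f h Pf Ph|v m] //; last exact: Pm.
have -> : (f + h, 0) = ((f, 0) : T) + (h, 0) by apply: affineP; rewrite //= addr0.
exact: PD.
Qed.

Lemma affine_bracket_mono a m b n : affine_bracket (amono a m) (amono b n) =
  amono [lie a, b] (m + n)
    + (if m + n == 0 then m%:~R * iform a b else 0) *: kk.
Proof.
apply: affineP.
  apply: lcoefP => k; rewrite /= scaler0 addr0 lcoef_mono.
  exact: (conv_mono brB_l brB_r).
rewrite /= add0r /GRing.scale /= mulr1.
by rewrite /affine_cocycle (conv_mono coB_l coB_r) eq_sym.
Qed.

Let affine_br0 x y : x.1 = 0 -> affine_bracket x y = 0.
Proof.
move=> x0; rewrite (_ : affine_bracket x y = affine_bracket 0 y) //.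
by rewrite /affine_bracket x0.
Qed.
Let affine_br0r x y : y.1 = 0 -> affine_bracket x y = 0.
Proof.
move=> y0; rewrite (_ : affine_bracket x y = affine_bracket x 0) //.
by rewrite /affine_bracket y0.
Qed.
Let kk1 (c : F) : (c *: kk).1 = 0.
Proof. by rewrite /= scaler0. Qed.

Let affineC x y : affine_bracket x y + affine_bracket y x = 0.
Proof.
elim/affine_ind: x => [|x1 x2 h1 h2|a m|c].
- by rewrite affine0l affine0r addr0.
- by rewrite affineDl affineDr addrACA h1 h2 addr0.
- elim/affine_ind: y => [|y1 y2 h1 h2|b n|c].
  + by rewrite affine0l affine0r addr0.
  + by rewrite affineDl affineDr addrACA h1 h2 addr0.
  + rewrite !affine_bracket_mono [n + m]addrC addrACA -scalerDl.
    rewrite [X in X *: _](_ : _ = 0) ?scale0r ?addr0.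
      apply: affineP; rewrite /= ?addr0 //.
      apply: lcoefP => k; rewrite lcoefD !lcoef_mono lcoef0.
      by case: eqP => _; rewrite ?addr0 // (bracketC a) addrN.
    case: eqP => [/eqP|_]; last by rewrite addr0.
    by rewrite addr_eq0 => /eqP ->; rewrite (iform_sym b) rmorphN /= mulNr addNr.
  + by rewrite affine_br0r // affine_br0 // addr0.
- by rewrite affine_br0 // affine_br0r // addr0.
Qed.

Fact affine_xx x : affine_bracket x x = 0.
Proof.
elim/affine_ind: x => [|x y hx hy|a m|c].
- exact: affine0l.
- by rewrite affineDl !affineDr hx hy add0r addr0 affineC.
- rewrite affine_bracket_mono bracketxx.
  rewrite (_ : (if _ then _ else _) = 0).
    rewrite scale0r addr0; apply: affineP => //.
    by apply: lcoefP => k; rewrite lcoef_mono lcoef0 if_same.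
  case: eqP => // /eqP; rewrite -mulr2n mulrn_eq0 /= => /eqP ->.
  by rewrite mul0r.
- exact: affine_br0.
Qed.

Fact affine_jacobi x y z :
  affine_bracket x (affine_bracket y z) + affine_bracket y (affine_bracket z x)
    + affine_bracket z (affine_bracket x y) = 0.
Proof.
pose J x y z := affine_bracket x (affine_bracket y z)
  + affine_bracket y (affine_bracket z x)
  + affine_bracket z (affine_bracket x y).
rewrite -/(J x y z).
have JC u v w : J u v w = J v w u by rewrite /J -addrA addrC.
have J0 u v : J 0 u v = 0 by rewrite /J !(affine0l, affine0r) !addr0.
have JD u u' v w : J (u + u') v w = J u v w + J u' v w.
  rewrite /J !(affineDl, affineDr).
  by rewrite (addrACA (affine_bracket u _)) [LHS]addrACA.
have Jk (c : F) v w : J (c *: kk) v w = 0.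
  rewrite /J affine_br0 // (affine_br0r w) // (affine_br0 v) //.
  by rewrite !affine0r !addr0.
elim/affine_ind: x => [|x1 x2 h1 h2|a m|c]; rewrite ?J0 ?JD ?h1 ?h2 ?addr0 ?Jk //.
rewrite JC; elim/affine_ind: y => [|x1 x2 h1 h2|b n|c];
  rewrite ?J0 ?JD ?h1 ?h2 ?addr0 ?Jk //.
rewrite JC; elim/affine_ind: z => [|x1 x2 h1 h2|c p|c];
  rewrite ?J0 ?JD ?h1 ?h2 ?addr0 ?Jk //.
have E (u v w : g) i j k : affine_bracket (amono u i) (affine_bracket (amono v j) (amono w k))
   = amono [lie u, [lie v, w]] (i + (j + k))
     + (if i + (j + k) == 0 then i%:~R * iform u [lie v, w] else 0) *: kk.
  by rewrite affine_bracket_mono affineDr (affine_br0r _ (kk1 _)) addr0 affine_bracket_mono.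
rewrite /J !E.
have -> : m + (n + p) = p + (m + n) by rewrite addrC -addrA addrC -addrA.
have -> : n + (p + m) = p + (m + n) by rewrite addrCA [n + m]addrC.
have f1 : iform a [lie b, c] = iform c [lie a, b].
  by rewrite -iform_inv iform_sym.
have f2 : iform b [lie c, a] = iform c [lie a, b].
  by rewrite -iform_inv iform_sym -iform_inv iform_sym.
rewrite f1 f2.
apply: affineP.
  apply: lcoefP => k; rewrite /= !scaler0 !addr0 !lcoefD !lcoef_mono lcoef0.
  by case: eqP => _; rewrite ?addr0 // jacobi.
rewrite /= !add0r /GRing.scale /= !mulr1.
case: eqP => [pmn|_]; last by rewrite !addr0.
rewrite -!mulrDl -!rmorphD /= (_ : p + m + n = 0) ?mul0r //.
by rewrite -addrA.
Qed.

HB.instance Definition _ :=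
  isLieAlgebra.Build F T affine_linl affine_linr affine_xx affine_jacobi.

Lemma bracket_amono (a b : g) m n : [lie amono a m, amono b n] =
  amono [lie a, b] (m + n)
    + (if m + n == 0 then m%:~R * iform a b else 0) *: kk.
Proof. exact: affine_bracket_mono. Qed.

Lemma kk_central : lie_central kk.
Proof. by move=> x; apply: affine_br0. Qed.

End Affine.

(* The loop algebra of a subalgebra of g, extended by F k. *)
Section AffineSub.
Variables (F : fieldType) (g : quadLieType F) (P : subalg g).

Definition affine_sub_pred : {pred affine g} :=
  [pred x : affine g | `[< forall m, lcoef x.1 m \in subalg_pred P >]].
Fact affine_sub_submod : submod_closed affine_sub_pred.
Proof.
split; first by apply/asboolP => m; rewrite lcoef0 rpred0.
move=> a x y /asboolP hx /asboolP hy; apply/asboolP => m.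
by rewrite lcoefD lcoefZ rpredD ?rpredZ.
Qed.
Fact affine_sub_bracket :
  {in affine_sub_pred &, forall x y, [lie x, y] \in affine_sub_pred}.
Proof.
move=> x y /asboolP hx /asboolP hy; apply/asboolP => m.
rewrite /= /lcoef /= (@convE _ _ _ _ _ (lsupp x.1)).
- by apply: rpred_sum => n _; apply: subalg_bracket.
- by move=> *; apply: bracket_linl.
- by move=> ? /lsuppP.
Qed.
Definition affine_sub := Subalg affine_sub_submod affine_sub_bracket.

Lemma kk_affine_sub : kk g \in subalg_pred affine_sub.
Proof. by apply/asboolP => m; rewrite lcoef0 rpred0. Qed.

End AffineSub.

Definition gl (F : fieldType) (N : nat) : Type := 'M[F]_N.

Section Gl.
Variables (F : fieldType) (N : nat).
Local Notation T := (gl F N).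

HB.instance Definition _ := GRing.Lmodule.copy T 'M[F]_N.

Definition gl_bracket (A B : T) : T := A *m B - B *m A.
Definition gl_form (A B : T) : F := \tr (A *m B).

Fact gl_linl (a : F) A B C :
  gl_bracket (a *: A + B) C = a *: gl_bracket A C + gl_bracket B C.
Proof.
rewrite /gl_bracket mulmxDl mulmxDr -scalemxAl -scalemxAr scalerBr opprD.
by rewrite addrACA.
Qed.
Fact gl_linr (a : F) A B C :
  gl_bracket C (a *: A + B) = a *: gl_bracket C A + gl_bracket C B.
Proof.
rewrite /gl_bracket mulmxDl mulmxDr -scalemxAl -scalemxAr scalerBr opprD.
by rewrite addrACA.
Qed.
Fact gl_xx A : gl_bracket A A = 0.
Proof. exact: addrN. Qed.
Fact gl_jacobi A B C : gl_bracket A (gl_bracket B C)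
  + gl_bracket B (gl_bracket C A) + gl_bracket C (gl_bracket A B) = 0.
Proof.
rewrite /gl_bracket !(mulmxBl, mulmxBr) !mulmxA.
set x1 := A *m B *m C; set x2 := A *m C *m B; set x3 := B *m C *m A.
set x4 := C *m B *m A; set x5 := B *m A *m C; set x6 := C *m A *m B.
by apply/matrixP => i j; rewrite !mxE; ring.
Qed.
HB.instance Definition _ :=
  isLieAlgebra.Build F T gl_linl gl_linr gl_xx gl_jacobi.

Fact gl_form_linl (a : F) A B C :
  gl_form (a *: A + B) C = a * gl_form A C + gl_form B C.
Proof. by rewrite /gl_form mulmxDl -scalemxAl mxtraceD mxtraceZ. Qed.
Fact gl_form_sym A B : gl_form A B = gl_form B A.
Proof. exact: mxtrace_mulC. Qed.
Fact gl_form_inv A B C : gl_form [lie A, B] C = gl_form A [lie B, C].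
Proof.
rewrite /gl_form /= /bracket /= /gl_bracket mulmxBl mulmxBr !raddfB /=.
by rewrite -!mulmxA; congr (_ - _); rewrite mxtrace_mulC mulmxA.
Qed.
HB.instance Definition _ :=
  hasInvariantForm.Build F T gl_form_linl gl_form_sym gl_form_inv.

Definition sl_pred : {pred T} := [pred A : T | \tr (A : 'M_N) == 0].
Fact sl_submod : submod_closed sl_pred.
Proof.
split; first by rewrite inE mxtrace0.
move=> a A B; rewrite !inE => /eqP hA /eqP hB.
by rewrite mxtraceD mxtraceZ hA hB mulr0 addr0.
Qed.
Fact sl_bracket : {in sl_pred &, forall A B, [lie A, B] \in sl_pred}.
Proof.
move=> A B _ _; rewrite inE /bracket /= /gl_bracket raddfB /= mxtrace_mulC.
by rewrite subrr.
Qed.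
Definition sl := Subalg sl_submod sl_bracket.

Definition scalar_pred : {pred T} := [pred A : T | is_scalar_mx (A : 'M_N)].
Fact scalar_submod : submod_closed scalar_pred.
Proof.
split; first by apply/is_scalar_mxP; exists 0; rewrite raddf0.
move=> a A B /is_scalar_mxP[b ->] /is_scalar_mxP[c ->].
by apply/is_scalar_mxP; exists (a * b + c); rewrite raddfD /= scale_scalar_mx.
Qed.
Fact scalar_bracket : {in scalar_pred &, forall A B, [lie A, B] \in scalar_pred}.
Proof.
move=> A B /is_scalar_mxP[b ->] /is_scalar_mxP[c ->].
apply/is_scalar_mxP; exists 0.
by rewrite /bracket /= /gl_bracket scalar_mxC subrr raddf0.
Qed.
(* The centre h = F I of gl_N. *)
Definition scalars := Subalg scalar_submod scalar_bracket.

Definition tauhat_loop (f : loop T) : int -> T :=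
  fun m => - ((-1) ^ m *: ((lcoef f m : 'M_N)^T : T)).

Fact tauhat_finsupp f : finsupp_pred (tauhat_loop f).
Proof.
apply/asboolP; apply: sub_finite_set (asboolP _ (valP f)) => m /=.
apply: contra => /eqP fm; rewrite /tauhat_loop (_ : lcoef f m = 0) //.
by rewrite trmx0 scaler0 oppr0.
Qed.

(* E_ij (x) t^m |-> - (-1)^m E_ji (x) t^m,  k |-> k *)
Definition tauhat_fun (x : affine T) : affine T :=
  (exist (fun f => finsupp_pred f) _ (tauhat_finsupp x.1), x.2).

Lemma tauhat_coef (x : affine T) m :
  lcoef (tauhat_fun x).1 m = - ((-1) ^ m *: ((lcoef x.1 m : 'M_N)^T : T)).
Proof. by []. Qed.

Fact tauhat_linear : linear tauhat_fun.
Proof.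
move=> a x y; apply: affineP => //; apply: lcoefP => m.
rewrite lcoefD lcoefZ /lcoef /= /tauhat_loop lcoefD lcoefZ.
by rewrite linearP /= scalerDr opprD scalerN !scalerA mulrC.
Qed.
HB.instance Definition _ := GRing.isLinear.Build F (affine T) (affine T) _
  tauhat_fun tauhat_linear.

Let tm (a : T) m :
  tauhat_fun (amono a m) = - (-1) ^ m *: amono ((a : 'M_N)^T : T) m.
Proof.
apply: affineP; last by rewrite /= scaler0.
apply: lcoefP => k; rewrite lcoefZ tauhat_coef !lcoef_mono.
case: eqP => [->|_]; first by rewrite scaleNr.
by rewrite trmx0 !scaler0 oppr0.
Qed.
Let tk (c : F) : tauhat_fun (c *: kk T) = c *: kk T.
Proof.
apply: affineP => //; apply: lcoefP => k.
have -> : (c *: kk T).1 = 0 by rewrite /= scaler0.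
by rewrite tauhat_coef /= scaler0 lcoef0 trmx0 scaler0 oppr0.
Qed.

Fact tauhat_bracket x y :
  tauhat_fun [lie x, y] = [lie tauhat_fun x, tauhat_fun y].
Proof.
elim/affine_ind: x => [|x1 x2 h1 h2|a m|c].
- by rewrite linear0 !bracket0x linear0.
- by rewrite bracketDl !linearD /= bracketDl h1 h2.
- elim/affine_ind: y => [|x1 x2 h1 h2|b n|c].
  + by rewrite linear0 !bracketx0 linear0.
  + by rewrite bracketDr !linearD /= bracketDr h1 h2.
  + rewrite bracket_amono linearD /= !tm tk bracketZl bracketZr bracket_amono.
    rewrite scalerA mulrNN -expfzDr ?oppr_eq0 ?oner_eq0 // scalerDr; congr (_ + _).
      rewrite scaleNr -scalerN; congr (_ *: _); apply: affineP; last by rewrite /= oppr0.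
      apply: lcoefP => k; rewrite -scaleN1r lcoefZ !lcoef_mono.
      case: eqP => _; rewrite ?scaler0 // scaleN1r.
      by rewrite /bracket /= /gl_bracket linearB /= !trmx_mul opprB.
    rewrite scalerA; congr (_ *: _); case: eqP => [->|_]; last by rewrite mulr0.
    by rewrite expr0z mul1r /iform /= /gl_form -trmx_mul mxtrace_tr mxtrace_mulC.
  + by rewrite tk bracketC bracketZl kk_central scaler0 oppr0 linear0
       bracketC bracketZl kk_central scaler0 oppr0.
- by rewrite tk !bracketZl !kk_central !scaler0 linear0.
Qed.

Definition tauhat : lieHom (affine T) (affine T) :=
  @LieHom F (affine T) (affine T) tauhat_fun tauhat_bracket.

Lemma tauhat_amono (a : T) m :
  tauhat (amono a m) = - (-1) ^ m *: amono ((a : 'M_N)^T : T) m.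
Proof. exact: tm. Qed.
Lemma tauhat_kk : tauhat (kk T) = kk T.
Proof. by rewrite -[kk T]scale1r; apply: tk. Qed.

(* For a subalgebra P of gl_N: the fixed points of tauhat in the affine Lie
   algebra of P, which is stable under tauhat for the P used here. *)
Definition twisted_affine (P : subalg T) : subalg (affine T) :=
  cap_subalg (affine_sub P) (fixed_subalg tauhat).

Fact kk_twisted P : kk T \in subalg_pred (twisted_affine P).
Proof. by rewrite inE kk_affine_sub inE tauhat_kk eqxx. Qed.
Definition twisted_kk P : sub_lie (twisted_affine P) :=
  exist (fun x => subalg_pred (twisted_affine P) x) (kk T) (kk_twisted P).

End Gl.

Record linear_char (F : fieldType) (S : zmodType) := LinearChar {
  char_fun :> S -> F;
  char_neq0 : forall x, char_fun x != 0;
  charD : forall x y, char_fun (x + y) = char_fun x * char_fun y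
}.

Inductive trig_gen (S : Type) := TrigC | TrigA of S & int.
Arguments TrigC {S}.

Section Trig.
Variables (F : fieldType) (S : zmodType) (chi : linear_char F S).
Local Notation term := (lterm F (trig_gen S)).
Local Notation A x m := (LVar (TrigA x m) : term).
Local Notation c := (LVar TrigC : term).

Inductive trig_rel : term -> term -> Prop :=
| trig_central x m : trig_rel (LBr c (A x m)) LZero
| trig_bracket x m y n : trig_rel (LBr (A x m) (A y n))
    (LAdd (LScale (chi (y *~ m - x *~ n) - chi (x *~ n - y *~ m))
                  (A (x + y) (m + n)))
          (LScale (m%:~R * ((x + y == 0) && (m + n == 0))%:R) c)).

Definition trigA : Type := presented trig_rel.
HB.instance Definition _ := LieAlgebra.on trigA.

Definition tA (x : S) (m : int) : trigA := pres_gen trig_rel (TrigA x m).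
Definition tc : trigA := pres_gen trig_rel TrigC.

Lemma tA_bracket x m y n : [lie tA x m, tA y n] =
  (chi (y *~ m - x *~ n) - chi (x *~ n - y *~ m)) *: tA (x + y) (m + n)
    + (m%:~R * ((x + y == 0) && (m + n == 0))%:R) *: tc.
Proof. exact: (pres_rel (trig_bracket x m y n)). Qed.
Lemma tc_bracket x m : [lie tc, tA x m] = 0.
Proof. exact: (pres_rel (trig_central x m)). Qed.

Lemma char0 : chi 0 = 1.
Proof.
apply: (mulfI (char_neq0 chi 0)).
by rewrite -charD mulr1 addr0.
Qed.

Section Aut.
Variable s : S -> int -> F.
Hypothesis sD : forall x m y n, s x m * s y n = - s (x + y) (m + n).
Hypothesis s0 : s 0 0 = -1.

Definition trig_aut_gen (u : trig_gen S) : trigA :=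
  match u with TrigC => tc | TrigA x m => s x m *: tA (- x) m end.

Lemma trig_aut_rel r t : trig_rel r t ->
  leval trig_aut_gen r = leval trig_aut_gen t.
Proof.
case=> [x m|x m y n] /=; first by rewrite bracketZr tc_bracket scaler0.
rewrite bracketZl bracketZr tA_bracket scalerA sD scalerDr !scalerA.
have -> : (- y) *~ m - (- x) *~ n = x *~ n - y *~ m.
  by rewrite !mulNrz opprK addrC.
have -> : (- x) *~ n - (- y) *~ m = y *~ m - x *~ n.
  by rewrite !mulNrz opprK addrC.
rewrite -opprD oppr_eq0 mulNr -mulrN opprB; congr (_ *: _ + _ *: _).
  exact: mulrC.
case: eqP => [->|_] /=; last by rewrite !mulr0.
case: eqP => [->|_] /=; last by rewrite !mulr0.
by rewrite s0 opprK mul1r.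
Qed.

Definition trig_aut : lieHom trigA trigA := pres_lift trig_aut_rel.

End Aut.

Definition tauB_coef (_ : S) (m : int) : F := - (-1) ^ m.
Definition tauD_coef (x : S) (_ : int) : F := - chi (x *+ 2).

Fact tauB_coefD x m y n :
  tauB_coef x m * tauB_coef y n = - tauB_coef (x + y) (m + n).
Proof. by rewrite /tauB_coef mulrNN opprK -expfzDr // oppr_eq0 oner_eq0. Qed.
Fact tauB_coef0 : tauB_coef 0 0 = -1.
Proof. by rewrite /tauB_coef expr0z. Qed.
Fact tauD_coefD x m y n :
  tauD_coef x m * tauD_coef y n = - tauD_coef (x + y) (m + n).
Proof. by rewrite /tauD_coef mulrNN opprK mulrnDl [RHS]charD. Qed.
Fact tauD_coef0 : tauD_coef 0 0 = -1.
Proof. by rewrite /tauD_coef mul0rn char0. Qed.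

Definition tauB := trig_aut tauB_coefD tauB_coef0.
Definition tauD := trig_aut tauD_coefD tauD_coef0.

Lemma tauB_A x m : tauB (tA x m) = - (-1) ^ m *: tA (- x) m.
Proof. exact: pres_liftE. Qed.
Lemma tauB_c : tauB tc = tc.
Proof. exact: pres_liftE. Qed.
Lemma tauD_A x m : tauD (tA x m) = - chi (x *+ 2) *: tA (- x) m.
Proof. exact: pres_liftE. Qed.
Lemma tauD_c : tauD tc = tc.
Proof. exact: pres_liftE. Qed.

Definition trigB := fixed_subalg tauB.
Definition trigD := fixed_subalg tauD.

End Trig.

Section KacMoody.
Variables (F : fieldType) (n : nat) (A : 'M[int]_n).

Definition km_mx : 'M[F]_n := map_mx intr A.

(* The realization (h, roots, coroots) of A on h = F^n + F^(n - rank A): the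
   coroots are the first n vectors of the canonical basis, and the roots are the
   columns of the matrix obtained by stacking, below A, a basis of a complement
   of its row space. *)
Definition km_dim : nat := (n + \rank (km_mx^C)%MS)%N.
Definition km_coroot (i : 'I_n) : 'rV[F]_km_dim := delta_mx 0 (lshift _ i).
Definition km_root_mx : 'M[F]_(km_dim, n) := col_mx km_mx (row_base (km_mx^C)%MS).
Definition km_root (j : 'I_n) (h : 'rV[F]_km_dim) : F := (h *m km_root_mx) 0 j.

Lemma km_root_coroot i j : km_root j (km_coroot i) = (A i j)%:~R.
Proof.
rewrite /km_root /km_coroot -rowE mxE /km_root_mx col_mxEu.
by rewrite mxE.
Qed.
Lemma km_dimE : (km_dim + \rank km_mx = n.*2)%N.
Proof. by rewrite /km_dim mxrank_compl -addnA subnK ?rank_leq_row ?addnn. Qed.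
Lemma km_root_free : row_free (km_root_mx^T).
Proof.
have full : \rank (km_mx + km_mx^C)%MS = n.
  exact/eqP/(addsmx_compl_full km_mx).
rewrite /row_free mxrank_tr /km_root_mx -addsmxE -[X in _ == X]full.
apply/eqP/eqmx_rank/eqmxP/adds_eqmx; first exact: eqmx_refl.
exact: eq_row_base.
Qed.

Inductive km_gen := KmH of 'rV[F]_km_dim | KmE of 'I_n | KmF of 'I_n.
Local Notation term := (lterm F km_gen).
Local Notation H h := (LVar (KmH h) : term).
Local Notation E i := (LVar (KmE i) : term).
Local Notation f i := (LVar (KmF i) : term).

Inductive km_rel : term -> term -> Prop :=
| km_lin a h h' : km_rel (H (a *: h + h')) (LAdd (LScale a (H h)) (H h'))
| km_hh h h' : km_rel (LBr (H h) (H h')) LZero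
| km_ef i j : km_rel (LBr (E i) (f j)) (if i == j then H (km_coroot i) else LZero)
| km_he h i : km_rel (LBr (H h) (E i)) (LScale (km_root i h) (E i))
| km_hf h i : km_rel (LBr (H h) (f i)) (LScale (- km_root i h) (f i)).

Definition km_tilde : Type := presented km_rel.
HB.instance Definition _ := LieAlgebra.on km_tilde.

(* The maximal ideal that intersects h trivially is obtained as the sum of all
   such ideals. *)
Definition km_radical : ideal km_tilde := ideal_sum (fun I : ideal km_tilde =>
  forall h, pres_gen km_rel (KmH h) \in ideal_pred I ->
    pres_gen km_rel (KmH h) = 0).

Definition kac_moody : Type := quot_lie km_radical.
HB.instance Definition _ := LieAlgebra.on kac_moody.

Definition km_derived : subalg kac_moody := derived_subalg kac_moody.

End KacMoody.

(* The generalized Cartan matrix 2 (a_i, a_j) / (a_i, a_i) of vectors a_i of the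
   lattice Z^l with its standard form. *)
Definition cartan_of (l n : nat) (a : 'I_n -> 'rV[int]_l) : 'M[int]_n :=
  let dot i j := (a i *m (a j)^T) 0 0 in
  \matrix_(i, j) ((2 * dot i j) %/ dot i i)%Z.

(* The k-th basis vector of Z^l; it is 0 for k >= l. *)
Definition eps (l k : nat) : 'rV[int]_l := \row_(j < l) (j == k :> nat)%:R.

(* a_0 = - theta with theta the highest root of B_l, and a_1, ..., a_l the simple
   roots of B_l. As eps l l = 0, this gives a_l = eps_{l-1} (the basis being
   numbered from 0), and theta = eps_0 when l = 1, so that B_1^(1) = A_1^(1). *)
Definition cartan_B1 (l : nat) : 'M[int]_l.+1 :=
  cartan_of (fun i : 'I_l.+1 =>
    if i == 0 :> nat then - (eps l 0 + eps l 1) else eps l i.-1 - eps l i).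

(* The finite parts of the simple roots, with the numbering in which a_0 is the
   shortest root: - eps_0, then the simple roots of C_l. *)
Definition cartan_A2l2 (l : nat) : 'M[int]_l.+1 :=
  cartan_of (fun i : 'I_l.+1 =>
    if i == 0 :> nat then - eps l 0
    else if i == l :> nat then 2 *: eps l l.-1 else eps l i.-1 - eps l i).

(* Main.v *)
From HB Require Import structures.
Require Import Defs.
From mathcomp Require Import all_boot all_order all_fingroup all_algebra all_solvable.
From mathcomp Require Import generic_quotient ring_quotient.
From mathcomp Require Import boolp classical_sets cardinality fsbigop.
From mathcomp Require Import reals complex ssrAC finmap ring zify.
Set Implicit Arguments.
Unset Strict Implicit.
Unset Printing Implicit Defensive.
Import Order.TTheory GRing.Theory Num.Theory.
Local Open Scope ring_scope.

(** The elements A_{alpha,m} are Fourier transforms of a basis of the affine algebra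
    of gl_N. View gl_N[t, t^-1] as the algebra of N-periodic infinite matrices, and
    let x p m be the matrix unit at (p, p + m) with all its N-translates; m is its
    degree for the principal gradation. After a central correction in degree 0,
      [x p m, x q n] = [q = p + m] x p (m + n) - [p = q + n] x q (m + n)
                       + [m + n = 0] [q = p + m] (m / N) k,
    the indices being read modulo N (x_bracket). For any integer u, the sums of
    chi (alpha (2p + u + m)) x p m over p satisfy the relations of the A_{alpha,m}
    (trig_image_bracket). The characters alpha |-> chi (2p alpha) are pairwise
    distinct and exhaust the dual of S, as chi is injective and N odd; so the
    Fourier transform can be inverted, and (1) holds (fourier_iso).

    For eps = 1 and eps = -1, the map tau : x p m |-> - eps^m x (-1 - p - m) m is an
    automorphism, namely minus the adjoint for a symmetric antidiagonal form J,
    with a sign (tau_x). The choice u = 1 transports tau_B to tau with eps = -1, and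
    u = 2 transports tau_D to tau with eps = 1 (tau_trig_image). A factorization
    J = P P^T conjugates tau with eps = -1 to the transposition defining tauhat
    (orth_tauhat), which gives the first half of (2).

    It remains to recognize the fixed points of tau with traceless coefficients,
    called folded below, as derived Kac-Moody algebras. A general criterion
    (km_derived_lieIso) asks for generators e i, f i with the right Cartan elements,
    inside an algebra extended by a derivation, and for a reason why the
    ideals that meet the Cartan subalgebra trivially vanish. The symmetrizations
    w p m of the x p m are the root vectors. An induction on the degree shows that
    they are generated by those of the simple roots (folded_generated). An ideal
    that meets the Cartan subalgebra trivially consists of elements without central
    component, while the bracket of an element with the conjugate transpose of one
    of its coefficients has a nonzero central component, by positivity
    (folded_simple). For eps = 1 the simple roots are those of B_l^(1), and for
    eps = -1 those of A_2l^(2) (folded_B1, folded_A2l2).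

    For eps = 1 every fixed point is traceless, hence (3). For eps = -1, splitting
    a matrix into its traceless and scalar parts decomposes the fixed points into
    two commuting subalgebras that share only the line of k, which is the second
    half of (2) (fixed_quotient). *)

(** * Homomorphisms, isomorphisms and quotients of Lie algebras *)

Section Isomorphisms.
Variable F : fieldType.

Section BuildHom.
Variables (L M : lieType F) (f : L -> M).
Hypothesis f_linear : linear f.
Hypothesis f_bracket : forall x y, f [lie x, y] = [lie f x, f y].

Definition lin_fun of linear f := f.
HB.instance Definition _ :=
  GRing.isLinear.Build F L M _ (lin_fun f_linear) f_linear.

Definition build_lieHom : lieHom L M :=
  @LieHom F L M (lin_fun f_linear) f_bracket.
End BuildHom.

Lemma bijective_lieIso (L M : lieType F) (h : lieHom L M) :
  injective h -> (forall y, exists x, h x = y) -> L ~=L M.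
Proof.
move=> h_inj h_surj; have [g gP] := choice h_surj.
by constructor; apply: (@LieIso _ _ _ h g) => x; [apply: h_inj|]; rewrite gP.
Qed.

Lemma lieIso_trans (L M K : lieType F) : L ~=L M -> M ~=L K -> L ~=L K.
Proof.
move=> [f] [g].
have gfB x y : g (f [lie x, y]) = [lie g (f x), g (f y)].
  by rewrite !hom_bracket.
have gfl : linear (g \o f) by move=> a x y; rewrite /= !linearP.
apply: (@bijective_lieIso _ _ (build_lieHom gfl gfB)) => [|z] /=.
  exact: inj_comp (can_inj (iso_homK g)) (can_inj (iso_homK f)).
exists (iso_inv f (iso_inv g z)).
exact: etrans (congr1 g (iso_invK f _)) (iso_invK g z).
Qed.

Lemma lieIso_sym (L M : lieType F) : L ~=L M -> M ~=L L.
Proof.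
case=> f; have fi := can_inj (iso_homK f).
have gl : linear (iso_inv f).
  by move=> a x y; apply: fi; rewrite linearP !iso_invK.
have gB x y : iso_inv f [lie x, y] = [lie iso_inv f x, iso_inv f y].
  by apply: fi; rewrite hom_bracket /= !iso_invK.
apply: (@bijective_lieIso _ _ (build_lieHom gl gB)) => [|x].
  exact: can_inj (iso_invK f).
by exists (f x); apply: iso_homK.
Qed.

(** Most of the isomorphisms below are restrictions of a homomorphism between
    ambient algebras to subalgebras of them. *)
Lemma subalg_lieIso (L M : lieType F) (h : lieHom L M) (P : subalg L)
    (Q : subalg M) : injective h ->
  (forall x, x \in subalg_pred P -> h x \in subalg_pred Q) ->
  (forall y, y \in subalg_pred Q -> exists2 x, x \in subalg_pred P & h x = y) ->
  sub_lie P ~=L sub_lie Q.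
Proof.
move=> h_inj hPQ hQP.
pose g (x : sub_lie P) : sub_lie Q :=
  exist (fun y => subalg_pred Q y) (h (val x)) (hPQ _ (valP x)).
have gl : linear g by move=> a x y; apply: val_inj; rewrite /= linearP.
have gB x y : g [lie x, y] = [lie g x, g y].
  by apply: val_inj; rewrite /= hom_bracket.
apply: (@bijective_lieIso _ _ (build_lieHom gl gB)) => [x y xy|y].
  by apply/val_inj/h_inj; have := congr1 val xy.
have [x Px hx] := hQP _ (valP y).
by exists (exist (fun y => subalg_pred P y) x Px); apply: val_inj.
Qed.

Lemma fixed_lieIso (L M : lieType F) (h : lieIso L M) (s : lieHom L L)
    (t : lieHom M M) : (forall x, h (s x) = t (h x)) ->
  sub_lie (fixed_subalg s) ~=L sub_lie (fixed_subalg t).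
Proof.
move=> hst; have hi := can_inj (iso_homK h).
apply: (@subalg_lieIso _ _ h) => // [x|y]; rewrite !inE => /eqP xE.
  by rewrite -hst xE.
exists (iso_inv h y); last exact: iso_invK.
by rewrite inE; apply/eqP/hi; rewrite hst iso_invK.
Qed.

Section QuotientMap.
Variables (L M : lieType F) (I : ideal L) (h : lieHom L M).
Hypothesis hI : forall x, x \in ideal_pred I -> h x = 0.

Definition quot_map_fun (q : quot_lie I) : M :=
  h (repr (q : Quotient.quot (ideal_pred I))).

Lemma quot_map_pi x : quot_map_fun (quot_pi I x) = h x.
Proof.
apply/eqP; rewrite -subr_eq0 -linearB; apply/eqP/hI.
by apply/quot_piP; rewrite quot_piK.
Qed.

Local Ltac lift q := rewrite -[q]quot_piK; move: (repr _) => {}q.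

Fact quot_map_linear : linear quot_map_fun.
Proof.
move=> a p q; lift p; lift q; rewrite -[a *: _]quot_piZ -quot_piD !quot_map_pi.
exact: linearP.
Qed.
HB.instance Definition _ :=
  GRing.isLinear.Build F (quot_lie I) M _ quot_map_fun quot_map_linear.

Fact quot_map_bracket p q :
  quot_map_fun [lie p, q] = [lie quot_map_fun p, quot_map_fun q].
Proof.
lift p; lift q; rewrite -[[lie _, _]]quot_pi_bracket !quot_map_pi.
exact: hom_bracket.
Qed.

Definition quot_map : lieHom (quot_lie I) M :=
  @LieHom F (quot_lie I) M quot_map_fun quot_map_bracket.

Lemma quot_map_inj : (forall x, h x = 0 -> x \in ideal_pred I) ->
  injective quot_map.
Proof.
move=> hker p q; lift p; lift q => /=; rewrite !quot_map_pi => pq.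
by apply/quot_piP/hker; rewrite linearB pq subrr.
Qed.

End QuotientMap.
End Isomorphisms.

(** * Extension of a Lie algebra by a derivation *)

Section DerivationExtension.
Variables (F : fieldType) (L : lieType F) (D : {linear L -> L}).
Hypothesis D_bracket : forall x y : L, D [lie x, y] = [lie D x, y] + [lie x, D y].

(** The bracket hypothesis is a parameter of the type, so that the Lie structure
    below can be inferred from the type alone. *)
Definition dext of (forall x y : L, D [lie x, y] = [lie D x, y] + [lie x, D y])
  : Type := (L * F^o)%type.
Local Notation M := (dext D_bracket).

HB.instance Definition _ := GRing.Lmodule.copy M (L * F^o)%type.

Definition dext_bracket (x y : M) : M :=
  ([lie x.1, y.1] + (x.2 : F) *: D y.1 - (y.2 : F) *: D x.1, 0).

Fact dext_linl (a : F) x y z :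
  dext_bracket (a *: x + y) z = a *: dext_bracket x z + dext_bracket y z.
Proof.
congr pair; last by rewrite /= scaler0 addr0.
rewrite /= bracket_linl linearP scalerDl !scalerDr scalerN !scalerA.
rewrite [z.2 * a]mulrC opprD [in RHS]addrACA; congr (_ + _).
by rewrite addrACA.
Qed.
Fact dext_xx x : dext_bracket x x = 0.
Proof. by congr pair; rewrite /= bracketxx add0r subrr. Qed.

Let dext_alt x y : dext_bracket y x = - dext_bracket x y.
Proof.
congr pair; last by rewrite /= oppr0.
by rewrite /= bracketC !opprD opprK addrAC -addrA.
Qed.
Fact dext_linr (a : F) x y z :
  dext_bracket z (a *: x + y) = a *: dext_bracket z x + dext_bracket z y.
Proof.
by rewrite dext_alt dext_linl opprD -scalerN -!dext_alt.
Qed.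
Fact dext_jacobi x y z :
  dext_bracket x (dext_bracket y z) + dext_bracket y (dext_bracket z x)
    + dext_bracket z (dext_bracket x y) = 0.
Proof.
congr pair; last by rewrite /= !addr0.
case: x y z => [x a] [y b] [z c] /=.
rewrite !scale0r !subr0 !(linearB, linearD, linearZ) /=.
rewrite !(bracketDr, bracketNr, bracketZr, D_bracket).
rewrite !(scalerBr, scalerDr) !scalerA.
rewrite (bracketC x (D z)) (bracketC y (D x)) (bracketC z (D y)) !scalerN.
rewrite (mulrC b a) (mulrC c a) (mulrC c b).
have -> : [lie x, [lie y, z]] = - [lie y, [lie z, x]] - [lie z, [lie x, y]].
  by apply/eqP; rewrite -opprD -addr_eq0 addrA jacobi.
rewrite !(raddfN, scalerN) !addrA.
(* This order puts each term next to its opposite. *)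
rewrite (ACl (9*1*16*2*3*12*20*4*17*5*6*11*7*15*21*8*10*19*13*18*14*22)) /=.
by rewrite !addrK subrr.
Qed.

HB.instance Definition _ :=
  isLieAlgebra.Build F M dext_linl dext_linr dext_xx dext_jacobi.

Lemma dextP (x y : M) : x.1 = y.1 -> x.2 = y.2 -> x = y.
Proof. by case: x y => [? ?] [? ?] /= -> ->. Qed.

Lemma dext_bracketE (x y : M) :
  [lie x, y] = ([lie x.1, y.1] + (x.2 : F) *: D y.1 - (y.2 : F) *: D x.1, 0).
Proof. by []. Qed.

Definition dext_in_fun (x : L) : M := (x, 0).
Fact dext_in_linear : linear dext_in_fun.
Proof. by move=> a x y; congr pair; rewrite /= scaler0 addr0. Qed.
Fact dext_in_bracket x y :
  dext_in_fun [lie x, y] = [lie dext_in_fun x, dext_in_fun y].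
Proof. by rewrite dext_bracketE /= !scale0r addr0 subr0. Qed.

Definition dext_in : lieHom L M := build_lieHom dext_in_linear dext_in_bracket.

End DerivationExtension.

(** * Recognizing a derived Kac-Moody algebra *)

Lemma bracket_sumr (F : fieldType) (L : lieType F) (I : Type) (s : seq I)
    (P : pred I) (f : I -> L) x :
  [lie x, \sum_(i <- s | P i) f i] = \sum_(i <- s | P i) [lie x, f i].
Proof.
by apply: (big_morph (bracket x)) => [y z|]; [apply: bracketDr|apply: bracketx0].
Qed.
Lemma bracket_suml (F : fieldType) (L : lieType F) (I : Type) (s : seq I)
    (P : pred I) (f : I -> L) x :
  [lie \sum_(i <- s | P i) f i, x] = \sum_(i <- s | P i) [lie f i, x].
Proof.
apply: (big_morph (fun y => bracket y x)) => [y z|]; last exact: bracket0x.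
exact: bracketDl.
Qed.

(** The Jacobi identity, as the statement that brackets with x are derivations. *)
Lemma bracket_deriv (F : fieldType) (L : lieType F) (x y z : L) :
  [lie x, [lie y, z]] = [lie [lie x, y], z] + [lie y, [lie x, z]].
Proof.
apply/eqP; rewrite -subr_eq0 -(jacobi x y z) (bracketC z [lie x, y]).
by rewrite (bracketC z x) bracketNr opprD !opprK -addrA [X in _ + X]addrC.
Qed.

(** One triangular half of the algebra on Chevalley generators, the other half
    being the case where the roles of the E's and the F's are exchanged. *)
Section TriangularHalf.
Variables (F : fieldType) (G : lieType F) (d n : nat).
Variables (H : 'rV[F]_d -> G) (E E' : 'I_n -> G).
Variables (root : 'I_n -> 'rV[F]_d -> F) (coroot : 'I_n -> 'rV[F]_d).
Hypothesis H_lin : forall a h h', H (a *: h + h') = a *: H h + H h'.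
Hypothesis HE : forall h i, [lie H h, E i] = root i h *: E i.
Hypothesis EE' : forall i j,
  [lie E' j, E i] = if i == j then H (coroot i) else 0.

(** [raised k] is spanned by the brackets of k + 1 of the E's. *)
Inductive raised : nat -> G -> Prop :=
| raised_gen i : raised 0 (E i)
| raised_bracket i k y : raised k y -> raised k.+1 [lie E i, y]
| raised_lin a k x y : raised k x -> raised k y -> raised k (a *: x + y).

Lemma raised0 k x : raised k x -> raised k 0.
Proof. by move=> kx; rewrite -(addNr x) -scaleN1r; apply: raised_lin. Qed.

Lemma raisedZ k a x : raised k x -> raised k (a *: x).
Proof.
by move=> kx; rewrite -[_ *: _]addr0; apply: raised_lin => //; apply: raised0 kx.
Qed.

Lemma raisedD k x y : raised k x -> raised k y -> raised k (x + y).
Proof. by rewrite -{2}[x]scale1r; apply: raised_lin. Qed.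

Lemma H0 : H 0 = 0.
Proof. by have := H_lin (-1) 0 0; rewrite !scaleN1r oppr0 addr0 addNr. Qed.

Lemma HZ a h : H (a *: h) = a *: H h.
Proof. by have := H_lin a h 0; rewrite H0 !addr0. Qed.

Lemma raised_H h k y : raised k y -> raised k [lie H h, y].
Proof.
elim=> {k y} [i|i k y ky IH|a k x y kx IHx ky IHy].
- by rewrite HE; apply/raisedZ/raised_gen.
- rewrite bracket_deriv HE bracketZl.
  by apply: raised_lin; apply: raised_bracket.
- by rewrite bracket_linr; apply: raised_lin.
Qed.

Lemma raised_lower j k y : raised k y ->
  if k is k'.+1 then raised k' [lie E' j, y] else exists h, [lie E' j, y] = H h.
Proof.
elim=> {k y} [i|i k y ky IH|a [|k] x y kx IHx ky IHy].
- rewrite EE'; case: eqP => _; first by exists (coroot i).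
  by exists 0; rewrite H0.
- rewrite bracket_deriv EE'; apply: raisedD.
    by case: eqP => _; [apply: raised_H|rewrite bracket0x; apply: raised0 ky].
  case: k ky IH => [|k] ky IH; last exact: raised_bracket.
  have [h ->] := IH; rewrite bracketC HE -scaleNr.
  exact/raisedZ/raised_gen.
- have [h hx] := IHx; have [h' hy] := IHy; exists (a *: h + h').
  by rewrite bracket_linr hx hy H_lin.
- by rewrite bracket_linr; apply: raised_lin.
Qed.

Lemma raised_degree h s k y : (forall i, root i h = s) -> raised k y ->
  [lie H h, y] = (s *+ k.+1) *: y.
Proof.
move=> hs; elim=> {k y} [i|i k y ky IH|a k x y kx IHx ky IHy].
- by rewrite HE hs.
- by rewrite bracket_deriv HE hs IH bracketZl bracketZr -scalerDl -mulrS.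
- by rewrite bracket_linr IHx IHy scalerDr !scalerA mulrC.
Qed.

End TriangularHalf.

Section Criterion.
Variables (F : numFieldType) (n : nat) (A : 'M[int]_n).
Local Notation Gt := (km_tilde F A).
Local Notation d := (km_dim F A).

Local Notation rel := (@km_rel F n A).
Definition kmH (h : 'rV[F]_d) : Gt := pres_gen rel (KmH h).
Definition kmE (i : 'I_n) : Gt := pres_gen rel (KmE F A i).
Definition kmF (i : 'I_n) : Gt := pres_gen rel (KmF F A i).

Lemma kmH_lin a h h' : kmH (a *: h + h') = a *: kmH h + kmH h'.
Proof. exact: (pres_rel (km_lin a h h')). Qed.
Lemma kmHH h h' : [lie kmH h, kmH h'] = 0.
Proof. exact: (pres_rel (km_hh h h')). Qed.
Lemma kmEF i j : [lie kmE i, kmF j] = if i == j then kmH (km_coroot F A i) else 0.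
Proof. by have /= -> := pres_rel (km_ef F A i j); case: eqP. Qed.
Lemma kmHE h i : [lie kmH h, kmE i] = km_root i h *: kmE i.
Proof. exact: (pres_rel (km_he h i)). Qed.
Lemma kmHF h i : [lie kmH h, kmF i] = - km_root i h *: kmF i.
Proof. exact: (pres_rel (km_hf h i)). Qed.

Lemma kmFE i j : [lie kmF j, kmE i] = if i == j then kmH (- km_coroot F A i) else 0.
Proof.
rewrite bracketC kmEF; case: eqP => // _; last by rewrite oppr0.
by rewrite -scaleN1r -(HZ kmH_lin) scaleN1r.
Qed.
Lemma kmEF' i j : [lie kmE j, kmF i] = if i == j then kmH (km_coroot F A i) else 0.
Proof. by rewrite kmEF eq_sym; case: eqP => // ->. Qed.

Local Notation raisedE := (raised kmE).
Local Notation raisedF := (raised kmF).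

(** n_- + h + n_+ *)
Inductive triangular : Gt -> Prop :=
| tri_H h : triangular (kmH h)
| tri_E k y : raisedE k y -> triangular y
| tri_F k y : raisedF k y -> triangular y
| tri_D x y : triangular x -> triangular y -> triangular (x + y).

Lemma triangularZ a y : triangular y -> triangular (a *: y).
Proof.
elim=> {y} [h|k y ky|k y ky|x y _ IHx _ IHy].
- by rewrite -(HZ kmH_lin); apply: tri_H.
- exact/tri_E/(raisedZ a ky).
- exact/tri_F/(raisedZ a ky).
- by rewrite scalerDr; apply: tri_D.
Qed.

Lemma triangular_H h y : triangular y -> triangular [lie kmH h, y].
Proof.
elim=> {y} [h'|k y ky|k y ky|x y _ IHx _ IHy].
- by rewrite kmHH -(H0 kmH_lin); apply: tri_H.
- exact/tri_E/(raised_H kmHE h ky).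
- exact/tri_F/(raised_H kmHF h ky).
- by rewrite bracketDr; apply: tri_D.
Qed.

Lemma triangular_E i y : triangular y -> triangular [lie kmE i, y].
Proof.
elim=> {y} [h'|k y ky|[|k] y ky|x y _ IHx _ IHy].
- rewrite bracketC kmHE -scaleNr.
  exact/tri_E/raisedZ/raised_gen.
- exact/tri_E/(raised_bracket i ky).
- by have [h ->] := raised_lower kmH_lin kmHF kmEF' i ky; apply: tri_H.
- exact/tri_F/(raised_lower kmH_lin kmHF kmEF' i ky).
- by rewrite bracketDr; apply: tri_D.
Qed.

Lemma triangular_F i y : triangular y -> triangular [lie kmF i, y].
Proof.
elim=> {y} [h'|[|k] y ky|k y ky|x y _ IHx _ IHy].
- rewrite bracketC kmHF -scaleNr.
  exact/tri_F/raisedZ/raised_gen.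
- by have [h ->] := raised_lower kmH_lin kmHE kmFE i ky; apply: tri_H.
- exact/tri_E/(raised_lower kmH_lin kmHE kmFE i ky).
- exact/tri_F/(raised_bracket i ky).
- by rewrite bracketDr; apply: tri_D.
Qed.

Lemma km_tilde_ind (P : Gt -> Prop) :
  (forall x, P (pres_gen rel x)) -> P 0 -> (forall x y, P x -> P y -> P (x + y)) ->
  (forall a x, P x -> P (a *: x)) -> (forall x y, P x -> P y -> P [lie x, y]) ->
  forall x, P x.
Proof.
move=> Pg P0 PD PZ PB x; rewrite -[x]pres_piK; move: (repr _) => {x}.
elim=> [x||s IHs t IHt|a s IHs|s IHs t IHt].
- exact: Pg.
- by rewrite pres_pi_zero.
- by rewrite pres_pi_add; apply: PD.
- by rewrite pres_pi_scale; apply: PZ.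
- by rewrite pres_pi_br; apply: PB.
Qed.

Lemma triangular_bracket x y : triangular y -> triangular [lie x, y].
Proof.
elim/km_tilde_ind: x y => [[h|i|i]||x x' IH IH'|a x IH|x x' IH IH'] y Ty.
- exact: triangular_H.
- exact: triangular_E.
- exact: triangular_F.
- by rewrite bracket0x -(H0 kmH_lin); apply: tri_H.
- by rewrite bracketDl; apply: tri_D; auto.
- by rewrite bracketZl; apply/triangularZ/IH.
- have -> : [lie [lie x, x'], y] = [lie x, [lie x', y]] + -1 *: [lie x', [lie x, y]].
    by rewrite bracket_deriv scaleN1r addrK.
  by apply: tri_D; [apply/IH/IH'|apply/triangularZ/IH'/IH].
Qed.

Lemma triangularT y : triangular y.
Proof.
elim/km_tilde_ind: y => [[h|i|i]||x x' IH IH'|a x IH|x x' IH IH'].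
- exact: tri_H.
- exact/tri_E/raised_gen.
- exact/tri_F/raised_gen.
- by rewrite -(H0 kmH_lin); apply: tri_H.
- exact: tri_D.
- exact: triangularZ.
- exact: triangular_bracket.
Qed.

(** The roots are linearly independent, so h has an element on which every
    simple root takes the value 1. It defines the principal gradation. *)
Lemma principal_exists : exists h0 : 'rV[F]_d, forall i, km_root i h0 = 1.
Proof.
pose B := (pinvmx (km_root_mx F A)^T)^T.
exists (const_mx 1 *m B) => i; rewrite /km_root -mulmxA.
have -> : B *m km_root_mx F A = 1%:M.
  by apply: trmx_inj; rewrite trmx_mul trmx1 trmxK mulmxVp // km_root_free.
by rewrite mulmx1 mxE.
Qed.

Lemma principal_decomposition h0 y : (forall i, km_root i h0 = 1) ->
  exists h (s : seq (int * Gt)), y = kmH h + \sum_(p <- s) p.2 /\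
    forall p, p \in s -> p.1 != 0 /\ [lie kmH h0, p.2] = p.1%:~R *: p.2.
Proof.
move=> h01; elim: (triangularT y) => {y} [h|k y ky|k y ky|x y _ IHx _ IHy].
- by exists h, [::]; rewrite big_nil addr0.
- exists 0, [:: (k.+1%:Z, y)]; rewrite (H0 kmH_lin) big_seq1 add0r; split=> //.
  move=> p; rewrite inE => /eqP -> /=; split=> //.
  by rewrite (raised_degree kmHE h01 ky).
- exists 0, [:: (- k.+1%:Z, y)]; rewrite (H0 kmH_lin) big_seq1 add0r; split=> //.
  move=> p; rewrite inE => /eqP -> /=; split=> //.
  have h0N i : - km_root i h0 = -1 by rewrite h01.
  by rewrite (raised_degree kmHF h0N ky) mulNrn rmorphN.
- have [h [s [-> hs]]] := IHx; have [h' [s' [-> hs']]] := IHy.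
  exists (1 *: h + h'), (s ++ s'); rewrite kmH_lin scale1r big_cat addrACA.
  by split=> // p; rewrite mem_cat => /orP[/hs|/hs'].
Qed.

(** An ideal contains the degree-0 parts of its elements: the other parts are
    killed one after the other by operators ad h0 - k. *)
Lemma ideal_degree0 (I : ideal Gt) h0 z (s : seq (int * Gt)) :
  [lie kmH h0, z] = 0 ->
  (forall p, p \in s -> p.1 != 0 /\ [lie kmH h0, p.2] = p.1%:~R *: p.2) ->
  z + \sum_(p <- s) p.2 \in ideal_pred I -> z \in ideal_pred I.
Proof.
have [m] := ubnP (size s); elim: m s z => // m IH [|[k y] s] z /=.
  by rewrite big_nil addr0.
move=> sm hz hs Iy; have [/= k0 hy] := hs (k, y) (mem_head _ _).
have hs' p : p \in s -> p.1 != 0 /\ [lie kmH h0, p.2] = p.1%:~R *: p.2.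
  by move=> ps; apply: hs; rewrite inE ps orbT.
suff Iz : - k%:~R *: z \in ideal_pred I.
  have kN0 : - k%:~R != 0 :> F by rewrite oppr_eq0 intr_eq0.
  by rewrite -[z](scalerK kN0) rpredZ.
apply: (IH [seq (p.1, (p.1 - k)%:~R *: p.2) | p <- s]); rewrite ?size_map //.
- by rewrite bracketZr hz scaler0.
- move=> p /mapP[q qs ->] /=; have [q0 hq] := hs' q qs.
  by split=> //; rewrite bracketZr hq !scalerA mulrC.
have -> : - k%:~R *: z
    + \sum_(p <- [seq (p.1, (p.1 - k)%:~R *: p.2) | p <- s]) p.2
    = [lie kmH h0, z + \sum_(p <- (k, y) :: s) p.2]
      - k%:~R *: (z + \sum_(p <- (k, y) :: s) p.2).
  rewrite big_cons /= bracketDr hz add0r bracketDr hy !scalerDr bracket_sumr.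
  rewrite opprD addrCA -scaleNr; congr (_ + _); rewrite big_map opprD.
  rewrite addrACA addrN add0r scaler_sumr -sumrB.
  rewrite big_seq_cond [RHS]big_seq_cond; apply: eq_bigr => p /andP[/hs'[_ ->] _].
  by rewrite rmorphB /= scalerBl.
by rewrite rpredB ?rpredZ ?ideal_bracket.
Qed.

(** A realization of the derived algebra as a subalgebra Q of M. The e i and f i
    are Chevalley generators of Q; T is a commuting family on which the simple
    roots take arbitrary values, and it supplies the directions of the Cartan
    subalgebra that the coroots do not span. The condition K is meant to say that
    certain coordinates vanish; brackets with Cartan elements satisfy it, and
    Q_simple asks that 0 be the only element of a Q-stable part of Q + im T that
    satisfies it throughout. *)
Section Realization.
Variables (M : lieType F) (Q : subalg M) (e f : 'I_n -> M).
Variable (T : {linear 'rV[F]_n -> M}).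
Local Notation hc i := [lie e i, f i].
Hypothesis eQ : forall i, e i \in subalg_pred Q.
Hypothesis fQ : forall i, f i \in subalg_pred Q.
Hypothesis ef : forall i j, i != j -> [lie e i, f j] = 0.
Hypothesis hce : forall i j, [lie hc i, e j] = (A i j)%:~R *: e j.
Hypothesis hcf : forall i j, [lie hc i, f j] = - (A i j)%:~R *: f j.
Hypothesis Te : forall c j, [lie T c, e j] = c 0 j *: e j.
Hypothesis Tf : forall c j, [lie T c, f j] = - c 0 j *: f j.
Hypothesis TT : forall c c', [lie T c, T c'] = 0.
Hypothesis hc_free : forall u : 'rV[F]_n, \sum_i u 0 i *: hc i = 0 -> u = 0.
Hypothesis Q_gen : forall R : subalg M, (forall i, e i \in subalg_pred R) ->
  (forall i, f i \in subalg_pred R) ->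
  forall x, x \in subalg_pred Q -> x \in subalg_pred R.
Variable K : M -> Prop.
Hypothesis K0 : K 0.
Hypothesis KD : forall x y, K x -> K y -> K (x + y).
Hypothesis KT : forall c x, K [lie T c, x].
Hypothesis Khc : forall i x, K [lie hc i, x].
Hypothesis Q_simple : forall J : M -> Prop, (forall x, J x -> K x) ->
  (forall x, J x -> exists2 q, q \in subalg_pred Q & exists c, x = q + T c) ->
  (forall x y, J x -> y \in subalg_pred Q -> J [lie x, y]) ->
  forall x, J x -> x = 0.

Definition real_cartan (h : 'rV[F]_(n + \rank ((km_mx F A)^C)%MS)) : M :=
  \sum_i lsubmx h 0 i *: hc i + T (rsubmx h *m row_base ((km_mx F A)^C)%MS).

Lemma real_cartan_lin a h h' :
  real_cartan (a *: h + h') = a *: real_cartan h + real_cartan h'.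
Proof.
rewrite /real_cartan (linearP rsubmx) mulmxDl -scalemxAl (linearP T) [in RHS]scalerDr.
rewrite [RHS]addrACA scaler_sumr -big_split /=; congr (_ + _).
by apply: eq_bigr => i _; rewrite !mxE scalerDl scalerA.
Qed.

Lemma km_root_split (h : 'rV[F]_(n + \rank ((km_mx F A)^C)%MS)) j :
  km_root (A := A) j h = (lsubmx h *m km_mx F A) 0 j
    + (rsubmx h *m row_base ((km_mx F A)^C)%MS) 0 j.
Proof.
by rewrite /km_root /km_root_mx -{1}(hsubmxK h) mul_row_col mxE.
Qed.

Lemma real_cartan_e h j : [lie real_cartan h, e j] = km_root (A := A) j h *: e j.
Proof.
rewrite bracketDl Te bracket_suml km_root_split scalerDl; congr (_ + _).
rewrite mxE scaler_suml; apply: eq_bigr => i _.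
by rewrite bracketZl hce scalerA [km_mx _ _ _ _]mxE.
Qed.

Lemma real_cartan_f h j : [lie real_cartan h, f j] = - km_root (A := A) j h *: f j.
Proof.
rewrite bracketDl Tf bracket_suml km_root_split opprD scalerDl; congr (_ + _).
rewrite mxE -sumrN scaler_suml; apply: eq_bigr => i _.
by rewrite bracketZl hcf scalerA [km_mx _ _ _ _]mxE mulrN.
Qed.

Lemma real_cartan_coroot i : real_cartan (km_coroot F A i) = hc i.
Proof.
rewrite /real_cartan /km_coroot.
have -> : rsubmx (delta_mx 0 (lshift _ i) : 'rV[F]_(n + \rank ((km_mx F A)^C)%MS)) = 0.
  by apply/matrixP => r k; rewrite !mxE ord1 eqxx eq_rlshift.
rewrite mul0mx linear0 addr0 (bigD1 i) //= big1 ?addr0.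
  by rewrite !mxE !eqxx scale1r.
by move=> k ki; rewrite !mxE eqxx /= eq_lshift (negPf ki) scale0r.
Qed.

(** The Cartan part commutes with brackets of e_i and f_i, by the derivation
    rule. *)
Lemma real_cartan_hc h i : [lie real_cartan h, hc i] = 0.
Proof.
by rewrite bracket_deriv real_cartan_e real_cartan_f bracketZl bracketZr -scalerDl
  addrN scale0r.
Qed.

Lemma T_hc c i : [lie T c, hc i] = 0.
Proof.
by rewrite bracket_deriv Te Tf bracketZl bracketZr -scalerDl addrN scale0r.
Qed.

Lemma real_cartan_abelian h h' : [lie real_cartan h, real_cartan h'] = 0.
Proof.
rewrite {2}/real_cartan bracketDr bracket_sumr big1 => [|i _]; last first.
  by rewrite bracketZr real_cartan_hc scaler0.
rewrite add0r bracketDl TT addr0 bracket_suml big1 // => i _.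
by rewrite bracketZl bracketC T_hc oppr0 scaler0.
Qed.

(** A vanishing e i would give a vanishing coroot, against hc_free. *)
Lemma e_neq0 i : e i != 0.
Proof.
apply/eqP => ei0; have /eqP : (delta_mx 0 i : 'rV[F]_n) = 0.
  apply: hc_free; rewrite big1 // => j _; rewrite mxE eqxx /=.
  by case: eqP => [->|_]; rewrite ?ei0 ?bracket0x ?scaler0 ?scale0r.
by apply/negP/eqP => /rowP/(_ i); rewrite !mxE !eqxx; apply/eqP/oner_neq0.
Qed.

(** The roots of an element h of the kernel vanish since the e j are nonzero. So
    the two parts of h produce opposite vectors, one in the row space of the
    Cartan matrix and one in a complement of it; both are 0. *)
Lemma real_cartan_inj h : real_cartan h = 0 -> h = 0.
Proof.
move=> h0; have root0 j : km_root (A := A) j h = 0.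
  have := real_cartan_e h j; rewrite h0 bracket0x => /esym/eqP.
  by rewrite scaler_eq0 (negPf (e_neq0 j)) orbF => /eqP.
set u := lsubmx h; set w := rsubmx h.
have uw : w *m row_base ((km_mx F A)^C)%MS = - (u *m km_mx F A).
  apply/eqP; rewrite -addr_eq0 addrC; apply/eqP/rowP => j.
  by rewrite mxE -km_root_split root0 mxE.
have wC0 : w *m row_base ((km_mx F A)^C)%MS = 0.
  apply/eqP; rewrite -submx0 -(capmx_compl (km_mx F A)) sub_capmx.
  rewrite {1}uw -mulNmx submxMl /=.
  by rewrite (submx_trans (submxMl _ _)) // eq_row_base.
have w0 : w = 0.
  apply: (row_free_inj (row_base_free ((km_mx F A)^C)%MS)).
  by rewrite wC0 mul0mx.
have u0 : u = 0.
  by apply: hc_free; move: h0; rewrite /real_cartan -/w wC0 linear0 addr0.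
by rewrite -(hsubmxK h) -/u -/w u0 w0 row_mx0.
Qed.

Definition real_gen (g : km_gen F A) : M :=
  match g with KmH h => real_cartan h | KmE i => e i | KmF i => f i end.

Lemma real_rel s t : rel s t -> leval real_gen s = leval real_gen t.
Proof.
case=> [a h h'|h h'|i j|h i|h i] /=.
- exact: real_cartan_lin.
- exact: real_cartan_abelian.
- by case: eqP => [->|/eqP ij] /=; [rewrite real_cartan_coroot|apply: ef].
- exact: real_cartan_e.
- exact: real_cartan_f.
Qed.

Definition real_hom : lieHom Gt M := pres_lift real_rel.

Lemma real_homH h : real_hom (kmH h) = real_cartan h.
Proof. exact: pres_liftE. Qed.
Lemma real_homE i : real_hom (kmE i) = e i.
Proof. exact: pres_liftE. Qed.
Lemma real_homF i : real_hom (kmF i) = f i.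
Proof. exact: pres_liftE. Qed.

Fact T_stable_submod c :
  submod_closed [pred x | (x \in subalg_pred Q) && ([lie T c, x] \in subalg_pred Q)].
Proof.
split=> [|a x y]; first by rewrite inE bracketx0 !rpred0.
rewrite !inE => /andP[Qx QTx] /andP[Qy QTy].
by rewrite bracket_linr !rpredD ?rpredZ.
Qed.
Fact T_stable_bracket c :
  {in [pred x | (x \in subalg_pred Q) && ([lie T c, x] \in subalg_pred Q)] &,
   forall x y, [lie x, y] \in
     [pred x | (x \in subalg_pred Q) && ([lie T c, x] \in subalg_pred Q)]}.
Proof.
move=> x y; rewrite !inE => /andP[Qx QTx] /andP[Qy QTy].
by rewrite bracket_deriv subalg_bracket // rpredD // subalg_bracket.
Qed.

(** The elements of Q that ad T keeps in Q form a subalgebra which contains the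
    generators. *)
Lemma T_stable c x : x \in subalg_pred Q -> [lie T c, x] \in subalg_pred Q.
Proof.
move=> Qx; have := Q_gen (R := Subalg (T_stable_submod c) (@T_stable_bracket c)).
move=> /(_ _ _ x Qx); rewrite inE => /= h; apply: (andP (h _ _)).2 => i.
  by rewrite inE /= eQ Te rpredZ.
by rewrite inE /= fQ Tf rpredZ.
Qed.

Lemma real_hom_range y :
  exists2 q, q \in subalg_pred Q & exists c, real_hom y = q + T c.
Proof.
elim/km_tilde_ind: y => [[h|i|i]||x x' [q Qq [c hx]] [q' Qq' [c' hx']]
    |a x [q Qq [c hx]]|x x' [q Qq [c hx]] [q' Qq' [c' hx']]].
- rewrite -[pres_gen _ _]/(kmH h) real_homH; eexists; last by eexists.
  by apply: rpred_sum => i _; rewrite rpredZ ?subalg_bracket.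
- by exists (e i) => //; exists 0; rewrite -[pres_gen _ _]/(kmE i) real_homE linear0 addr0.
- by exists (f i) => //; exists 0; rewrite -[pres_gen _ _]/(kmF i) real_homF linear0 addr0.
- by exists 0; rewrite ?rpred0 //; exists 0; rewrite !linear0 addr0.
- exists (q + q'); first by rewrite rpredD.
  by exists (c + c'); rewrite !linearD /= hx hx' addrACA.
- exists (a *: q); first by rewrite rpredZ.
  by exists (a *: c); rewrite !linearZ /= hx scalerDr.
- exists [lie real_hom x, real_hom x']; last first.
    by exists 0; rewrite hom_bracket linear0 addr0.
  rewrite hx hx' !(bracketDl, bracketDr) TT addr0.
  rewrite (bracketC (T c') q); apply: rpredD; last exact: T_stable.
  by apply: rpredD; [apply: subalg_bracket|rewrite rpredN; apply: T_stable].
Qed.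

Lemma K_cartan h x : K [lie real_cartan h, x].
Proof.
rewrite bracketDl; apply: KD => //; rewrite bracket_suml.
elim/big_ind: _ => // i _; rewrite bracketZl -bracketZr; exact: Khc.
Qed.

(** An ideal that meets h trivially contains the h-components of its elements, so
    these are 0. The other components are brackets with an element of h, hence
    the image of the ideal satisfies K, and Q_simple kills it. *)
Lemma real_hom_radical x : x \in ideal_pred (km_radical F A) -> real_hom x = 0.
Proof.
move=> /asboolP[s [-> hs]]; rewrite linear_sum big_seq big1 // => y /hs[I CI Iy].
apply: (@Q_simple (fun z => exists2 y, y \in ideal_pred I & z = real_hom y))
  => [_ [{}y {}Iy ->]|_ [{}y {}Iy ->]|_ z [{}y {}Iy ->] Qz|]; last by exists y.
- have [h0 h01] := principal_exists.
  have [h [t [yE ht]]] := principal_decomposition y h01.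
  have Ih : kmH h \in ideal_pred I.
    by apply: (ideal_degree0 (kmHH h0 h) ht); rewrite -yE.
  rewrite yE [kmH h](CI h Ih) add0r linear_sum big_seq.
  elim/big_ind: _ => // p /ht[p0 hp].
  have p1 : p.1%:~R != 0 :> F by rewrite intr_eq0.
  have -> : p.2 = [lie kmH h0, p.1%:~R^-1 *: p.2].
    by rewrite bracketZr hp scalerA mulVf // scale1r.
  by rewrite hom_bracket real_homH; apply: K_cartan.
- exact: real_hom_range.
- have [u ->] : exists u, z = real_hom u.
    pose im := [pred z | `[< exists u, z = real_hom u >]].
    have im_submod : submod_closed im.
      split; first by apply/asboolP; exists 0; rewrite linear0.
      move=> a _ _ /asboolP[u ->] /asboolP[v ->]; apply/asboolP.
      by exists (a *: u + v); rewrite linearP.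
    have im_bracket : {in im &, forall u v, [lie u, v] \in im}.
      move=> _ _ /asboolP[u ->] /asboolP[v ->]; apply/asboolP.
      by exists [lie u, v]; rewrite hom_bracket.
    apply/asboolP; apply: (@Q_gen (Subalg im_submod im_bracket)) Qz => i.
      by apply/asboolP; exists (kmE i); rewrite real_homE.
    by apply/asboolP; exists (kmF i); rewrite real_homF.
  exists [lie y, u]; last by rewrite hom_bracket.
  by rewrite bracketC rpredN ideal_bracket.
Qed.

(** The kernel is itself an ideal that meets h trivially. *)
Lemma real_hom_kernel x : real_hom x = 0 -> x \in ideal_pred (km_radical F A).
Proof.
have ker_submod : submod_closed [pred x | real_hom x == 0].
  split=> [|a y z]; first by rewrite inE linear0.
  by rewrite !inE linearP => /eqP -> /eqP ->; rewrite scaler0 addr0.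
have ker_bracket y : {in [pred x | real_hom x == 0],
    forall z, [lie y, z] \in [pred x | real_hom x == 0]}.
  by move=> z; rewrite !inE hom_bracket => /eqP ->; rewrite bracketx0.
move=> x0; apply/asboolP; exists [:: x]; rewrite big_seq1; split=> // y.
rewrite inE => /eqP ->; exists (Ideal ker_submod ker_bracket); last by rewrite inE x0.
move=> h; rewrite inE -[pres_gen _ _]/(kmH h) real_homH => /eqP/real_cartan_inj ->.
exact: H0 kmH_lin.
Qed.

(** A bracket of two elements of Q + im T lies in Q; conversely e i and f i are, up
    to sign, their own brackets with an element on which all simple roots
    are 1. *)
Theorem km_derived_lieIso : sub_lie (km_derived F A) ~=L sub_lie Q.
Proof.
pose g := quot_map real_hom_radical.
have g_pi y : g (quot_pi _ y) = real_hom y.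
  exact: (quot_map_pi real_hom_radical).
apply: (@subalg_lieIso _ _ _ g).
- exact: quot_map_inj real_hom_kernel.
- move=> _ /asboolP[s ->]; rewrite linear_sum; apply: rpred_sum => p _.
  have g_range r : exists2 q, q \in subalg_pred Q & exists c, g r = q + T c.
    by rewrite -[r]quot_piK g_pi; apply: real_hom_range.
  have [q Qq [c hq]] := g_range p.1; have [q' Qq' [c' hq']] := g_range p.2.
  rewrite hom_bracket hq hq' !(bracketDl, bracketDr) TT addr0.
  rewrite (bracketC (T c') q); apply: rpredD; last exact: T_stable.
  by apply: rpredD; [apply: subalg_bracket|rewrite rpredN; apply: T_stable].
pose im := [pred x | `[< exists2 y, y \in subalg_pred (km_derived F A) & g y = x >]].
have im_submod : submod_closed im.
  split; first by apply/asboolP; exists 0; rewrite ?rpred0 ?linear0.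
  move=> a _ _ /asboolP[u Du <-] /asboolP[v Dv <-]; apply/asboolP.
  by exists (a *: u + v); rewrite ?linearP // rpredD ?rpredZ.
have im_bracket : {in im &, forall u v, [lie u, v] \in im}.
  move=> _ _ /asboolP[u Du <-] /asboolP[v Dv <-]; apply/asboolP.
  by exists [lie u, v]; rewrite ?hom_bracket ?subalg_bracket.
have [h0 h01] := principal_exists.
move=> x Qx; apply/asboolP.
apply: (@Q_gen (Subalg im_submod im_bracket)) Qx => i; apply/asboolP.
  exists (quot_pi _ (kmE i)); last by rewrite g_pi real_homE.
  apply/asboolP; exists [:: (quot_pi _ (kmH h0), quot_pi _ (kmE i))].
  by rewrite big_seq1 /= -[RHS]quot_pi_bracket kmHE h01 scale1r.
exists (quot_pi _ (kmF i)); last by rewrite g_pi real_homF.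
apply/asboolP; exists [:: (quot_pi _ (kmF i), quot_pi _ (kmH h0))].
by rewrite big_seq1 /= -[RHS]quot_pi_bracket bracketC kmHF h01 scaleN1r opprK.
Qed.
End Realization.
End Criterion.

(** * Maps defined degree by degree on affine algebras *)

Section AffineMaps.
Variables (F : fieldType) (g : quadLieType F).

Lemma amono_linear m : linear (fun a : g => amono a m).
Proof.
move=> a x y; apply: affineP; last by rewrite /= scaler0 addr0.
apply: lcoefP => k; rewrite lcoefD lcoefZ !lcoef_mono.
by case: eqP; rewrite ?scaler0 ?addr0.
Qed.

Lemma amonoD (a b : g) m : amono (a + b) m = amono a m + amono b m.
Proof. by have := amono_linear m 1 a b; rewrite !scale1r. Qed.
Lemma amono0 m : amono (0 : g) m = 0.
Proof. by have := amono_linear m (-1) 0 0; rewrite !scaleN1r oppr0 addr0 addNr. Qed.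
Lemma amonoZ c (a : g) m : amono (c *: a) m = c *: amono a m.
Proof. by have := amono_linear m c a 0; rewrite amono0 !addr0. Qed.
Lemma amonoN (a : g) m : amono (- a) m = - amono a m.
Proof. by rewrite -scaleN1r amonoZ scaleN1r. Qed.
Lemma amonoB (a b : g) m : amono (a - b) m = amono a m - amono b m.
Proof. by rewrite amonoD amonoN. Qed.
Lemma amono_sum (I : Type) (s : seq I) (P : pred I) (f : I -> g) m :
  amono (\sum_(i <- s | P i) f i) m = \sum_(i <- s | P i) amono (f i) m.
Proof.
apply: (big_morph (fun a => amono a m)) => [a b|]; [exact: amonoD|exact: amono0].
Qed.

Lemma affine_expand (x : affine g) :
  x = \sum_(m <- lsupp x.1) amono (lcoef x.1 m) m + (x.2 : F) *: kk g.
Proof.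
apply: affineP.
  rewrite /= scaler0 addr0 {1}(loop_sum x.1).
  by rewrite (big_morph (fun y : affine g => y.1) (id1 := 0) (op1 := +%R)).
rewrite /= (big_morph (fun y : affine g => y.2) (id1 := 0) (op1 := +%R)) //=.
by rewrite big1 // add0r /GRing.scale /= mulr1.
Qed.

Lemma kkC (x : affine g) : [lie x, kk g] = 0.
Proof. by rewrite bracketC kk_central oppr0. Qed.

(** What reduces identities between brackets to monomials. *)
Lemma affine_bilinear (V : lmodType F) (B C : affine g -> affine g -> V) :
  (forall x y z, B (x + y) z = B x z + B y z) ->
  (forall x y z, B z (x + y) = B z x + B z y) ->
  (forall x y z, C (x + y) z = C x z + C y z) ->
  (forall x y z, C z (x + y) = C z x + C z y) ->
  (forall c x, B (c *: kk g) x = C (c *: kk g) x) ->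
  (forall c x, B x (c *: kk g) = C x (c *: kk g)) ->
  (forall a m b n, B (amono a m) (amono b n) = C (amono a m) (amono b n)) ->
  forall x y, B x y = C x y.
Proof.
move=> Bl Br Cl Cr kl kr h x y; elim/affine_ind: x => [|x x' hx hx'|a m|c].
- by rewrite -(scale0r (kk g)) kl.
- by rewrite Bl Cl hx hx'.
- elim/affine_ind: y => [|y y' hy hy'|b n|c].
  + by rewrite -(scale0r (kk g)) kr.
  + by rewrite Br Cr hy hy'.
  + exact: h.
  + exact: kr.
- exact: kl.
Qed.

Section Degreewise.
Variables (phi : int -> g -> g) (s : F).
Hypothesis phi_lin : forall m, linear (phi m).

Fact degreewise_finsupp (f : loop g) : finsupp_pred (fun m => phi m (lcoef f m)).
Proof.
apply/asboolP; apply: sub_finite_set (asboolP _ (valP f)) => m /=.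
apply: contra => /eqP fm; rewrite (_ : lcoef f m = 0) //.
by have := phi_lin m (-1) 0 0; rewrite !scaleN1r oppr0 addr0 addNr => ->.
Qed.

Definition degreewise (x : affine g) : affine g :=
  (exist (fun f => finsupp_pred f) _ (degreewise_finsupp x.1), s * x.2).

Lemma degreewise_linear : linear degreewise.
Proof.
move=> a x y; apply: affineP.
  apply: lcoefP => m; rewrite lcoefD lcoefZ; exact: phi_lin.
by rewrite /= mulrDr; congr (_ + _); rewrite /GRing.scale /= mulrCA.
Qed.

Lemma degreewise_coef x m :
  lcoef (degreewise x).1 m = phi m (lcoef x.1 m).
Proof. by []. Qed.

Lemma degreewise_amono a m : degreewise (amono a m) = amono (phi m a) m.
Proof.
apply: affineP; last exact: mulr0.
apply: lcoefP => k; rewrite degreewise_coef !lcoef_mono; case: eqP => [->|] // _.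
by have := phi_lin k (-1) 0 0; rewrite !scaleN1r oppr0 addr0 addNr => ->.
Qed.

Lemma degreewise_kk : degreewise (kk g) = s *: kk g.
Proof.
apply: affineP => //; apply: lcoefP => k; rewrite degreewise_coef /= scaler0 !lcoef0.
by have := phi_lin k (-1) 0 0; rewrite !scaleN1r oppr0 addr0 addNr => ->.
Qed.

End Degreewise.
End AffineMaps.

Section DegreewiseHom.
Variables (F : fieldType) (g : quadLieType F) (phi : int -> g -> g).
Hypothesis phi_lin : forall m, linear (phi m).
Hypothesis phi_bracket : forall m n a b,
  phi (m + n) [lie a, b] = [lie phi m a, phi n b].
Hypothesis phi_form : forall m a b, iform (phi m a) (phi (- m) b) = iform a b.

Lemma degreewise_bracket x y : degreewise 1 phi_lin [lie x, y] =
  [lie degreewise 1 phi_lin x, degreewise 1 phi_lin y].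
Proof.
pose h : affine g -> affine g := degreewise 1 phi_lin.
have hD u v : h (u + v) = h u + h v.
  by have := degreewise_linear 1 phi_lin 1 u v; rewrite !scale1r.
have h0 : h 0 = 0.
  by have := degreewise_linear 1 phi_lin (-1) 0 0; rewrite !scaleN1r !addNr.
have hZ c u : h (c *: u) = c *: h u.
  by have := degreewise_linear 1 phi_lin c u 0; rewrite -/h h0 !addr0.
have hk : h (kk g) = kk g by rewrite /h degreewise_kk scale1r.
rewrite -!/(h _).
apply: (affine_bilinear (B := fun x y => h [lie x, y]) (C := fun x y => [lie h x, h y])).
- by move=> u v z; rewrite bracketDl hD.
- by move=> u v z; rewrite bracketDr hD.
- by move=> u v z; rewrite hD bracketDl.
- by move=> u v z; rewrite hD bracketDr.
- by move=> c u; rewrite !(bracketZl, hZ) hk !kk_central h0.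
- by move=> c u; rewrite !(bracketZr, hZ) hk !kkC h0.
move=> a m b n; rewrite bracket_amono hD hZ hk /h !degreewise_amono bracket_amono.
rewrite phi_bracket; congr (_ + _ *: _); case: eqP => // mn.
have -> : n = - m by apply/eqP; rewrite -addr_eq0 addrC mn.
by rewrite phi_form.
Qed.

Definition degreewise_hom : lieHom (affine g) (affine g) :=
  build_lieHom (degreewise_linear 1 phi_lin) degreewise_bracket.

Lemma degreewise_homE a m : degreewise_hom (amono a m) = amono (phi m a) m.
Proof. exact: degreewise_amono. Qed.
Lemma degreewise_hom_kk : degreewise_hom (kk g) = kk g.
Proof. by rewrite -[RHS]scale1r; apply: degreewise_kk. Qed.
Lemma degreewise_hom_snd x : (degreewise_hom x).2 = x.2.
Proof. exact: mul1r. Qed.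
End DegreewiseHom.

(** * The principal basis of the affine algebra of gl_N *)

Lemma central_regroup (R : comPzRingType) (V : lmodType R) (a b u v w : R) (y z k : V) :
  a *: y - b *: z + (a * u - b * v + w) *: k =
  a *: (y + u *: k) - b *: (z + v *: k) + w *: k.
Proof.
rewrite scalerDl scalerBl !scalerDr !scalerA opprD addrA; congr (_ + _).
by rewrite addrACA.
Qed.

Section PrincipalBasis.
Variables (F : numFieldType) (l : nat).
Local Notation N := (2 * l).+1.
Local Notation glN := (gl F N).
Local Notation G := (affine glN).
Local Notation "p =N q" := (p == q %[mod N%:Z])%Z (at level 70).

Lemma divz_eqN p : p = (p %/ N%:Z)%Z * N%:Z + (p %% N%:Z)%Z.
Proof. exact: divz_eq. Qed.

Definition idx (p : int) : 'I_N := inord `|(p %% N%:Z)%Z|%N.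

Lemma idxE p : (idx p)%:Z = (p %% N%:Z)%Z.
Proof.
have p0 : (0 <= p %% N%:Z)%Z by apply: modz_ge0.
have pN : (p %% N%:Z < N%:Z)%Z by apply: ltz_pmod.
rewrite inordK ?gez0_abs //; move: (p %% N%:Z)%Z p0 pN => r r0 rN; lia.
Qed.

Lemma idx_eq p q : (idx p == idx q) = (p =N q).
Proof. by rewrite -val_eqE /= -eqz_nat !idxE. Qed.

Lemma idx_ord (i : 'I_N) : idx i%:Z = i.
Proof.
apply: val_inj; apply/eqP; rewrite -eqz_nat idxE modz_small // ltz_nat.
exact: ltn_ord.
Qed.

Lemma idx_congr p q : p =N q -> idx p = idx q.
Proof. by rewrite -idx_eq => /eqP. Qed.

Lemma congrP p q : reflect (exists k, q = p + k * N%:Z) (p =N q).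
Proof.
apply: (iffP eqP) => [pq|[k ->]]; last by rewrite addrC modzMDl.
exists ((q %/ N%:Z)%Z - (p %/ N%:Z)%Z).
by rewrite {1}[p]divz_eqN {1}[q]divz_eqN pq; ring.
Qed.

Lemma congr_sym p q : (p =N q) = (q =N p).
Proof. by rewrite eq_sym. Qed.

Lemma congrD2l k p q : (k + p =N k + q) = (p =N q).
Proof. by rewrite eqz_modDl. Qed.

Lemma divz_shift p k : ((p + k * N%:Z) %/ N%:Z)%Z = (p %/ N%:Z)%Z + k.
Proof. by rewrite addrC divzMDl // addrC. Qed.

(** gl_N[t, t^-1] consists of the N-periodic infinite matrices; E p q is the
    matrix unit with N-translates of an entry at (p, q). *)
Definition E (p q : int) : G :=
  amono (delta_mx (idx p) (idx q) : glN) ((q %/ N%:Z)%Z - (p %/ N%:Z)%Z).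

Lemma E_shift k p q : E (p + k * N%:Z) (q + k * N%:Z) = E p q.
Proof.
rewrite /E !divz_shift; congr amono; last by ring.
by congr delta_mx; apply: idx_congr; apply/congrP; exists (- k); ring.
Qed.

Lemma gl_delta_bracket (i j i' j' : 'I_N) :
  [lie (delta_mx i j : glN), (delta_mx i' j' : glN)] =
  (i' == j)%:R *: (delta_mx i j' : glN) - (j' == i)%:R *: (delta_mx i' j : glN).
Proof.
by rewrite /bracket /= /gl_bracket !mul_delta_mx_cond eq_sym -!scaler_nat.
Qed.

Lemma gl_delta_form (i j i' j' : 'I_N) :
  iform (delta_mx i j : glN) (delta_mx i' j' : glN) = ((i' == j) && (j' == i))%:R.
Proof.
rewrite /iform /= /gl_form mul_delta_mx_cond eq_sym; case: eqP => _ /=.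
  rewrite /mxtrace (bigD1 i) //= big1 => [|k ki]; rewrite mxE ?(negPf ki) //.
  by rewrite eqxx addr0 eq_sym.
by rewrite mxtrace0.
Qed.

Lemma E_bracket p q r s : [lie E p q, E r s] =
  (r =N q)%:R *: E p (s + q - r) - (s =N p)%:R *: E r (q + s - p)
  + ([&& r =N q, s =N p & q - p + s - r == 0]%:R
      * ((q %/ N%:Z)%Z - (p %/ N%:Z)%Z)%:~R) *: kk glN.
Proof.
rewrite bracket_amono gl_delta_bracket gl_delta_form !idx_eq amonoB !amonoZ.
congr (_ + _); first congr (_ - _).
- case: congrP => [[k qE]|_]; rewrite ?scale0r // !scale1r /E; congr amono.
    by congr delta_mx; apply: idx_congr; apply/congrP; exists k; rewrite qE; ring.
  rewrite qE (_ : s + _ - r = s + k * N%:Z); last by ring.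
  by rewrite !divz_shift; ring.
- case: congrP => [[k pE]|_]; rewrite ?scale0r // !scale1r /E; congr amono.
    by congr delta_mx; apply: idx_congr; apply/congrP; exists (- k); rewrite pE; ring.
  rewrite pE (_ : q + _ - _ = q + (- k) * N%:Z); last by ring.
  by rewrite !divz_shift; ring.
congr (_ *: _); case: congrP => [[k qE]|_] /=; last by rewrite mulr0 if_same mul0r.
case: congrP => [[j pE]|_] /=; last by rewrite mulr0 if_same mul0r.
rewrite mulr1; have -> : (q %/ N%:Z)%Z - (p %/ N%:Z)%Z + ((s %/ N%:Z)%Z - (r %/ N%:Z)%Z) = k - j.
  by rewrite qE pE !divz_shift; ring.
have -> : q - p + s - r = (k - j) * N%:Z by rewrite qE pE; ring.
rewrite mulf_eq0 orbF; case: eqP; rewrite ?mul1r ?mul0r //.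
Qed.

Lemma NF0 : N%:R != 0 :> F.
Proof. by rewrite pnatr_eq0. Qed.

(** With these multiples of kk added to the diagonal matrix units, the cocycle of
    the basis below becomes m / N, whatever the rows. The shift by l makes uc odd
    under p |-> -1 - p, so that the involutions preserve the basis up to sign. *)
Definition uc (p : int) : F := ((p %% N%:Z)%Z%:~R - l%:R) / N%:R.

Lemma ucE p : uc p = ((p - l%:Z)%:~R / N%:R - (p %/ N%:Z)%Z%:~R).
Proof.
rewrite /uc /modz !rmorphB rmorphM /= -!pmulrn.
by have := NF0; move: N%:R => c c0; field.
Qed.

(** The principal basis: x p m depends on p modulo N only, and m is its degree for
    the principal gradation. It is locked to keep simplification from unfolding
    it into families of matrices. *)
Definition x : int -> int -> G := locked (fun p m =>
  E p (p + m) + ((m == 0)%:R * uc p) *: kk glN).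

Lemma xE p m : x p m = E p (p + m) + ((m == 0)%:R * uc p) *: kk glN.
Proof. by rewrite /x -lock. Qed.

Lemma x_congr p q m : p =N q -> x p m = x q m.
Proof.
move=> pq; have /congrP[k qE] := pq; rewrite !xE /uc (eqP pq) qE; congr (_ + _).
by rewrite addrAC E_shift.
Qed.

Lemma x_bracket p m q n : [lie x p m, x q n] =
  (q =N p + m)%:R *: x p (m + n) - (p =N q + n)%:R *: x q (m + n)
  + ((m + n == 0)%:R * (q =N p + m)%:R * (m%:~R / N%:R)) *: kk glN.
Proof.
rewrite (xE p m) (xE q n) bracketDr bracketDl bracketZl kk_central scaler0 addr0.
rewrite bracketZr kkC scaler0 addr0 E_bracket [q + n =N p]congr_sym.
have -> : p + m - p + (q + n) - q = m + n by ring.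
rewrite [q + n + _ - _](_ : _ = p + (m + n)); last by ring.
rewrite [p + m + _ - _](_ : _ = q + (m + n)); last by ring.
have -> : [&& q =N p + m, p =N q + n & m + n == 0]%:R
    * (((p + m) %/ N%:Z)%Z - (p %/ N%:Z)%Z)%:~R =
    (q =N p + m)%:R * ((m + n == 0)%:R * uc p)
    - (p =N q + n)%:R * ((m + n == 0)%:R * uc q)
    + (m + n == 0)%:R * (q =N p + m)%:R * (m%:~R / N%:R) :> F.
  case: (eqVneq (m + n) 0) => [mn|_]; last by rewrite !andbF !(mul0r, mulr0) subrr add0r.
  have nE : n = - m by apply/eqP; rewrite -addr_eq0 addrC mn.
  have -> : (p =N q + n) = (q =N p + m).
    by rewrite nE -(congrD2l m p) addrCA subrr addr0 congr_sym addrC.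
  case: (boolP (q =N p + m)) => [qE|_] /=; last by rewrite !mul0r mulr0 mul0r subrr addr0.
  rewrite !mul1r [uc q]/uc (eqP qE) -/(uc (p + m)) !ucE !rmorphB !rmorphD /=.
  by have := NF0; move: N%:R => c c0; field.
by rewrite !xE; apply: central_regroup.
Qed.

Lemma E_x p q : E p q = x p (q - p) - ((q == p)%:R * uc p) *: kk glN.
Proof. by rewrite xE addrCA subrr addr0 subr_eq0 addrK. Qed.

Lemma amono_delta (i j : 'I_N) n :
  amono (delta_mx i j : glN) n = E i%:Z (j%:Z + n * N%:Z).
Proof.
rewrite /E -[in RHS](@idx_congr j%:Z (j%:Z + n * N%:Z)); last by apply/congrP; exists n.
by rewrite !idx_ord divz_shift !divz_nat !divn_small // add0r subr0.
Qed.

Lemma gl_expand (a : glN) : a = \sum_i \sum_j (a : 'M_N) i j *: (delta_mx i j : glN).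
Proof. exact: matrix_sum_delta. Qed.

(** The matrix units are the x p m, up to multiples of kk. *)
Lemma principal_ind (P : G -> Prop) : P 0 -> (forall y z, P y -> P z -> P (y + z)) ->
  (forall a y, P y -> P (a *: y)) -> P (kk glN) -> (forall p m, P (x p m)) ->
  forall y, P y.
Proof.
move=> P0 PD PZ Pk Px; elim/affine_ind => // [a m|c]; last exact: PZ.
rewrite (gl_expand a) amono_sum; elim/big_ind: _ => // i _.
rewrite amono_sum; elim/big_ind: _ => // j _.
rewrite amonoZ amono_delta E_x -scaleNr; apply/PZ/PD; first exact: Px.
exact: PZ.
Qed.

End PrincipalBasis.

(** * The involutions and their symmetrized basis *)

Section MatrixAutomorphisms.
Variables (F : fieldType) (N : nat) (P Pi : 'M[F]_N).
Hypothesis PPi : P *m Pi = 1%:M.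
Local Notation glN := (gl F N).

Let PiP : Pi *m P = 1%:M. Proof. exact: mulmx1C. Qed.

Definition conj_mx (a : glN) : glN := P *m (a : 'M_N) *m Pi.

Let conj_linear (m : int) : linear conj_mx.
Proof. by move=> c a b; rewrite /conj_mx mulmxDr mulmxDl -scalemxAr -scalemxAl. Qed.

Lemma conj_mxM (a b : 'M_N) : conj_mx a *m conj_mx b = conj_mx (a *m b).
Proof. by rewrite /conj_mx !mulmxA -(mulmxA _ Pi P) PiP mulmx1. Qed.

Lemma conj_mx_trace (a : 'M_N) : \tr (conj_mx a : 'M_N) = \tr a.
Proof. by rewrite /conj_mx mxtrace_mulC mulmxA PiP mul1mx. Qed.

Let conj_bracket (m n : int) (a b : glN) :
  conj_mx [lie a, b] = [lie conj_mx a, conj_mx b].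
Proof. by rewrite /bracket /= /gl_bracket !conj_mxM /conj_mx mulmxBr mulmxBl. Qed.

Let conj_form (m : int) (a b : glN) : iform (conj_mx a) (conj_mx b) = iform a b.
Proof. by rewrite /iform /= /gl_form conj_mxM conj_mx_trace. Qed.

Definition conj_hom : lieHom (affine glN) (affine glN) :=
  degreewise_hom conj_linear conj_bracket conj_form.

Lemma conj_hom_coef y m : lcoef (conj_hom y).1 m = conj_mx (lcoef y.1 m).
Proof. by []. Qed.
Lemma conj_hom_snd y : (conj_hom y).2 = y.2.
Proof. exact: degreewise_hom_snd. Qed.

Variable eps : F.
Hypothesis eps0 : eps != 0.

(** The automorphisms of the second kind: minus the adjoint for a bilinear form,
    with a sign depending on the degree. *)
Definition twist_mx (m : int) (a : glN) : glN :=
  - (eps ^ m *: conj_mx ((a : 'M_N)^T : 'M_N)).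

Let twist_linear m : linear (twist_mx m).
Proof.
move=> c a b; rewrite /twist_mx linearP /= (conj_linear m) scalerDr opprD.
by rewrite scalerN !scalerA mulrC.
Qed.

Let twist_bracket m n (a b : glN) :
  twist_mx (m + n) [lie a, b] = [lie twist_mx m a, twist_mx n b].
Proof.
rewrite /twist_mx bracketNl bracketNr opprK bracketZl bracketZr scalerA -expfzDr //.
rewrite -(conj_bracket 0 0) -scalerN; congr (_ *: _).
rewrite /bracket /= /gl_bracket linearB /= !trmx_mul /conj_mx.
by rewrite -mulNmx -mulmxN opprB.
Qed.

Let twist_form m (a b : glN) : iform (twist_mx m a) (twist_mx (- m) b) = iform a b.
Proof.
rewrite /iform /= /gl_form /twist_mx mulNmx mulmxN opprK -scalemxAl -scalemxAr.
rewrite scalerA -expfzDr // subrr expr0z scale1r conj_mxM conj_mx_trace.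
by rewrite -trmx_mul mxtrace_tr mxtrace_mulC.
Qed.

Definition twist_hom : lieHom (affine glN) (affine glN) :=
  degreewise_hom twist_linear twist_bracket twist_form.

Lemma twist_homE a m : twist_hom (amono a m) = amono (twist_mx m a) m.
Proof. exact: degreewise_homE. Qed.
Lemma twist_hom_kk : twist_hom (kk glN) = kk glN.
Proof. exact: degreewise_hom_kk. Qed.
Lemma twist_hom_coef y m : lcoef (twist_hom y).1 m = twist_mx m (lcoef y.1 m).
Proof. by []. Qed.
Lemma twist_hom_snd y : (twist_hom y).2 = y.2.
Proof. exact: degreewise_hom_snd. Qed.

End MatrixAutomorphisms.

Section Folding.
Variables (F : numFieldType) (l : nat) (eps : F).
Hypothesis eps2 : eps * eps = 1.
Local Notation N := (2 * l).+1.
Local Notation glN := (gl F N).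
Local Notation G := (affine glN).
Local Notation "p =N q" := (p == q %[mod N%:Z])%Z (at level 70).
Local Notation E := (@E F l).
Local Notation x := (@x F l).
Local Notation uc := (@uc F l).

Lemma eps0 : eps != 0.
Proof. by apply/eqP => e0; move: eps2; rewrite e0 mul0r => /esym/eqP; rewrite oner_eq0. Qed.

Lemma eps_even m k : eps ^ (m + 2 * k) = eps ^ m.
Proof.
rewrite expfzDr ?eps0 // -exprz_exp.
have -> : eps ^ 2 = 1 by rewrite -exprnP expr2.
by rewrite exp1rz mulr1.
Qed.

Lemma eps_parity m n k : m = n + 2 * k -> eps ^ m = eps ^ n.
Proof. by move=> ->; apply: eps_even. Qed.

(** A symmetric form for either sign of eps, because i + l and rev i + l have the
    same parity. *)
Definition Jmx : 'M[F]_N :=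
  \matrix_(i, j) (if j == rev_ord i then eps ^ (i%:Z + l%:Z) else 0).

Lemma rev_ord_eq n (i j : 'I_n) : (rev_ord i == j) = (i == rev_ord j).
Proof. by rewrite -{1}[j]rev_ordK (inj_eq rev_ord_inj). Qed.

Lemma Jmx_tr : Jmx^T = Jmx.
Proof.
apply/matrixP => i j; rewrite !mxE.
rewrite -rev_ord_eq eq_sym; case: eqP => // ->; apply: (@eps_parity _ _ (l%:Z - i%:Z)).
by rewrite /=; have := ltn_ord i; lia.
Qed.

Lemma JmxK : Jmx *m Jmx = 1%:M.
Proof.
apply/matrixP => i j; rewrite !mxE (bigD1 (rev_ord i)) //= big1 => [|k /negPf ki].
  rewrite !mxE eqxx rev_ordK addr0 [i == j]eq_sym; case: eqP => _; last first.
    by rewrite mulr0.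
  rewrite -expfzDr ?eps0 // -[RHS](expr0z eps); apply: (@eps_parity _ _ (2 * l)%N%:Z).
  by rewrite /=; have := ltn_ord i; lia.
by rewrite !mxE ki mul0r.
Qed.

(** For eps = -1 and eps = 1 these are the images of the involutions B and D. *)
Definition tau : lieHom G G := twist_hom JmxK eps0.

Lemma tau_kk : tau (kk glN) = kk glN.
Proof. exact: twist_hom_kk. Qed.

Lemma modz_reflect p : ((-1 - p) %% N%:Z)%Z = N%:Z - 1 - (p %% N%:Z)%Z.
Proof.
have p0 : (0 <= p %% N%:Z)%Z by apply: modz_ge0.
have pN : (p %% N%:Z < N%:Z)%Z by apply: ltz_pmod.
have -> : -1 - p = (- 1 - (p %/ N%:Z)%Z) * N%:Z + (N%:Z - 1 - (p %% N%:Z)%Z).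
  by rewrite {1}[p](divz_eqN l); ring.
rewrite modzMDl modz_small //; move: (p %% N%:Z)%Z p0 pN => r; lia.
Qed.

Lemma divz_reflect p : ((-1 - p) %/ N%:Z)%Z = - 1 - (p %/ N%:Z)%Z.
Proof.
apply: (@mulIf _ N%:Z) => //; apply: (addIr ((-1 - p) %% N%:Z)%Z).
by rewrite -divz_eqN modz_reflect {1}[p](divz_eqN l); ring.
Qed.

Lemma idx_reflect p : idx l (-1 - p) = rev_ord (idx l p).
Proof.
apply: val_inj; apply/eqP; rewrite -eqz_nat idxE modz_reflect -idxE /=.
by have := ltn_ord (idx l p); lia.
Qed.

Lemma mul_Jmx (a : 'M[F]_N) i j :
  (Jmx *m a) i j = eps ^ (i%:Z + l%:Z) * a (rev_ord i) j.
Proof.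
rewrite !mxE (bigD1 (rev_ord i)) //= big1 => [|k /negPf ki]; last first.
  by rewrite !mxE ki mul0r.
by rewrite !mxE eqxx addr0.
Qed.

Lemma twist_J_coef m (a : glN) (i j : 'I_N) :
  (twist_mx Jmx Jmx eps m a : 'M_N) i j
  = - (eps ^ (m + i%:Z + j%:Z) * (a : 'M_N) (rev_ord j) (rev_ord i)).
Proof.
have JaJ : conj_mx Jmx Jmx ((a : 'M_N)^T : 'M_N) i j =
    eps ^ (i%:Z + l%:Z) * (eps ^ (j%:Z + l%:Z) * (a : 'M_N) (rev_ord j) (rev_ord i)).
  rewrite /conj_mx -mulmxA mul_Jmx -{1}Jmx_tr -trmx_mul [_^T _ _]mxE mul_Jmx.
  by [].
rewrite /twist_mx 2!mxE JaJ !mulrA -!expfzDr ?eps0 //; congr (- (_ * _)).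
by apply: (@eps_parity _ _ l%:Z); ring.
Qed.

Lemma tau_E p q : tau (E p q) = - eps ^ (q - p) *: E (-1 - q) (-1 - p).
Proof.
rewrite /tau twist_homE /E -amonoZ !divz_reflect !idx_reflect; congr amono; last by ring.
apply/matrixP => i j; rewrite twist_J_coef [in RHS]mxE !mxE !rev_ord_eq.
rewrite [(i == _) && _]andbC mulNr.
case: (eqVneq j) => [->|_] /=; last by rewrite !mulr0.
case: (eqVneq i) => [->|_] /=; last by rewrite !mulr0.
rewrite !mulr1; congr (- _); rewrite {3}[q](divz_eqN l) {3}[p](divz_eqN l) -!idxE.
have revE r : ((N - (idx l r).+1)%N : int) = (2 * l)%N%:Z - (idx l r)%:Z.
  by have := ltn_ord (idx l r); lia.
rewrite !revE; apply: (@eps_parity _ _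
  (2 * l%:Z - (idx l q)%:Z - ((q %/ N%:Z)%Z - (p %/ N%:Z)%Z) * l%:Z)).
move: (q %/ N%:Z)%Z (p %/ N%:Z)%Z (nat_of_ord (idx l q)) (nat_of_ord (idx l p)).
have -> : N%:Z = 2 * l%:Z + 1 by rewrite -addn1 PoszD PoszM.
by move=> dq dp iq ip; rewrite PoszM; ring.
Qed.

Lemma ucN p : uc (-1 - p) = - uc p.
Proof.
rewrite !ucE divz_reflect !rmorphB /= rmorphN /=.
have : N%:R != 0 :> F by rewrite pnatr_eq0.
have : N%:R = 2 * l%:R + 1 :> F by rewrite -natr1 natrM.
by move: N%:R => c -> c0; field.
Qed.

Lemma tau_x p m : tau (x p m) = - eps ^ m *: x (-1 - p - m) m.
Proof.
rewrite !xE linearD linearZ /= tau_kk tau_E.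
have -> : p + m - p = m by ring.
have -> : -1 - (p + m) = -1 - p - m by ring.
have -> : -1 - p - m + m = -1 - p by ring.
rewrite scalerDr scalerA; congr (_ + _ *: _).
case: eqP => [->|_]; last by rewrite !mul0r mulr0.
by rewrite expr0z subr0 ucN !mul1r mulN1r opprK.
Qed.

Lemma tauK y : tau (tau y) = y.
Proof.
elim/(@principal_ind F l): y => [|y z hy hz|a y hy||p m].
- by rewrite !linear0.
- by rewrite !linearD /= hy hz.
- by rewrite !linearZ /= hy.
- by rewrite !tau_kk.
rewrite tau_x linearZ /= tau_x scalerA mulrNN -expfzDr ?eps0 //.
rewrite (_ : -1 - (-1 - p - m) - m = p); last by ring.
by rewrite (@eps_parity (m + m) 0 m) ?expr0z ?scale1r //; ring.
Qed.

(** The symmetrization of x p m. By w_reflect it depends, up to sign, only on the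
    class of p under p |-> -1 - p - m. *)
Definition w : int -> int -> G := locked (fun p m => x p m + tau (x p m)).

Lemma w_fold p m : w p m = x p m + tau (x p m).
Proof. by rewrite /w -lock. Qed.

Lemma wE p m : w p m = x p m - eps ^ m *: x (-1 - p - m) m.
Proof. by rewrite w_fold tau_x scaleNr. Qed.

Lemma tau_w p m : tau (w p m) = w p m.
Proof. by rewrite w_fold linearD /= tauK addrC. Qed.

Lemma w_congr p q m : p =N q -> w p m = w q m.
Proof. by move=> pq; rewrite !w_fold (x_congr F m pq). Qed.

Lemma w_reflect p m : w (-1 - p - m) m = - eps ^ m *: w p m.
Proof.
rewrite !wE (_ : -1 - (-1 - p - m) - m = p); last by ring.
rewrite scalerBr scalerA mulNr -expfzDr ?eps0 //.
rewrite (@eps_parity (m + m) 0 m); last by ring.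
by rewrite expr0z scaleN1r opprK addrC scaleNr.
Qed.

Lemma x_w p m q n : [lie w p m, x q n] =
  (q =N p + m)%:R *: x p (m + n) - (p =N q + n)%:R *: x q (m + n)
  + ((m + n == 0)%:R * (q =N p + m)%:R * (m%:~R / N%:R)) *: kk glN
  - eps ^ m *: ((q =N -1 - p)%:R *: x (-1 - p - m) (m + n)
     - (-1 - p - m =N q + n)%:R *: x q (m + n)
     + ((m + n == 0)%:R * (q =N -1 - p)%:R * (m%:~R / N%:R)) *: kk glN).
Proof.
rewrite wE bracketDl bracketNl bracketZl !x_bracket.
by rewrite (_ : -1 - p - m + m = -1 - p); last by ring.
Qed.

Definition fold (y : G) : G := y + tau y.

Lemma foldD y z : fold (y + z) = fold y + fold z.
Proof. by rewrite /fold linearD addrACA. Qed.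
Lemma foldZ a y : fold (a *: y) = a *: fold y.
Proof. by rewrite /fold linearZ scalerDr. Qed.
Lemma foldB y z : fold (y - z) = fold y - fold z.
Proof. by rewrite foldD -scaleN1r foldZ scaleN1r. Qed.
Lemma fold_kk : fold (kk glN) = 2%:R *: kk glN.
Proof. by rewrite /fold tau_kk scaler_nat. Qed.

Lemma bracket_fold y z : tau y = y -> [lie y, fold z] = fold [lie y, z].
Proof. by move=> ty; rewrite /fold bracketDr hom_bracket ty. Qed.

Lemma fold_regroup a b c d a' b' c' y z y' z' :
  fold (a *: y - b *: z + c *: kk glN - d *: (a' *: y' - b' *: z' + c' *: kk glN)) =
  a *: fold y - b *: fold z + (2 * c) *: kk glN
  - d *: (a' *: fold y' - b' *: fold z' + (2 * c') *: kk glN).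
Proof. by rewrite !(foldB, foldD, foldZ) fold_kk !scalerA ![_ * 2]mulrC. Qed.

(** Since w p m is fixed by tau, its bracket with w q n is the symmetrization of its
    bracket with x q n. *)
Lemma w_bracket p m q n : [lie w p m, w q n] =
  (q =N p + m)%:R *: w p (m + n) - (p =N q + n)%:R *: w q (m + n)
  + (2 * ((m + n == 0)%:R * (q =N p + m)%:R * (m%:~R / N%:R))) *: kk glN
  - eps ^ m *: ((q =N -1 - p)%:R *: w (-1 - p - m) (m + n)
     - (-1 - p - m =N q + n)%:R *: w q (m + n)
     + (2 * ((m + n == 0)%:R * (q =N -1 - p)%:R * (m%:~R / N%:R))) *: kk glN).
Proof.
rewrite [w q n]w_fold -/(fold (x q n)) (bracket_fold _ (tau_w p m)) x_w fold_regroup.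
by rewrite /fold -!w_fold.
Qed.

End Folding.

(** * The folded algebra and its ideals *)

Lemma bracket_amono_snd (F : fieldType) (g : quadLieType F) (y : affine g) b n :
  ([lie y, amono b n]).2 = - n%:~R * iform (lcoef y.1 (- n)) b.
Proof.
have form0 (c : g) : iform 0 c = 0.
  by have := iform_linl (-1) 0 0 c; rewrite scaleN1r oppr0 addr0 mulN1r addNr.
elim/affine_ind: y => [|y z hy hz|a m|c].
- by rewrite bracket0x lcoef0 form0 mulr0.
- have formD (c d e : g) : iform (c + d) e = iform c e + iform d e.
    by have := iform_linl 1 c d e; rewrite scale1r mul1r.
  by rewrite bracketDl lcoefD formD mulrDr -hy -hz.
- rewrite bracket_amono /= add0r lcoef_mono [- n == m]eq_sym -addr_eq0.
  case: eqP => mn; last by rewrite form0 mulr0 scale0r.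
  have -> : m = - n by apply/eqP; rewrite -addr_eq0 mn.
  by rewrite rmorphN /GRing.scale /= mulr1.
- rewrite bracketZl kk_central scaler0 /= scaler0.
  by rewrite lcoef0 form0 mulr0.
Qed.

Lemma bracket_amono_coef (F : fieldType) (g : quadLieType F) (y : affine g) b n k :
  lcoef ([lie y, amono b n]).1 k = [lie lcoef y.1 (k - n), b].
Proof.
elim/affine_ind: y => [|y z hy hz|a m|c].
- by rewrite bracket0x !lcoef0 bracket0x.
- by rewrite bracketDl !lcoefD hy hz bracketDl.
- rewrite bracket_amono /= scaler0 addr0 !lcoef_mono subr_eq.
  by case: eqP; rewrite ?bracket0x.
- by rewrite bracketZl kk_central scaler0 /= scaler0 !lcoef0 bracket0x.
Qed.

Section PrincipalDerivation.
Variables (F : numFieldType) (l : nat).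
Local Notation N := (2 * l).+1.
Local Notation glN := (gl F N).
Local Notation G := (affine glN).

Definition rho : 'M[F]_N := diag_mx (\row_i (nat_of_ord i)%:R).

(** The principal derivation N t d/dt + [., rho], for which x p m has degree m. *)
Definition pdeg_mx (n : int) (a : glN) : glN :=
  (a : 'M_N) *m rho - rho *m (a : 'M_N) + (n%:~R * N%:R) *: (a : 'M_N).

Lemma pdeg_mx_coef n (a : glN) i j :
  (pdeg_mx n a : 'M_N) i j = (j%:R - i%:R + n%:~R * N%:R) * (a : 'M_N) i j.
Proof. by rewrite /pdeg_mx mul_mx_diag mul_diag_mx !mxE; ring. Qed.

Lemma pdeg_mx_linear n : linear (pdeg_mx n).
Proof.
move=> c a b; apply/matrixP => i j; rewrite [RHS]mxE [in RHS]mxE !pdeg_mx_coef !mxE.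
by ring.
Qed.

Definition pdeg_fun : G -> G := degreewise 0 pdeg_mx_linear.
HB.instance Definition _ := GRing.isLinear.Build F G G _ pdeg_fun
  (degreewise_linear 0 pdeg_mx_linear).

Lemma pdegD y z : pdeg_fun (y + z) = pdeg_fun y + pdeg_fun z.
Proof. exact: linearD. Qed.
Lemma pdegZ c y : pdeg_fun (c *: y) = c *: pdeg_fun y.
Proof. exact: linearZ. Qed.
Lemma pdeg0 : pdeg_fun 0 = 0.
Proof. exact: linear0. Qed.
Lemma pdeg_amono a m : pdeg_fun (amono a m) = amono (pdeg_mx m a) m.
Proof. exact: degreewise_amono. Qed.
Lemma pdeg_kk : pdeg_fun (kk glN) = 0.
Proof. by rewrite /pdeg_fun degreewise_kk scale0r. Qed.
Lemma pdeg_snd y : (pdeg_fun y).2 = 0.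
Proof. exact: mul0r. Qed.

Lemma pdeg_bracket (y z : G) : pdeg_fun [lie y, z] = [lie pdeg_fun y, z] + [lie y, pdeg_fun z].
Proof.
apply: (affine_bilinear (B := fun y z => pdeg_fun [lie y, z])
  (C := fun y z => [lie pdeg_fun y, z] + [lie y, pdeg_fun z])).
- by move=> u v t; rewrite bracketDl linearD.
- by move=> u v t; rewrite bracketDr linearD.
- by move=> u v t; rewrite linearD /= !bracketDl addrACA.
- by move=> u v t; rewrite linearD /= !bracketDr addrACA.
- move=> c u; rewrite pdegZ pdeg_kk scaler0 bracket0x add0r !bracketZl !kk_central.
  by rewrite scaler0 pdeg0.
- move=> c u; rewrite pdegZ pdeg_kk scaler0 bracketx0 addr0 !bracketZr !kkC.
  by rewrite scaler0 pdeg0.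
move=> a m b n; rewrite bracket_amono linearD linearZ /= pdeg_kk scaler0 addr0.
rewrite !pdeg_amono !bracket_amono addrACA -amonoD -scalerDl.
have -> : (if m + n == 0 then m%:~R * iform (pdeg_mx m a) b else 0)
    + (if m + n == 0 then m%:~R * iform a (pdeg_mx n b) else 0) = 0.
  case: eqP => [mn|_]; last by rewrite addr0.
  have -> : n = - m by apply/eqP; rewrite -addr_eq0 addrC mn.
  rewrite -mulrDr [X in _ * X](_ : _ = 0) ?mulr0 //.
  rewrite /iform /= /gl_form /mxtrace -big_split big1 //= => i _.
  rewrite !mxE -big_split big1 //= => k _; rewrite !pdeg_mx_coef rmorphN /=; ring.
rewrite scale0r addr0; congr amono; apply/matrixP => i j.
rewrite pdeg_mx_coef /bracket /= /gl_bracket !mxE.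
rewrite mulrBr !mulr_sumr -!sumrB -big_split /=; apply: eq_bigr => k _.
rewrite !pdeg_mx_coef rmorphD /=; ring.
Qed.

Lemma pdeg_E p q : pdeg_fun (E F l p q) = (q - p)%:~R *: E F l p q.
Proof.
rewrite /E pdeg_amono -amonoZ; congr amono; apply/matrixP => i j.
rewrite pdeg_mx_coef !mxE; case: (eqVneq i) => [->|_] /=; last by rewrite !mulr0.
case: (eqVneq j) => [->|_] /=; last by rewrite !mulr0.
rewrite !mulr1 !pmulrn !idxE /modz !rmorphB !rmorphM /=; ring.
Qed.

Lemma pdeg_x p m : pdeg_fun (x F l p m) = m%:~R *: x F l p m.
Proof.
rewrite xE pdegD pdegZ pdeg_kk scaler0 addr0 pdeg_E scalerDr scalerA.
rewrite (_ : p + m - p = m); last by ring.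
by case: eqP => [->|_]; rewrite ?(mul0r, mulr0) ?scale0r addr0.
Qed.

End PrincipalDerivation.

Section FoldedAlgebra.
Variables (F : numClosedFieldType) (l : nat) (eps : F).
Hypothesis eps2 : eps * eps = 1.
Local Notation N := (2 * l).+1.
Local Notation glN := (gl F N).
Local Notation G := (affine glN).
Local Notation "p =N q" := (p == q %[mod N%:Z])%Z (at level 70).
Local Notation x := (@x F l).
Local Notation tau := (tau l eps2).
Local Notation w := (w l eps2).
Local Notation twist := (twist_mx (Jmx l eps) (Jmx l eps) eps).

Definition folded : subalg G := cap_subalg (affine_sub (sl F N)) (fixed_subalg tau).

Lemma foldedP y : reflect ((forall m, \tr (lcoef y.1 m : 'M_N) = 0) /\ tau y = y)
  (y \in subalg_pred folded).
Proof.
apply: (iffP andP) => [[/asboolP hy]|[hy ty]].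
  by rewrite inE => /eqP ty; split=> // m; apply/eqP; have := hy m; rewrite inE.
split; last by rewrite inE ty.
by apply/asboolP => m; rewrite inE; apply/eqP.
Qed.

Lemma folded_amono a m : \tr (a : 'M_N) = 0 -> twist m a = a ->
  amono (a : glN) m \in subalg_pred folded.
Proof.
move=> ta xa; apply/foldedP; split=> [k|]; last by rewrite /tau twist_homE xa.
by rewrite lcoef_mono; case: eqP => // _; rewrite mxtrace0.
Qed.

Lemma folded_coef y m : y \in subalg_pred folded -> twist m (lcoef y.1 m) = lcoef y.1 m.
Proof. by move=> /foldedP[_ ty]; rewrite -{2}ty. Qed.

Lemma rev_ord_natr (r : 'I_N) : (rev_ord r)%:R = (2 * l)%:R - r%:R :> F.
Proof. by rewrite /= subSS natrB // -ltnS. Qed.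

Lemma eps_conj m : (eps ^ m)^* = eps ^ m.
Proof.
have eps_real : eps \is Num.real.
  have /eqP := eps2; rewrite -expr2 sqrf_eq1 => /orP[]/eqP ->; rewrite ?rpredN.
    exact: rpred1.
  exact: rpred1.
by apply: conj_Creal; rewrite rpredXz.
Qed.

Lemma twist_coefE m (a : glN) (i j : 'I_N) : (twist m a : 'M_N) i j
  = - (eps ^ (m + i%:Z + j%:Z) * (a : 'M_N) (rev_ord j) (rev_ord i)).
Proof. exact: twist_J_coef. Qed.

Lemma twist_trace m (a : glN) : \tr (twist m a : 'M_N) = - eps ^ m * \tr (a : 'M_N).
Proof.
rewrite /twist_mx -scaleNr mxtraceZ -[X in _ = _ * X]mxtrace_tr.
by congr (_ * _); apply: conj_mx_trace; apply: JmxK.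
Qed.

(** The conjugate transpose: a and adj a pair to a sum of squared moduli. *)
Definition adj (a : 'M[F]_N) : 'M[F]_N := \matrix_(i, j) (a j i)^*.

Lemma adj_trace (a : 'M[F]_N) : \tr a = 0 -> \tr (adj a) = 0.
Proof.
move=> a0; rewrite /mxtrace (eq_bigr (fun i => (a i i)^*)) => [|i _].
  by rewrite -rmorph_sum; apply: etrans (congr1 _ a0) (rmorph0 _).
by rewrite mxE.
Qed.

Lemma adj_twist m (a : glN) : twist m a = a -> twist (- m) (adj a) = adj a.
Proof.
move=> ta; apply/matrixP => i j; rewrite twist_coefE [in RHS]mxE -[in RHS]ta.
rewrite twist_coefE mxE rmorphN rmorphM /= eps_conj; congr (- (_ * _)).
by apply: (eps_parity eps2 (k := - m)); ring.
Qed.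

Lemma adj_form (a : glN) : iform a (adj a : glN) = 0 -> a = 0.
Proof.
rewrite /iform /= /gl_form /mxtrace => h; apply/matrixP => i j; rewrite mxE.
have pos k : true -> 0 <= ((a : 'M_N) *m adj a) k k.
  by move=> _; rewrite mxE sumr_ge0 // => r _; rewrite mxE mul_conjC_ge0.
have /(_ i erefl)/eqP := @psumr_eq0P _ _ _ _ pos h.
rewrite mxE psumr_eq0 => [/allP/(_ j (mem_index_enum _))|r _]; last first.
  by rewrite mxE mul_conjC_ge0.
by rewrite /= mxE mul_conjC_eq0 => /eqP.
Qed.

(** The orthogonal Lie algebra of the form J has no centre: a regular diagonal
    matrix forces a to be diagonal, and then the entries of a agree with the
    middle one, which vanishes. The test elements b are taken in degree 2, which
    imposes on b the same condition as degree 0. *)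
Lemma centerless (a : glN) : twist 0 a = a ->
  (forall b : glN, \tr (b : 'M_N) = 0 -> twist 2 b = b -> [lie a, b] = 0) -> a = 0.
Proof.
move=> ta ca.
have diag i j : i != j -> (a : 'M_N) i j = 0.
  move=> ij; pose d : glN := diag_mx (\row_k (k%:R - l%:R)).
  have trd : twist 2 d = d.
    apply/matrixP => r s; rewrite twist_coefE !mxE (inj_eq rev_ord_inj) eq_sym.
    case: eqP => [->|_]; last by rewrite !mulr0n mulr0 oppr0.
    rewrite !mulr1n (eps_parity eps2 (n := 0) (k := 1 + s%:Z)); last by ring.
    rewrite rev_ord_natr natrM expr0z; ring.
  have d0 : \tr (d : 'M_N) = 0.
    have : \tr (d : 'M_N) = - \tr (d : 'M_N).
      by rewrite -{1}trd twist_trace -exprnP expr2 eps2 mulN1r.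
    by move/eqP; rewrite -addr_eq0 -mulr2n mulrn_eq0 /= => /eqP.
  have /matrixP/(_ i j) := ca d d0 trd.
  rewrite /bracket /= /gl_bracket mul_mx_diag mul_diag_mx !mxE => /eqP.
  have -> : (a : 'M_N) i j * (j%:R - l%:R) - (i%:R - l%:R) * (a : 'M_N) i j =
    (j%:R - i%:R) * (a : 'M_N) i j by ring.
  rewrite mulf_eq0 subr_eq0 eqr_nat => /orP[/eqP ji|/eqP //].
  by case/eqP: ij; apply: val_inj.
have lN : (l < N)%N by lia.
pose o := Ordinal lN.
have revo : rev_ord o = o by apply: val_inj; rewrite /=; lia.
have aoo : (a : 'M_N) o o = 0.
  have : (a : 'M_N) o o = - (a : 'M_N) o o.
    rewrite -{1}ta twist_coefE revo (eps_parity eps2 (n := 0) (k := o%:Z)); last by ring.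
    by rewrite expr0z mul1r.
  by move/eqP; rewrite -addr_eq0 -mulr2n mulrn_eq0 /= => /eqP.
apply/matrixP => i j; rewrite mxE; have [<-|/diag //] := eqVneq i j.
have [->//|io] := eqVneq i o.
pose b : glN := (delta_mx i o : glN) + twist 2 (delta_mx i o : glN).
have tb : twist 2 b = b.
  have tl : linear (twist 2) by move=> c u v; apply/matrixP => r s;
    rewrite twist_coefE [RHS]mxE [in RHS]mxE !twist_coefE !mxE; ring.
  have := tl 1 (delta_mx i o : glN) (twist 2 (delta_mx i o : glN)).
  rewrite !scale1r -/b => ->; rewrite addrC; congr (_ + _).
  apply/matrixP => r s; rewrite !twist_coefE !rev_ordK mulrN opprK mulrA -expfzDr ?eps0 //.
  rewrite (eps_parity eps2 (n := 0) (k := 2 + 2 * l%:Z)) ?expr0z ?mul1r //=.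
  by have := ltn_ord r; have := ltn_ord s; lia.
have b0 : \tr (b : 'M_N) = 0.
  by rewrite mxtraceD twist_trace -exprnP expr2 eps2 mulN1r subrr.
have /matrixP/(_ i o) := ca b b0 tb.
have bio : (b : 'M_N) i o = 1.
  rewrite /b mxE twist_coefE !mxE !eqxx revo eq_sym (negPf io) /=.
  by rewrite mulr0 subr0.
rewrite /bracket /= /gl_bracket !mxE (bigD1 i) //= big1 => [|k ki]; last first.
  by rewrite diag ?mul0r // eq_sym.
rewrite (bigD1 o) //= big1 => [|k ko]; last by rewrite diag ?mulr0.
by rewrite bio aoo mulr1 mulr0 !addr0 subr0.
Qed.

(** Bracketing y with the adjoint of its coefficient of degree n, placed in degree
    - n, gives the central coordinate n times a sum of squared moduli. So only the
    coefficient of degree 0 is left, and it commutes with everything. *)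
Lemma folded_simple (J : G -> Prop) :
  (forall y, J y -> y \in subalg_pred folded /\ y.2 = 0) ->
  (forall y z, J y -> z \in subalg_pred folded -> J [lie y, z]) ->
  forall y, J y -> y = 0.
Proof.
move=> JL JB.
have coef0 y n : J y -> n != 0 -> lcoef y.1 n = 0.
  move=> Jy n0; have [Ly _] := JL y Jy; apply: adj_form.
  have Lb : amono (adj (lcoef y.1 n) : glN) (- n) \in subalg_pred folded.
    apply: folded_amono; first exact/adj_trace/(proj1 (foldedP _ Ly)).
    exact/adj_twist/folded_coef.
  have [_ /eqP] := JL _ (JB _ _ Jy Lb); rewrite bracket_amono_snd opprK.
  by rewrite mulf_eq0 rmorphN oppr_eq0 oppr_eq0 intr_eq0 (negPf n0) => /eqP.
move=> y Jy; have [Ly y2] := JL y Jy.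
have y0 : lcoef y.1 0 = 0.
  apply: centerless; first exact: folded_coef.
  move=> b trb tb; have Lb := folded_amono trb tb.
  have := coef0 _ 2%:Z (JB _ _ Jy Lb) isT.
  by rewrite bracket_amono_coef subrr.
apply: affineP => //; apply: lcoefP => n; rewrite lcoef0.
by have [->//|/coef0->] := eqVneq n 0.
Qed.

End FoldedAlgebra.

(** * Generators of the folded algebra *)

(** The W p m satisfy the relations of the w p m in positive degrees, but may also
    be their negative transposes; so the results serve positive and negative
    degrees alike. *)
Section Generation.
Variables (F : numFieldType) (G : lieType F) (l : nat) (eps : F).
Hypothesis l_gt0 : (0 < l)%N.
Hypothesis eps2 : eps * eps = 1.
Local Notation N := (2 * l).+1.
Local Notation dv z := (N%:Z %| z)%Z.
Variable W : int -> int -> G.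
Hypothesis W_congr : forall p q m, dv (p - q) -> W p m = W q m.
Hypothesis W_reflect : forall p m, W (-1 - p - m) m = - eps ^ m *: W p m.
Hypothesis W_bracket : forall p m q n, 0 < m -> 0 < n -> [lie W p m, W q n] =
  (dv (q - (p + m)))%:R *: W p (m + n) - (dv (p - (q + n)))%:R *: W q (m + n)
  - eps ^ m *: ((dv (q - (-1 - p)))%:R *: W (-1 - p - m) (m + n)
     - (dv (-1 - p - m - (q + n)))%:R *: W q (m + n)).
Variable S : subalg G.

Lemma dv_shift k b a c : a = k * b + c -> dv b -> dv a = dv c.
Proof. by move=> -> hb; rewrite rpredDl ?dvdz_mull. Qed.

Lemma dvN z : dv (- z) = dv z.
Proof. exact: rpredN. Qed.

Lemma dv_half z : dv (2 * z) = dv z.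
Proof.
rewrite Gauss_dvdzr // /coprimez /gcdz /= -addn1 mulnC.
by rewrite gcdnC gcdnMDl gcdn1.
Qed.

Lemma dv1 : dv 1 = false.
Proof. by rewrite dvdzE /= dvdn1 eqSS muln_eq0 /= -leqn0 leqNgt l_gt0. Qed.
Lemma dv2 : dv 2 = false.
Proof. exact: etrans (dv_half 1) dv1. Qed.

Lemma eps_pm1 m : (eps ^ m == 1) || (eps ^ m == -1).
Proof.
by rewrite -sqrf_eq1 expr2 -expfzMl eps2 exp1rz.
Qed.

(** In degrees divisible by N the diagonal matrices occur, and only those of trace
    0 can be reached. *)
Definition reached m :=
  (~~ dv m -> forall p, W p m \in subalg_pred S) /\
  (dv m -> forall p q, W p m - W q m \in subalg_pred S).

Lemma SZ_inv (c : F) y : c != 0 -> c *: y \in subalg_pred S -> y \in subalg_pred S.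
Proof. by move=> c0 Sy; rewrite -[y](scalerK c0) rpredZ. Qed.

Lemma consecutive_differences m :
  (forall p, ~~ dv p -> W p m - W (p - 1) m \in subalg_pred S) ->
  forall p q, W p m - W q m \in subalg_pred S.
Proof.
move=> step.
have small r : (r < N)%N -> W r%:Z m - W 0 m \in subalg_pred S.
  elim: r => [|r IH] rN; first by rewrite subrr rpred0.
  have rN' : ~~ dv r.+1%:Z.
    by rewrite dvdzE /= gtnNdvd.
  have := rpredD (step _ rN') (IH (ltnW rN)).
  by rewrite (_ : r.+1%:Z - 1 = r%:Z) ?subrKA //; lia.
have any p : W p m - W 0 m \in subalg_pred S.
  have p0 : 0 <= (p %% N%:Z)%Z by apply: modz_ge0.
  have pN : (p %% N%:Z)%Z < N%:Z by apply: ltz_pmod.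
  rewrite (@W_congr p (p %% N%:Z)%Z); last first.
    by rewrite {1}(divz_eq p N%:Z) addrK dvdz_mull.
  case: (p %% N%:Z)%Z p0 pN => // r _ rN; apply: small; lia.
move=> p q; have := rpredB (any p) (any q).
by rewrite opprB addrA subrK.
Qed.

Hypothesis S1 : forall p, W p 1 \in subalg_pred S.
Hypothesis S2 : W (-1) 2 \in subalg_pred S.

(** The four terms of [W p m, W (p + m) 1] reduce to one. *)
Lemma reach_generic p m : 0 < m -> W p m \in subalg_pred S ->
  ~~ dv (m + 1) -> ~~ dv (p + m + 1) -> ~~ dv (2 * p + m + 1) ->
  W p (m + 1) \in subalg_pred S.
Proof.
move=> m0 Wpm h1 h2 h3.
have := subalg_bracket Wpm (S1 (p + m)); rewrite W_bracket //.
rewrite subrr dvdz0 scale1r.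
rewrite (_ : p - _ = - (m + 1)) ?dvN; last by ring.
rewrite (_ : p + m - _ = 2 * p + m + 1); last by ring.
rewrite (_ : - 1 - p - m - _ = - (2 * (p + m + 1))) ?dvN ?dv_half; last by ring.
by rewrite (negPf h1) (negPf h2) (negPf h3) !scale0r !subr0 scaler0 subr0.
Qed.

(** When N divides m, [W r m, W q 1] is a multiple of W q (m + 1). The factors for
    r = q and r = q + 1 differ, except where W q (m + 1) = 0. *)
Lemma reach_mod0 m : 0 < m -> reached m -> dv m -> forall p, W p (m + 1) \in subalg_pred S.
Proof.
move=> m0 [_ /[swap] mN /(_ mN) Wm] q.
have E r : [lie W r m, W q 1] = ((dv (q - r))%:R - (dv (r - q - 1))%:R
    - eps ^ m * ((dv (q + r + 1))%:R - (dv (q + r + 2))%:R)) *: W q (m + 1).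
  rewrite W_bracket //.
  rewrite (@dv_shift (-1) m (q - (r + m)) (q - r)) //; last by ring.
  rewrite (@dv_shift 0 m (r - (q + 1)) (r - q - 1)) //; last by ring.
  rewrite (@dv_shift 0 m (q - (-1 - r)) (q + r + 1)) //; last by ring.
  rewrite (@dv_shift (-1) m (-1 - r - m - (q + 1)) (- (q + r + 2))) ?dvN //; last by ring.
  rewrite scalerBl scalerBl -scalerA scalerBl; congr (_ - _ - _ *: (_ - _)).
    case: (boolP (dv (q - r))) => [h|_]; rewrite ?scale0r // (@W_congr r q) //.
    by rewrite (@dv_shift (-1) (q - r) (r - q) 0) //; ring.
  case: (boolP (dv (q + r + 1))) => [h|_]; rewrite ?scale0r // (@W_congr _ q) //.
  rewrite (@dv_shift (-1) (q + r + 1) _ (- m)) ?dvN //; ring.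
have wE : W q m - W (q + 1) m \in subalg_pred S by apply: Wm.
have E' r a b c d : q - r = a -> r - q - 1 = b -> q + r + 1 = c -> q + r + 2 = d ->
  [lie W r m, W q 1] = ((dv a)%:R - (dv b)%:R
    - eps ^ m * ((dv c)%:R - (dv d)%:R)) *: W q (m + 1).
  by move=> <- <- <- <-.
have := subalg_bracket wE (S1 q); rewrite bracketDl bracketNl.
rewrite (E' q 0 (- 1) (2 * q + 1) (2 * (q + 1))); [|ring..].
rewrite (E' (q + 1) (- 1) 0 (2 * (q + 1)) (2 * q + 3)); [|ring..].
rewrite -scalerBl.
rewrite dvdz0 !dvN dv1 dv_half; have em := eps_pm1 m.
have [q1|q1] := boolP (dv (q + 1)).
  rewrite (@dv_shift 2 (q + 1) (2 * q + 1) (-1)) ?dvN ?dv1 //; last by ring.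
  rewrite (@dv_shift 2 (q + 1) (2 * q + 3) 1) ?dv1 //; last by ring.
  case/orP: em => /eqP em; rewrite em.
    by apply: SZ_inv; rewrite (_ : _ - _ = 4%:R) ?pnatr_eq0 //=; ring.
  have epsN : eps = -1.
    have := eps_pm1 1; rewrite expr1z => /orP[]/eqP // e1.
    by move/eqP: em; rewrite e1 exp1rz -addr_eq0 -(natrD _ 1 1) pnatr_eq0.
  have eM : eps ^ (m + 1) = 1.
    by rewrite expfzDr ?epsN ?oppr_eq0 ?oner_eq0 // -epsN em expr1z epsN mulrNN mulr1.
  (* The factor vanishes, but W q (m + 1) is then opposite to its mirror image,
     which is itself. *)
  suff -> : W q (m + 1) = 0 by rewrite rpred0.
  have := W_reflect q (m + 1); rewrite eM scaleN1r (@W_congr _ q).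
    by move/eqP; rewrite -addr_eq0 -mulr2n -scaler_nat scaler_eq0 pnatr_eq0 /= => /eqP.
  by rewrite (@dv_shift (-2) (q + 1) _ (- m)) ?dvN //; ring.
apply: SZ_inv; case: (boolP (dv (2 * q + 1))) => h1.
  rewrite (@dv_shift 1 (2 * q + 1) (2 * q + 3) 2) ?dv2 //; last by ring.
  case/orP: em => /eqP ->.
    by rewrite (_ : _ - _ = 1) ?oner_eq0 //=; ring.
  by rewrite (_ : _ - _ = 3%:R) ?pnatr_eq0 //=; ring.
case: (dv (2 * q + 3)).
  case/orP: em => /eqP ->.
    by rewrite (_ : _ - _ = 1) ?oner_eq0 //=; ring.
  by rewrite (_ : _ - _ = 3%:R) ?pnatr_eq0 //=; ring.
by rewrite (_ : _ - _ = 2%:R) ?pnatr_eq0 //=; ring.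
Qed.

(** When N divides m + 1, [W p m, W (p + m) 1] has two terms. *)
Lemma reach_next_mod0 m : 0 < m -> reached m -> dv (m + 1) ->
  forall p q, W p (m + 1) - W q (m + 1) \in subalg_pred S.
Proof.
move=> m0 [Wm _] mN.
have mN' : ~~ dv m.
  by apply/negP => h; have := dv1; rewrite -(@dv_shift 1 m (m + 1) 1) ?mN //; ring.
have step p : ~~ dv p -> W p (m + 1) - W (p - 1) (m + 1) \in subalg_pred S.
  move=> p0; have := subalg_bracket (Wm mN' p) (S1 (p + m)); rewrite W_bracket //.
  rewrite subrr dvdz0 (_ : p - _ = - (m + 1)) ?dvN ?mN; last by ring.
  rewrite (@dv_shift 1 (m + 1) (p + m - (-1 - p)) (2 * p)) ?dv_half ?(negPf p0) //; last by ring.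
  rewrite (@dv_shift (-2) (m + 1) (-1 - p - m - (p + m + 1)) (- (2 * p))) //; last by ring.
  rewrite dvN dv_half (negPf p0) !scale0r subr0 scaler0 subr0 !scale1r.
  rewrite (@W_congr (p + m) (p - 1)) //.
  by rewrite (@dv_shift 1 (m + 1) _ 0) //; ring.
exact: consecutive_differences.
Qed.

(** When N divides n, neither -1 nor its mirror image -2 is generic in degree
    n + 1; this is where W (-1) 2 is needed. *)
Lemma reach_exceptional n : 0 < n -> reached n -> dv n -> W (-1) (n + 2) \in subalg_pred S.
Proof.
move=> n0 [_ /[swap] nN /(_ nN) Wn].
have e2 : eps ^ 2 = 1 by rewrite -exprnP expr2.
have E r : [lie W (-1) 2, W r n] = (dv (r - 1))%:R *: W (-1) (n + 2)
    - (dv (r + 1))%:R *: W r (n + 2) - ((dv r)%:R *: W (-2) (n + 2)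
      - (dv (r + 2))%:R *: W r (n + 2)).
  rewrite W_bracket // e2 scale1r [2 + n]addrC.
  rewrite (@dv_shift 0 n (r - (-1 + 2)) (r - 1)) //; last by ring.
  rewrite (@dv_shift (-1) n (-1 - (r + n)) (- (r + 1))) ?dvN //; last by ring.
  rewrite (@dv_shift 0 n (r - (-1 - -1)) r) //; last by ring.
  rewrite (@dv_shift (-1) n (-1 - -1 - 2 - (r + n)) (- (r + 2))) ?dvN //.
  by ring.
have E' r (a b c d : bool) : dv (r - 1) = a -> dv (r + 1) = b -> dv r = c ->
    dv (r + 2) = d -> [lie W (-1) 2, W r n] = a%:R *: W (-1) (n + 2)
    - b%:R *: W r (n + 2) - (c%:R *: W (-2) (n + 2) - d%:R *: W r (n + 2)).
  by move=> <- <- <- <-.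
have := subalg_bracket S2 (Wn (-1) 1); rewrite bracketDr bracketNr.
rewrite (E' (-1) false true false false) ?dvdz0 ?dv1 //; last 2 first.
- exact: etrans (dvN 2) dv2.
- exact: etrans (dvN 1) dv1.
rewrite (E' 1 true false false (dv (1 + 2))) ?dv1 //; last exact: dv2.
rewrite !scale0r !scale1r !subr0 !sub0r opprK.
have [d3|_] := boolP (dv (1 + 2)); last first.
  rewrite scale0r addr0 -opprD -mulr2n -scaler_nat -scaleNr.
  by apply: SZ_inv; rewrite oppr_eq0 pnatr_eq0.
have -> : W 1 (n + 2) = - eps ^ (n + 2) *: W (-1) (n + 2).
  rewrite -W_reflect; apply: W_congr.
  by rewrite (@dv_shift 1 n _ (1 + 2)) //; ring.
rewrite scale1r -{1 2}[W (-1) (n + 2)]scale1r -!scaleNr -!scalerDl -scalerBl.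
apply: SZ_inv; case/orP: (eps_pm1 (n + 2)) => /eqP ->.
  by rewrite (_ : _ - _ = - 1%:R) ?oppr_eq0 ?pnatr_eq0 //; ring.
by rewrite (_ : _ - _ = - 3%:R) ?oppr_eq0 ?pnatr_eq0 //; ring.
Qed.

(** If p is not generic, either its mirror image is, or W p (m + 1) is a
    multiple of W (-1) (m + 1). *)
Lemma reach_next m : 0 < m -> reached m -> (1 < m -> reached (m - 1)) -> reached (m + 1).
Proof.
move=> m0 rm rm1; split=> mN; last exact: reach_next_mod0.
have [mN'|mN'] := boolP (dv m); first exact: reach_mod0.
have Wm p : W p m \in subalg_pred S by apply: (proj1 rm).
have exceptional : W (-1) (m + 1) \in subalg_pred S.
  have [m1|m1] := boolP (dv (m - 1)).
    have [->|m2] := eqVneq m 1; first exact: S2.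
    have m3 : 1 < m by lia.
    have := @reach_exceptional (m - 1) _ (rm1 m3) m1.
    by rewrite (_ : m - 1 + 2 = m + 1); [apply; lia|ring].
  apply: reach_generic => //; first by rewrite (_ : - 1 + m + 1 = m) //; ring.
  by rewrite (_ : 2 * -1 + m + 1 = m - 1) //; ring.
have refl p : dv (p + m + 1) -> W p (m + 1) \in subalg_pred S.
  move=> pm; have := W_reflect (-1) (m + 1); rewrite (@W_congr _ p) => [->|].
    exact: rpredZ.
  by rewrite (@dv_shift (-1) (p + m + 1) _ 0) ?dvdz0 //; ring.
move=> p; have [/refl//|pm] := boolP (dv (p + m + 1)).
have [pm2|pm2] := boolP (dv (2 * p + m + 1)); last exact: reach_generic.
have := W_reflect (p - 1) (m + 1); rewrite (@W_congr _ p) => [->|]; last first.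
  by rewrite (@dv_shift (-1) (2 * p + m + 1) _ 0) ?dvdz0 //; ring.
apply: rpredZ; have [pm3|pm3] := boolP (dv (p - 1 + m + 1)); first exact: refl.
apply: reach_generic => //.
by rewrite (@dv_shift 1 (2 * p + m + 1) _ (-2)) ?dvN ?dv2 //; ring.
Qed.

Lemma reach_all m : 0 < m -> reached m.
Proof.
have r1 : reached 1 by split; rewrite ?dv1.
suff h (n : nat) : reached n.+1%:Z /\ reached n.+2%:Z.
  by case: m => // [[|n]] // _; case: (h n).
elim: n => [|n [IH IH']]; split=> //.
  by apply: (@reach_next 1).
rewrite (_ : n.+3%:Z = n.+2%:Z + 1); last by lia.
exact: reach_next.
Qed.
End Generation.

(** Minus the transpose, with t replaced by its inverse, maps w p m to
    - w (p + m) (- m), so that this family satisfies the same relations. *)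
Section OppositeFamily.
Variables (F : numFieldType) (G : lieType F) (l : nat) (eps : F).
Local Notation N := (2 * l).+1.
Local Notation dv z := (N%:Z %| z)%Z.
Hypothesis epsN : forall m, eps ^ (- m) = eps ^ m.
Variable W : int -> int -> G.
Hypothesis W_congr : forall p q m, dv (p - q) -> W p m = W q m.
Hypothesis W_reflect : forall p m, W (-1 - p - m) m = - eps ^ m *: W p m.
Hypothesis W_bracket : forall p m q n, m + n != 0 -> [lie W p m, W q n] =
  (dv (q - (p + m)))%:R *: W p (m + n) - (dv (p - (q + n)))%:R *: W q (m + n)
  - eps ^ m *: ((dv (q - (-1 - p)))%:R *: W (-1 - p - m) (m + n)
     - (dv (-1 - p - m - (q + n)))%:R *: W q (m + n)).

Definition opposite (p m : int) : G := - W (p + m) (- m).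

Lemma opposite_congr p q m : dv (p - q) -> opposite p m = opposite q m.
Proof.
move=> h; congr (- _); apply: W_congr.
by rewrite (_ : _ - _ = p - q) //; ring.
Qed.

Lemma opposite_reflect p m : opposite (-1 - p - m) m = - eps ^ m *: opposite p m.
Proof.
have := W_reflect (p + m) (- m).
rewrite (_ : -1 - (p + m) - - m = -1 - p - m + m) ?epsN => [h|]; last by ring.
by rewrite /opposite h scalerN.
Qed.

Lemma opposite_bracket p m q n : m + n != 0 -> [lie opposite p m, opposite q n] =
  (dv (q - (p + m)))%:R *: opposite p (m + n)
  - (dv (p - (q + n)))%:R *: opposite q (m + n)
  - eps ^ m *: ((dv (q - (-1 - p)))%:R *: opposite (-1 - p - m) (m + n)
     - (dv (-1 - p - m - (q + n)))%:R *: opposite q (m + n)).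
Proof.
move=> mn; rewrite /opposite bracketNl bracketNr opprK W_bracket; last first.
  by rewrite -opprD oppr_eq0.
rewrite epsN !scalerN !opprK -opprD.
have dvC a b : a = - b -> dv a = dv b by move=> ->; apply: rpredN.
have dvE a b : a = b -> dv a = dv b by move=> ->.
have WD a b p1 q1 k : dv a = dv b -> (dv b -> dv (p1 - q1)) ->
    (dv a)%:R *: W p1 k = (dv b)%:R *: W q1 k.
  move=> ->; case: (dv b) => [h|_]; last by rewrite !scale0r.
  by rewrite (W_congr _ (h isT)).
rewrite (WD (q + n - (p + m + - m)) (p - (q + n)) (p + m) (q + (m + n))) => [||h].
- rewrite (WD (p + m - (q + n + - n)) (q - (p + m)) (q + n) (p + (m + n))) => [||h].
  + rewrite (WD _ (-1 - p - m - (q + n)) (-1 - (p + m) + m) (q + (m + n))) => [||h].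
    * rewrite (WD (-1 - (p + m) + m - (q + n + - n)) (q - (-1 - p)) (q + n)
        (-1 - p - m + (m + n))) => [||h].
      - rewrite [X in X - _ = _]addrC; congr (_ - _ *: _).
        by rewrite addrC.
      - by apply: dvC; ring.
      - by rewrite (_ : _ - _ = q - (-1 - p)) //; ring.
    * by apply: dvC; ring.
    * by rewrite (_ : _ - _ = -1 - p - m - (q + n)) //; ring.
  + by apply: dvC; ring.
  + by rewrite (_ : _ - _ = q - (p + m)) //; ring.
- by apply: dvC; ring.
- by rewrite (_ : _ - _ = p - (q + n)) //; ring.
Qed.
End OppositeFamily.

Lemma cartan_regroup (R : comPzRingType) (V : lmodType R) (b : bool) (e c : R) (u v k u' : V) :
  (b -> u' = u) ->
  1%:R *: u - 1%:R *: v + (2 * (1%:R * 1%:R * c)) *: k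
  - e *: (b%:R *: u' - b%:R *: v + (2 * (1%:R * b%:R * c)) *: k) =
  (1 - e * b%:R) *: (u - v + (2 * c) *: k).
Proof.
move=> h; have -> : b%:R *: u' = b%:R *: u by case: b h => [->|]; rewrite ?scale0r.
rewrite !mul1r !scale1r scalerBl scale1r -[(e * _) *: _]scalerA; congr (_ - _ *: _).
by rewrite scalerDr scalerBr scalerA mulrCA.
Qed.

Section FoldedGeneration.
Variables (F : numClosedFieldType) (l : nat) (eps : F).
Hypothesis l_gt0 : (0 < l)%N.
Hypothesis eps2 : eps * eps = 1.
Local Notation N := (2 * l).+1.
Local Notation glN := (gl F N).
Local Notation G := (affine glN).
Local Notation dv z := (N%:Z %| z)%Z.
Local Notation x := (@x F l).
Local Notation w := (w l eps2).
Local Notation fold := (fold (l := l) eps2).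

Lemma w_dv p q m : dv (p - q) -> w p m = w q m.
Proof. by rewrite -eqz_mod_dvd; apply: w_congr. Qed.

Lemma w_bracket_dv p m q n : [lie w p m, w q n] =
  (dv (q - (p + m)))%:R *: w p (m + n) - (dv (p - (q + n)))%:R *: w q (m + n)
  + (2 * ((m + n == 0)%:R * (dv (q - (p + m)))%:R * (m%:~R / N%:R))) *: kk glN
  - eps ^ m *: ((dv (q - (-1 - p)))%:R *: w (-1 - p - m) (m + n)
     - (dv (-1 - p - m - (q + n)))%:R *: w q (m + n)
     + (2 * ((m + n == 0)%:R * (dv (q - (-1 - p)))%:R * (m%:~R / N%:R))) *: kk glN).
Proof. by rewrite -!eqz_mod_dvd; apply: w_bracket. Qed.

Lemma w_bracket_neq0 p m q n : m + n != 0 -> [lie w p m, w q n] =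
  (dv (q - (p + m)))%:R *: w p (m + n) - (dv (p - (q + n)))%:R *: w q (m + n)
  - eps ^ m *: ((dv (q - (-1 - p)))%:R *: w (-1 - p - m) (m + n)
     - (dv (-1 - p - m - (q + n)))%:R *: w q (m + n)).
Proof.
move=> /negPf mn; rewrite w_bracket_dv mn !mul0r !mulr0 !scale0r.
by rewrite [X in X - _ = _]addr0 [X in _ - _ *: X = _]addr0.
Qed.

Lemma epsN m : eps ^ (- m) = eps ^ m.
Proof. by apply: (eps_parity eps2 (k := - m)); ring. Qed.

(** The factor is 1, except for 2p + m + 1 divisible by N, where it is 0 if
    w p m = 0, and 2 if w p m is twice a basis element. *)
Lemma w_bracket_opp p m : [lie w p m, w (p + m) (- m)] =
  (1 - eps ^ m * (dv (2 * p + m + 1))%:R)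
  *: (w p 0 - w (p + m) 0 + (2 * (m%:~R / N%:R)) *: kk glN).
Proof.
have E' (a b c d : bool) z : m - m = z -> dv (p + m - (p + m)) = a ->
    dv (p - (p + m + - m)) = b -> dv (p + m - (-1 - p)) = c ->
    dv (-1 - p - m - (p + m + - m)) = d -> [lie w p m, w (p + m) (- m)] =
  a%:R *: w p z - b%:R *: w (p + m) z
  + (2 * ((z == 0)%:R * a%:R * (m%:~R / N%:R))) *: kk glN
  - eps ^ m *: (c%:R *: w (-1 - p - m) z - d%:R *: w (p + m) z
     + (2 * ((z == 0)%:R * c%:R * (m%:~R / N%:R))) *: kk glN).
  by move=> <- <- <- <- <-; apply: w_bracket_dv.
rewrite (E' true true (dv (2 * p + m + 1)) (dv (2 * p + m + 1)) 0).
- apply: cartan_regroup => h; apply: w_dv.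
  by rewrite (_ : -1 - p - m - p = - (2 * p + m + 1)) ?rpredN //; ring.
- by ring.
- by rewrite subrr dvdz0.
- by rewrite (_ : p - _ = 0) ?dvdz0 //; ring.
- by rewrite (_ : p + m - _ = 2 * p + m + 1) //; ring.
- by rewrite (_ : -1 - p - m - _ = - (2 * p + m + 1)) ?rpredN //; ring.
Qed.

Lemma w_bracket_opp_eq p m q (b : bool) : p + m = q -> dv (2 * p + m + 1) = b ->
  [lie w p m, w q (- m)] =
  (1 - eps ^ m * b%:R) *: (w p 0 - w q 0 + (2 * (m%:~R / N%:R)) *: kk glN).
Proof. by move=> <- <-; apply: w_bracket_opp. Qed.

Variable S : subalg G.
Hypothesis S1 : forall p, w p 1 \in subalg_pred S.
Hypothesis SN1 : forall p, w p (- 1) \in subalg_pred S.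
Hypothesis S2 : w (-1) 2 \in subalg_pred S.
Hypothesis SN2 : w 1 (- 2) \in subalg_pred S.

Lemma folded_reach_pos m : 0 < m -> reached l w S m.
Proof.
apply: (@reach_all F G l eps l_gt0 eps2) => [p q n|p n|p k q n k0 n0||].
- exact: w_dv.
- exact: w_reflect.
- by apply: w_bracket_neq0; lia.
- exact: S1.
- exact: S2.
Qed.

Lemma folded_reach_neg m : 0 < m -> reached l (opposite w) S m.
Proof.
apply: (@reach_all F G l eps l_gt0 eps2) => [p q n|p n|p k q n k0 n0|p|].
- by apply: opposite_congr => {}p {}q {}n; apply: w_dv.
- by apply: opposite_reflect => [{}n|{}p {}n]; [apply: epsN|apply: w_reflect].
- apply: (@opposite_bracket F G l eps) => [j|p' q' n'|p' k' q' n'|].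
  + exact: epsN.
  + exact: w_dv.
  + exact: w_bracket_neq0.
  + by lia.
- by rewrite rpredN; apply: SN1.
- by rewrite rpredN; apply: SN2.
Qed.

(** In degrees 1 and -1 the brackets telescope to w 1 0 - w (-1) 0 plus a multiple
    of kk; degrees 2 and -2 give the opposite difference. The multiples of kk add
    up to 2. *)
Lemma kk_reached : kk glN \in subalg_pred S.
Proof.
have D p : ~~ dv (p + 1) ->
    w p 0 - w (p + 1) 0 + (2 * (1%:~R / N%:R)) *: kk glN \in subalg_pred S.
  move=> p1; have := subalg_bracket (S1 p) (SN1 (p + 1)); rewrite w_bracket_opp.
  rewrite (_ : 2 * p + 1 + 1 = 2 * (p + 1)); last by ring.
  by rewrite dv_half (negPf p1) mulr0 subr0 scale1r.
have sum n : (n < N.-1)%N ->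
    w 1 0 - w (1 + n%:Z) 0 + (2 * (n%:R / N%:R)) *: kk glN \in subalg_pred S.
  elim: n => [|n IH] nN.
    by rewrite addr0 subrr add0r mul0r mulr0 scale0r rpred0.
  have n1 : ~~ dv (1 + n%:Z + 1) by rewrite dvdzE /= gtnNdvd //; lia.
  have := rpredD (IH (ltnW nN)) (D _ n1).
  rewrite addrACA subrKA -scalerDl (_ : 1 + n%:Z + 1 = 1 + n.+1%:Z); last by lia.
  by rewrite -mulrDr -mulrDl natr1.
have N2 : (N.-2 < N.-1)%N by lia.
have h0 : w (-1) 0 - w 1 0 + (2 * (2%:R / N%:R)) *: kk glN \in subalg_pred S.
  have := subalg_bracket S2 SN2.
  rewrite (@w_bracket_opp_eq (-1) 2 1 false) ?mulr0 ?subr0 ?scale1r //.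
  have e1 : (2 * -1 + 2 + 1 = 1 :> int) by [].
  by rewrite e1 (dv1 l_gt0).
have := rpredD h0 (sum _ N2).
rewrite (_ : w (1 + (N.-2)%:Z) 0 = w (-1) 0); last first.
  by apply: w_dv; rewrite (_ : _ - _ = N%:Z) ?dvdzz //; lia.
rewrite addrACA subrKA subrr add0r -scalerDl -mulrDr -mulrDl -natrD.
rewrite (_ : (2 + N.-2)%N = N) ?divff ?NF0 ?mulr1 //; last by lia.
by apply: SZ_inv; rewrite pnatr_eq0.
Qed.

Lemma folded_reach m : reached l w S m.
Proof.
case: (ltrgt0P m) => [|m0|->]; first exact: folded_reach_pos.
  have mp : 0 < - m by rewrite oppr_gt0.
  have [h1 h2] := folded_reach_neg mp.
  have wE p : w p m = - opposite w (p + m) (- m).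
    by rewrite /opposite !opprK addrK.
  rewrite /reached -[dv m]rpredN; split=> [/h1 h p|/h2 h p q].
    by rewrite wE rpredN.
  by rewrite !wE -opprD rpredN.
split=> [|_]; first by rewrite dvdz0.
apply: (consecutive_differences l_gt0 w_dv) => p p0.
have := subalg_bracket (S1 (p - 1)) (SN1 p).
rewrite (@w_bracket_opp_eq (p - 1) 1 p false) ?subrK //; last first.
  by rewrite (_ : 2 * (p - 1) + 1 + 1 = 2 * p) ?dv_half ?(negPf p0) //; ring.
rewrite mulr0 subr0 scale1r => h.
have := rpredB h (rpredZ (2 * (1%:~R / N%:R)) kk_reached).
by rewrite addrK -opprB rpredN.
Qed.

Lemma fold_sum (I : Type) (s : seq I) (f : I -> G) :
  fold (\sum_(i <- s) f i) = \sum_(i <- s) fold (f i).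
Proof.
apply: (big_morph fold) => [y z|]; [exact: foldD|by rewrite /fold linear0 addr0].
Qed.

Lemma fold_E p q : fold (E F l p q) = w p (q - p) - (2 * ((q == p)%:R * uc F l p)) *: kk glN.
Proof. by rewrite E_x foldB foldZ fold_kk scalerA mulrC w_fold. Qed.

(** The folded algebra is spanned by symmetrized matrix units, except that the
    symmetrized diagonal units only enter through combinations of trace 0. *)
Lemma folded_generated y : y \in subalg_pred (folded l eps2) -> y \in subalg_pred S.
Proof.
move=> /foldedP[y0 ty]; apply: (@SZ_inv _ _ _ 2%:R); first by rewrite pnatr_eq0.
have -> : 2%:R *: y = fold y by rewrite /fold ty scaler_nat.
rewrite (affine_expand y) foldD foldZ fold_kk scalerA rpredD ?rpredZ ?kk_reached //.
elim: (finmap.enum_fset (lsupp y.1)) => [|n s IH].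
  by rewrite big_nil /fold linear0 addr0 rpred0.
rewrite big_cons foldD rpredD // {IH}.
move: (lcoef y.1 n) (y0 n) => a ta {y0 ty y s}.
have fold_amono : fold (amono a n) =
    \sum_i \sum_j (a : 'M_N) i j *: fold (E F l i%:Z (j%:Z + n * N%:Z)).
  rewrite {1}(gl_expand a) amono_sum fold_sum; apply: eq_bigr => i _.
  rewrite amono_sum fold_sum; apply: eq_bigr => j _.
  by rewrite amonoZ foldZ amono_delta.
have nN : dv (n * N%:Z) by rewrite dvdz_mull.
have diag i : fold (E F l i (i + n * N%:Z)) - w 0 (n * N%:Z) \in subalg_pred S.
  rewrite fold_E (_ : i + n * N%:Z - i = n * N%:Z); last by ring.
  rewrite addrAC rpredB ?rpredZ ?kk_reached //.
  exact: (proj2 (folded_reach _)).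
have -> : fold (amono a n) = \sum_i ((a : 'M_N) i i *:
      (fold (E F l i%:Z (i%:Z + n * N%:Z)) - w 0 (n * N%:Z))
    + \sum_(j | j != i) (a : 'M_N) i j *: fold (E F l i%:Z (j%:Z + n * N%:Z))).
  rewrite fold_amono [RHS](eq_bigr (fun i : 'I_N =>
    \sum_j (a : 'M_N) i j *: fold (E F l i%:Z (j%:Z + n * N%:Z))
    - (a : 'M_N) i i *: w 0 (n * N%:Z))) => [|i _].
    by rewrite sumrB -scaler_suml -[X in X *: _]/(\tr (a : 'M_N)) ta scale0r subr0.
  by rewrite [in RHS](bigD1 i) //= scalerBr addrAC.
apply: rpred_sum => i _; apply: rpredD; first exact/rpredZ/diag.
apply: rpred_sum => j ji; rewrite rpredZ // fold_E rpredB ?rpredZ ?kk_reached //.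
apply: (proj1 (folded_reach _)); rewrite (@dv_shift _ 1 (n * N%:Z) _ (j%:Z - i%:Z)) //.
  rewrite -eqz_mod_dvd -idx_eq !idx_ord; exact: ji.
by rewrite mul1r; ring.
Qed.
End FoldedGeneration.

(** * Kac-Moody data in the folded algebra *)

Section FoldedElements.
Variables (F : numClosedFieldType) (l : nat) (eps : F).
Hypothesis eps2 : eps * eps = 1.
Local Notation N := (2 * l).+1.
Local Notation glN := (gl F N).
Local Notation G := (affine glN).
Local Notation dv z := (N%:Z %| z)%Z.
Local Notation x := (@x F l).
Local Notation w := (w l eps2).
Local Notation tau := (tau l eps2).

Lemma idx_eq_dv p q : (idx l p == idx l q) = dv (p - q).
Proof. by rewrite idx_eq eqz_mod_dvd. Qed.

Lemma trace_x p m k : ~~ dv m -> \tr (lcoef (x p m).1 k : 'M_N) = 0.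
Proof.
move=> mN; have m0 : (m == 0) = false.
  by apply/negbTE; apply: contra mN => /eqP ->; apply: dvdz0.
rewrite xE m0 mul0r scale0r addr0 /E lcoef_mono; case: eqP => _; last exact: mxtrace0.
rewrite /mxtrace big1 // => i _; rewrite mxE; case: eqP => //= ->.
by rewrite idx_eq_dv opprD addrA subrr add0r dvN (negPf mN).
Qed.

Lemma trace_w p m k : \tr (lcoef (w p m).1 k : 'M_N) =
  \tr (lcoef (x p m).1 k : 'M_N) - eps ^ m * \tr (lcoef (x (-1 - p - m) m).1 k : 'M_N).
Proof.
have -> : lcoef (w p m).1 k = lcoef (x p m).1 k - eps ^ m *: lcoef (x (-1 - p - m) m).1 k.
  by rewrite wE.
move: (lcoef (x p m).1 k) (lcoef (x (-1 - p - m) m).1 k) => y z.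
by rewrite -scaleNr mxtraceD mxtraceZ mulNr.
Qed.

Lemma w_folded p m : ~~ dv m -> w p m \in subalg_pred (folded l eps2).
Proof.
move=> mN; apply/foldedP; split=> [k|]; last exact: tau_w.
by rewrite trace_w (trace_x p k mN) (trace_x _ k mN) mulr0 subr0.
Qed.

Lemma x_neq0 p m : ~~ dv m -> x p m != 0.
Proof.
move=> mN; apply/eqP => /(congr1 (fun y : G => (lcoef y.1
  (((p + m) %/ N%:Z)%Z - (p %/ N%:Z)%Z) : 'M_N) (idx l p) (idx l (p + m)))).
have m0 : (m == 0) = false.
  by apply/negbTE; apply: contra mN => /eqP ->; apply: dvdz0.
rewrite xE m0 mul0r scale0r addr0 /E lcoef_mono eqxx lcoef0 !mxE !eqxx.
by move/eqP; rewrite oner_eq0.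
Qed.

(** Either w p m is twice x p m, or its two terms are distinct basis elements. *)
Lemma w_neq0 p m : ~~ dv m -> 1 - eps ^ m * (dv (2 * p + m + 1))%:R != 0 -> w p m != 0.
Proof.
move=> mN; have m0 : (m == 0) = false.
  by apply/negbTE; apply: contra mN => /eqP ->; apply: dvdz0.
have [b|b _] := boolP (dv (2 * p + m + 1)).
  rewrite mulr1 => c0; rewrite wE (_ : x (-1 - p - m) m = x p m); last first.
    apply: x_congr; rewrite eqz_mod_dvd (_ : _ - _ = - (2 * p + m + 1)) ?dvN //.
    by ring.
  by rewrite -{1}[x p m]scale1r -scalerBl scaler_eq0 negb_or c0 x_neq0.
apply/eqP => /(congr1 (fun y : G => (lcoef y.1
  (((p + m) %/ N%:Z)%Z - (p %/ N%:Z)%Z) : 'M_N) (idx l p) (idx l (p + m)))).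
rewrite wE !xE m0 !mul0r !scale0r !addr0 lcoefD -scaleNr lcoefZ !lcoef_mono eqxx lcoef0.
rewrite !mxE !eqxx; case: eqP => _; rewrite !mxE ?mulr0 ?addr0.
  rewrite idx_eq_dv (_ : p - _ = 2 * p + m + 1) ?(negPf b) ?mulr0 ?addr0; last by ring.
  by move/eqP; rewrite oner_eq0.
by move/eqP; rewrite oner_eq0.
Qed.

Lemma pdeg_w p m : pdeg_fun (w p m) = m%:~R *: w p m.
Proof.
rewrite wE -scaleNr pdegD pdegZ !pdeg_x scalerDr !scalerA.
by rewrite [m%:~R * _]mulrC.
Qed.

Variable pos : 'I_l -> int.

(** The eigenvalue of the diagonal matrix w (pos k) 0 on the basis vector r. *)
Definition mu (k : 'I_l) (r : int) : F := (dv (pos k - r))%:R - (dv (pos k + 1 + r))%:R.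

Definition Tv (v : 'rV[F]_l) : G := \sum_k v 0 k *: w (pos k) 0.

Lemma Tv_linear a v v' : Tv (a *: v + v') = a *: Tv v + Tv v'.
Proof.
rewrite /Tv scaler_sumr -big_split; apply: eq_bigr => k _ /=.
by rewrite !mxE scalerDl scalerA.
Qed.

Lemma w0_bracket s r m : [lie w s 0, x r m] =
  ((dv (s - r))%:R - (dv (s + 1 + r))%:R
    - ((dv (s - (r + m)))%:R - (dv (s + 1 + (r + m)))%:R)) *: x r m.
Proof.
have E' (a b c d : bool) : (r == s + 0 %[mod N%:Z])%Z = a ->
    (s == r + m %[mod N%:Z])%Z = b -> (r == -1 - s %[mod N%:Z])%Z = c ->
    (-1 - s - 0 == r + m %[mod N%:Z])%Z = d ->
  [lie w s 0, x r m] = a%:R *: x s (0 + m) - b%:R *: x r (0 + m)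
  + ((0 + m == 0)%:R * a%:R * (0%:~R / N%:R)) *: kk glN
  - eps ^ 0 *: (c%:R *: x (-1 - s - 0) (0 + m) - d%:R *: x r (0 + m)
     + ((0 + m == 0)%:R * c%:R * (0%:~R / N%:R)) *: kk glN).
  by move=> <- <- <- <-; apply: x_w.
rewrite (E' (dv (s - r)) (dv (s - (r + m))) (dv (s + 1 + r)) (dv (s + 1 + (r + m)))).
- rewrite expr0z scale1r !mul0r !mulr0 !scale0r !add0r.
  rewrite [X in X - _ = _]addr0 [X in _ - X = _]addr0.
  have -> : (dv (s - r))%:R *: x s m = (dv (s - r))%:R *: x r m.
    case: (boolP (dv (s - r))) => h; rewrite ?scale0r // (@x_congr _ _ s r) //.
    by rewrite eqz_mod_dvd.
  have -> : (dv (s + 1 + r))%:R *: x (-1 - s - 0) m = (dv (s + 1 + r))%:R *: x r m.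
    case: (boolP (dv (s + 1 + r))) => h; rewrite ?scale0r // (@x_congr _ _ _ r) //.
    by rewrite eqz_mod_dvd (_ : _ - _ = - (s + 1 + r)) ?dvN //; ring.
  rewrite -!scalerBl; congr (_ *: _); ring.
- by rewrite eqz_mod_dvd (_ : _ - _ = - (s - r)) ?dvN //; ring.
- by rewrite eqz_mod_dvd.
- by rewrite eqz_mod_dvd (_ : _ - _ = s + 1 + r) //; ring.
- by rewrite eqz_mod_dvd (_ : _ - _ = - (s + 1 + (r + m))) ?dvN //; ring.
Qed.

Lemma Tv_w v r m : [lie Tv v, w r m] =
  (\sum_k v 0 k * (mu k r - mu k (r + m))) *: w r m.
Proof.
rewrite /Tv bracket_suml scaler_suml; apply: eq_bigr => k _.
rewrite bracketZl [w r m]w_fold -/(fold eps2 (x r m)) (bracket_fold _ (tau_w l eps2 (pos k) 0)).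
rewrite w0_bracket foldZ scalerA.
by [].
Qed.

Lemma Tv_folded v : Tv v \in subalg_pred (folded l eps2).
Proof.
apply: rpred_sum => k _; apply: rpredZ; apply/foldedP; split; last exact: tau_w.
move=> n; rewrite trace_w expr0z mul1r.
have tr0 p : \tr (lcoef (x p 0).1 n : 'M_N) = (n == 0)%:R.
  rewrite xE addr0 /= scaler0 addr0 /E lcoef_mono subrr; case: eqP => _.
    rewrite /mxtrace (bigD1 (idx l p)) //= mxE !eqxx big1 ?addr0 // => i /negPf ni.
    by rewrite mxE ni.
  exact: mxtrace0.
by rewrite !tr0 subrr.
Qed.

Lemma pdeg_Tv v : pdeg_fun (Tv v) = 0.
Proof.
rewrite /Tv (big_morph (@pdeg_fun F l) (@pdegD F l) (@pdeg0 F l)) big1 // => k _.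
by rewrite pdegZ pdeg_w scale0r scaler0.
Qed.
End FoldedElements.

(** A choice of Chevalley generators e i = w (p i) (d i) of the folded algebra. The
    indices pos k select one element of each pair {r, -1 - r} with r other than
    l, and identify the diagonal matrices with F^l; by a_mu the vector a i is the
    finite part of the root of e i, d i its degree, and ad_free says that these
    affine roots are independent. Since the Cartan subalgebra of the folded algebra
    cannot separate them, the principal derivation is adjoined. *)
Section CartanDatum.
Variables (F : numClosedFieldType) (l : nat) (eps : F).
Hypothesis eps2 : eps * eps = 1.
Local Notation N := (2 * l).+1.
Local Notation glN := (gl F N).
Local Notation G := (affine glN).
Local Notation dv z := (N%:Z %| z)%Z.
Local Notation w := (w l eps2).
Local Notation folded := (folded l eps2).

Variable pos : 'I_l -> int.
Local Notation mu := (mu F pos).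
Local Notation Tv := (Tv eps2 pos).

Variables (a : 'I_l.+1 -> 'rV[int]_l) (p d : 'I_l.+1 -> int).
Local Notation dot i j := ((a i *m (a j)^T) 0 0).
Local Notation half i := (1 - eps ^ d i * (dv (2 * p i + d i + 1))%:R).
Hypothesis a_mu : forall i k, (a i 0 k)%:~R = mu k (p i) - mu k (p i + d i).
Hypothesis w0_pos : forall r, w r 0 = \sum_k mu k r *: w (pos k) 0.
Hypothesis a_integral : forall i, exists v, 2 *: a i = dot i i *: v.
Hypothesis a_neq0 : forall i, dot i i != 0.
Hypothesis half_neq0 : forall i, half i != 0.
Hypothesis d_ndvd : forall i, ~~ dv (d i).
Hypothesis ef0 : forall i j, i != j -> [lie w (p i) (d i), w (p j + d j) (- d j)] = 0.
Hypothesis ad_free : forall b : 'rV[F]_l.+1,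
  (forall k, \sum_i b 0 i * (a i 0 k)%:~R = 0) -> \sum_i b 0 i * (d i)%:~R = 0 -> b = 0.
Hypothesis gen : forall S : subalg G,
  (forall i, w (p i) (d i) \in subalg_pred S) ->
  (forall i, w (p i + d i) (- d i) \in subalg_pred S) ->
  forall y, y \in subalg_pred folded -> y \in subalg_pred S.

Local Notation M := (dext (@pdeg_bracket F l)).
Local Notation dotF i := ((dot i i)%:~R : F).

Definition aF i : 'rV[F]_l := map_mx intr (a i).
(** The coroot [e i, f i]: the vector 2 a i / (a i, a i) and the central term that
    the cocycle adds to it. *)
Definition hcG i : G := (2 / dotF i) *: (Tv (aF i) + (2 * ((d i)%:~R / N%:R)) *: kk glN).
Definition eM i : M := dext_in (@pdeg_bracket F l) (w (p i) (d i)).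
(** The divisor half i is 2 when e i is twice a basis element, and 1 otherwise. *)
Definition fM i : M :=
  dext_in (@pdeg_bracket F l) ((2 / dotF i / half i) *: w (p i + d i) (- d i)).

Lemma dotF_neq0 i : dotF i != 0.
Proof. by rewrite intr_eq0. Qed.

Lemma Tv_aF i : Tv (aF i) = w (p i) 0 - w (p i + d i) 0.
Proof.
rewrite (w0_pos (p i)) (w0_pos (p i + d i)) -sumrB; apply: eq_bigr => k _.
by rewrite mxE a_mu scalerBl.
Qed.

Lemma eM_fM i : [lie eM i, fM i] = dext_in (@pdeg_bracket F l) (hcG i).
Proof.
rewrite -hom_bracket bracketZr w_bracket_opp scalerA divfK ?half_neq0 //.
by rewrite /hcG Tv_aF.
Qed.

Lemma dotF_sum i j : (dot i j)%:~R = \sum_k aF i 0 k * aF j 0 k :> F.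
Proof.
rewrite mxE rmorph_sum; apply: eq_bigr => k _.
by rewrite rmorphM !mxE.
Qed.

Lemma cartan_ofE i j : ((cartan_of a) i j)%:~R = 2 / dotF i * (dot i j)%:~R :> F.
Proof.
have [v av] := a_integral i.
have E : 2 * dot i j = (v *m (a j)^T) 0 0 * dot i i.
  have := congr1 (fun u : 'rV[int]_l => (u *m (a j)^T) 0 0) av.
  by rewrite -!scalemxAl !mxE => ->; rewrite mulrC.
rewrite mxE E mulzK ?a_neq0 //.
have := congr1 (fun z : int => z%:~R : F) E; rewrite !rmorphM /=.
by move=> EF; rewrite mulrAC EF mulfK ?dotF_neq0.
Qed.

Lemma hcG_w i r m : [lie hcG i, w r m] =
  (2 / dotF i * \sum_k aF i 0 k * (mu k r - mu k (r + m))) *: w r m.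
Proof. by rewrite bracketZl bracketDl bracketZl kk_central scaler0 addr0 Tv_w scalerA. Qed.

Lemma hcG_e i j : [lie hcG i, w (p j) (d j)] = ((cartan_of a) i j)%:~R *: w (p j) (d j).
Proof.
rewrite hcG_w cartan_ofE [(dot i j)%:~R]dotF_sum; congr ((_ * _) *: _).
by apply: eq_bigr => k _; rewrite -a_mu [aF j 0 k]mxE.
Qed.

Lemma hcG_f i j : [lie hcG i, w (p j + d j) (- d j)] =
  - ((cartan_of a) i j)%:~R *: w (p j + d j) (- d j).
Proof.
rewrite hcG_w cartan_ofE [(dot i j)%:~R]dotF_sum -mulrN -sumrN; congr ((_ * _) *: _).
apply: eq_bigr => k _; rewrite [aF j 0 k]mxE a_mu -mulrN addrK.
by congr (_ * _); rewrite [RHS]opprB.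
Qed.

(** A row is a simple root followed by its degree; by independence, the simple
    roots take arbitrary values on the Cartan subalgebra extended by the
    principal derivation. *)
Definition root_mx : 'M[F]_(l.+1, l + 1) :=
  row_mx (\matrix_(i, k) aF i 0 k) (\col_i (d i)%:~R).

Lemma root_mx_free : row_free root_mx.
Proof.
rewrite -kermx_eq0; apply/eqP/row_matrixP => i; rewrite row0.
set b := row i _; have b0 : b *m root_mx = 0 by rewrite -row_mul mulmx_ker row0.
apply: ad_free => [k|].
  have /matrixP/(_ 0 (lshift 1 k)) := b0; rewrite !mxE => h.
  by rewrite -[RHS]h; apply: eq_bigr => j _; rewrite row_mxEl !mxE.
have /matrixP/(_ 0 (rshift l 0)) := b0; rewrite !mxE => h.
by rewrite -[RHS]h; apply: eq_bigr => j _; rewrite row_mxEr !mxE.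
Qed.

(** The coordinates of the Cartan element at which the simple roots have the
    values c. *)
Definition solve (c : 'rV[F]_l.+1) : 'rV[F]_(l + 1) := c *m pinvmx root_mx^T.

Lemma solveP c j : \sum_k lsubmx (solve c) 0 k * aF j 0 k
  + rsubmx (solve c) 0 0 * (d j)%:~R = c 0 j.
Proof.
have full : row_full root_mx^T by rewrite /row_full mxrank_tr; apply: root_mx_free.
have : solve c *m root_mx^T = c by rewrite /solve -mulmxA mulVpmx // mulmx1.
move=> /matrixP/(_ 0 j) <-.
rewrite -{3}[solve c]hsubmxK tr_row_mx mul_row_col mxE !mxE big_ord1 !mxE.
by congr (_ + _); apply: eq_bigr => k _; rewrite !mxE.
Qed.

Definition TM_fun (c : 'rV[F]_l.+1) : M :=
  (Tv (lsubmx (solve c)), rsubmx (solve c) 0 0 : F^o).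

Fact TM_linear : linear TM_fun.
Proof.
move=> s c c'; have sl : solve (s *: c + c') = s *: solve c + solve c'.
  by rewrite /solve mulmxDl scalemxAl.
apply: dextP; first by rewrite /= sl (linearP lsubmx) Tv_linear.
by rewrite /= sl !mxE.
Qed.
HB.instance Definition _ := GRing.isLinear.Build F 'rV[F]_l.+1 M _ TM_fun TM_linear.

Lemma TM_in c y : [lie TM_fun c, dext_in (@pdeg_bracket F l) y] =
  dext_in (@pdeg_bracket F l) ([lie Tv (lsubmx (solve c)), y]
    + (rsubmx (solve c) 0 0 : F) *: pdeg_fun y).
Proof. by rewrite dext_bracketE /= scale0r subr0. Qed.

Lemma TM_w c r m s : \sum_k lsubmx (solve c) 0 k * (mu k r - mu k (r + m))
    + rsubmx (solve c) 0 0 * m%:~R = s ->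
  [lie TM_fun c, dext_in (@pdeg_bracket F l) (w r m)] =
  s *: dext_in (@pdeg_bracket F l) (w r m).
Proof. by move=> <-; rewrite TM_in Tv_w pdeg_w scalerA -scalerDl linearZ. Qed.

Definition folded_ext_pred : {pred M} :=
  [pred z : M | (z.1 \in subalg_pred folded) && (z.2 == 0)].
Fact folded_ext_submod : submod_closed folded_ext_pred.
Proof.
split=> [|s y z]; first by apply/andP; split=> //; apply: rpred0.
move=> /andP[Ly /eqP y2] /andP[Lz /eqP z2]; apply/andP; split.
  exact: rpredD (rpredZ s Ly) Lz.
by rewrite /= y2 z2 scaler0 addr0.
Qed.
Fact folded_ext_bracket :
  {in folded_ext_pred &, forall y z, [lie y, z] \in folded_ext_pred}.
Proof.
move=> y z /andP[Ly /eqP y2] /andP[Lz /eqP z2]; apply/andP; split=> //.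
have -> : [lie y, z].1 = [lie y.1, z.1].
  by rewrite dext_bracketE /= y2 z2 !scale0r addr0 subr0.
exact: subalg_bracket Ly Lz.
Qed.
Definition folded_ext := Subalg folded_ext_submod folded_ext_bracket.

Lemma eM_folded i : eM i \in subalg_pred folded_ext.
Proof. by apply/andP; split=> //; apply: w_folded. Qed.
Lemma fM_folded i : fM i \in subalg_pred folded_ext.
Proof. apply/andP; split=> //; apply/rpredZ/w_folded.
by rewrite rpredN. Qed.

Local Notation inM := (dext_in (@pdeg_bracket F l)).

Lemma inM_inj : injective inM.
Proof. by move=> y z []. Qed.

Lemma w0_amono s : exists b c, w s 0 = amono b 0 + c *: kk glN.
Proof.
have xA r : exists b c, x F l r 0 = amono b 0 + c *: kk glN.
  by rewrite xE addr0 /E subrr; do 2![eexists].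
have [b [c xs]] := xA s; have [b' [c' xs']] := xA (-1 - s - 0).
exists (b - b'), (c - c'); rewrite wE expr0z scale1r xs xs' amonoB scalerBl.
by rewrite opprD addrACA.
Qed.

Lemma Tv_snd v y : ([lie Tv v, y]).2 = 0.
Proof.
rewrite /Tv bracket_suml.
rewrite (big_morph (fun y : G => y.2) (id1 := 0) (op1 := +%R)) // big1 // => k _.
have [b [c ->]] := w0_amono (pos k).
have h : ([lie y, amono b 0]).2 = 0 by rewrite bracket_amono_snd oppr0 mul0r.
rewrite bracketZl bracketDl bracketZl kk_central scaler0 addr0 bracketC.
by rewrite -[LHS]/(v 0 k * - ([lie y, amono b 0]).2) h oppr0 mulr0.
Qed.

Lemma hcG_snd i y : ([lie hcG i, y]).2 = 0.
Proof.
rewrite bracketZl bracketDl bracketZl kk_central scaler0 addr0.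
by rewrite -[LHS]/(2 / dotF i * ([lie Tv (aF i), y]).2) Tv_snd mulr0.
Qed.

Lemma eM_fM_neq i j : i != j -> [lie eM i, fM j] = 0.
Proof. by move=> ij; rewrite -hom_bracket bracketZr ef0 // scaler0 linear0. Qed.

Lemma hc_e i j : [lie [lie eM i, fM i], eM j] = ((cartan_of a) i j)%:~R *: eM j.
Proof. by rewrite eM_fM -hom_bracket hcG_e linearZ. Qed.

Lemma hc_f i j : [lie [lie eM i, fM i], fM j] = - ((cartan_of a) i j)%:~R *: fM j.
Proof. by rewrite eM_fM -hom_bracket bracketZr hcG_f scalerA mulrC -scalerA linearZ. Qed.

Lemma TM_e c j : [lie TM_fun c, eM j] = c 0 j *: eM j.
Proof.
apply: TM_w; rewrite -solveP; congr (_ + _); apply: eq_bigr => k _.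
by rewrite [aF j 0 k]mxE a_mu.
Qed.

Lemma TM_f c j : [lie TM_fun c, fM j] = - c 0 j *: fM j.
Proof.
rewrite /fM linearZ bracketZr (@TM_w _ _ _ (- c 0 j)); first by rewrite scalerA mulrC -scalerA.
rewrite -solveP opprD rmorphN mulrN; congr (_ - _); rewrite -sumrN; apply: eq_bigr => k _.
by rewrite [aF j 0 k]mxE a_mu addrK -mulrN; congr (_ * _); rewrite [RHS]opprB.
Qed.

Lemma Tv_Tv v v' : [lie Tv v, Tv v'] = 0.
Proof.
rewrite {2}/Tv bracket_sumr big1 // => k _; rewrite bracketZr Tv_w big1 ?scale0r ?scaler0 //.
by move=> j _; rewrite addr0 subrr mulr0.
Qed.

Lemma TM_TM c c' : [lie TM_fun c, TM_fun c'] = 0.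
Proof. by rewrite dext_bracketE /= Tv_Tv !pdeg_Tv !scaler0 addr0 subr0. Qed.

(** Applied to the roots, the relation kills the finite parts, because the a j
    span; then the coefficient of kk kills the degrees. *)
Lemma hc_free (u : 'rV[F]_l.+1) : \sum_i u 0 i *: [lie eM i, fM i] = 0 -> u = 0.
Proof.
move=> u0.
have y0 : \sum_i u 0 i *: hcG i = 0.
  apply: inM_inj; rewrite linear0 -[RHS]u0 linear_sum; apply: eq_bigr => i _.
  by rewrite linearZ eM_fM.
pose b : 'rV[F]_l.+1 := \row_i (u 0 i * (2 / dotF i)).
have bE i : b 0 i = u 0 i * (2 / dotF i) by rewrite mxE.
pose V : 'rV[F]_l := \sum_i b 0 i *: aF i.
have VE k : V 0 k = \sum_i b 0 i * aF i 0 k.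
  by rewrite summxE; apply: eq_bigr => i _; rewrite mxE.
have V0 : V = 0.
  have Va j : \sum_k V 0 k * aF j 0 k = 0.
    have := congr1 (fun y => [lie y, w (p j) (d j)]) y0.
    rewrite bracket0x bracket_suml => h.
    have wj : w (p j) (d j) != 0 by apply: w_neq0.
    apply/eqP; rewrite -[_ == 0]orbF -(negPf wj) -scaler_eq0; apply/eqP.
    rewrite -[RHS]h.
    rewrite (eq_bigr (fun k => \sum_i b 0 i * aF i 0 k * aF j 0 k)) => [|k _]; last first.
      by rewrite VE mulr_suml.
    rewrite exchange_big scaler_suml; apply: eq_bigr => i _ /=.
    rewrite bracketZl hcG_w scalerA mulrA; congr (_ *: _).
    rewrite mxE mulr_sumr; apply: eq_bigr => k _.
    by rewrite -a_mu [aF j 0 k]mxE -!mulrA.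
  have free : row_free root_mx^T.
    by have /eqP rk := root_mx_free; rewrite /row_free mxrank_tr rk addn1.
  have : row_mx V 0 *m root_mx^T = 0.
    apply/rowP => j; rewrite tr_row_mx mul_row_col mul0mx addr0 !mxE -[RHS](Va j).
    by apply: eq_bigr => k _; rewrite !mxE.
  move=> h; have := row_free_inj free (etrans h (esym (mul0mx _ _))).
  by move=> /(congr1 lsubmx); rewrite row_mxKl linear0.
suff b0 : b = 0.
  have c0 i : 2 / dotF i != 0 by rewrite mulf_neq0 ?invr_eq0 ?dotF_neq0 ?pnatr_eq0.
  apply/rowP => i; have /rowP/(_ i)/eqP := b0; rewrite bE [X in _ == X]mxE mulf_eq0.
  by rewrite (negPf (c0 i)) orbF [in RHS]mxE => /eqP.
apply: ad_free => [k|].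
  have /rowP/(_ k) := V0; rewrite VE !mxE => h; rewrite -[RHS]h.
  by apply: eq_bigr => i _; rewrite [aF i 0 k]mxE.
have : \sum_i u 0 i *: hcG i
    = Tv V + (2 / N%:R * \sum_i b 0 i * (d i)%:~R) *: kk glN.
  have -> : Tv V = \sum_i b 0 i *: Tv (aF i).
    rewrite /Tv; under eq_bigr => k _ do rewrite VE scaler_suml.
    rewrite exchange_big; apply: eq_bigr => i _; rewrite scaler_sumr.
    by apply: eq_bigr => k _; rewrite scalerA.
  rewrite mulr_sumr scaler_suml -big_split; apply: eq_bigr => i _ /=.
  rewrite /hcG scalerA -bE [LHS]scalerDr scalerA; congr (_ + _ *: _).
  by rewrite mulrCA -[RHS]mulrA [_^-1 * _]mulrC -[in RHS]mulrA.
rewrite y0 V0 (_ : Tv 0 = 0) ?add0r; last first.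
  by rewrite /Tv big1 // => k _; rewrite mxE scale0r.
move=> /esym/(congr1 (fun y : G => y.2))/eqP; rewrite /= /GRing.scale /= mulr1.
have c0 : 2 / N%:R != 0 :> F by rewrite mulf_neq0 ?invr_eq0 ?NF0 ?pnatr_eq0.
by rewrite mulf_eq0 (negPf c0) => /eqP.
Qed.

Lemma folded_ext_gen (R : subalg M) : (forall i, eM i \in subalg_pred R) ->
  (forall i, fM i \in subalg_pred R) ->
  forall z, z \in subalg_pred folded_ext -> z \in subalg_pred R.
Proof.
move=> eR fR z /andP[Lz /eqP z2].
have pre_submod : submod_closed [pred y : G | inM y \in subalg_pred R].
  split=> [|s y y']; first by rewrite inE linear0 rpred0.
  by rewrite !inE linearP => Ry Ry'; apply: rpredD => //; apply: rpredZ.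
have pre_bracket : {in [pred y : G | inM y \in subalg_pred R] &,
    forall y y', [lie y, y'] \in [pred y : G | inM y \in subalg_pred R]}.
  by move=> y y'; rewrite !inE hom_bracket; apply: subalg_bracket.
have -> : z = inM z.1 by apply: dextP.
apply: (@gen (Subalg pre_submod pre_bracket)) Lz => i; first exact: eR.
have c0 : 2 / dotF i / half i != 0.
  by rewrite !mulf_neq0 ?invr_eq0 ?dotF_neq0 ?half_neq0 ?pnatr_eq0.
rewrite -[_ \in _]/(inM (w (p i + d i) (- d i)) \in subalg_pred R).
by apply: (SZ_inv c0); have := fR i; rewrite /fM linearZ.
Qed.

(** The condition K of the criterion: no components along kk and the derivation. *)
Definition no_center (z : M) : Prop := z.1.2 = 0 /\ z.2 = 0.

Lemma dext_snd (y z : M) : ([lie y, z]).1.2 = ([lie y.1, z.1]).2.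
Proof.
rewrite -[LHS]/(([lie y.1, z.1]).2 + (y.2 : F) * (pdeg_fun z.1).2
  - (z.2 : F) * (pdeg_fun y.1).2).
by rewrite !pdeg_snd !mulr0 addr0 subr0.
Qed.

Lemma no_center_T c z : no_center [lie TM_fun c, z].
Proof.
by split=> //; rewrite dext_snd Tv_snd.
Qed.

Lemma no_center_hc i z : no_center [lie [lie eM i, fM i], z].
Proof. by split=> //; rewrite eM_fM dext_snd hcG_snd. Qed.

(** With no component along the derivation, an element of folded_ext + im TM lies
    in the folded algebra, so that folded_simple applies. *)
Lemma folded_ext_simple (J : M -> Prop) : (forall z, J z -> no_center z) ->
  (forall z, J z -> exists2 q, q \in subalg_pred folded_ext & exists c, z = q + TM_fun c) ->
  (forall z y, J z -> y \in subalg_pred folded_ext -> J [lie z, y]) ->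
  forall z, J z -> z = 0.
Proof.
move=> JK JQ JB z Jz.
have zE y : J y -> y = inM y.1 by move=> /JK[_ y2]; apply: dextP.
suff -> : z = inM 0 by rewrite linear0.
rewrite (zE z Jz); congr (inM _).
apply: (folded_simple (eps2 := eps2) (J := fun y => J (inM y))) => [y Jy|y y' Jy Ly'|]; last first.
- by rewrite -zE.
- rewrite hom_bracket; apply: JB => //; apply/andP; split=> //.
have [q /andP[Lq _] [c yE]] := JQ _ Jy; split; last by case: (JK _ Jy).
have -> : y = q.1 + Tv (lsubmx (solve c)) by rewrite -[y]/((inM y).1) yE.
by apply: rpredD => //; apply: Tv_folded.
Qed.

Theorem folded_kac_moody : sub_lie (km_derived F (cartan_of a)) ~=L sub_lie folded.
Proof.
have embedded : sub_lie folded_ext ~=L sub_lie folded.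
  apply: lieIso_sym; apply: (@subalg_lieIso _ _ _ inM) => [|y Ly|z /andP[Lz /eqP z2]].
  - exact: inM_inj.
  - by apply/andP; split.
  - by exists z.1 => //; apply: dextP; rewrite ?z2.
apply: lieIso_trans embedded.
apply: (@km_derived_lieIso F l.+1 (cartan_of a) M folded_ext eM fM TM_fun
  _ _ _ _ _ _ _ _ _ _ no_center).
- exact: eM_folded.
- exact: fM_folded.
- exact: eM_fM_neq.
- exact: hc_e.
- exact: hc_f.
- exact: TM_e.
- exact: TM_f.
- exact: TM_TM.
- exact: hc_free.
- exact: folded_ext_gen.
- by [].
- move=> y z [y1 y2] [z1 z2]; split; first by rewrite /= y1 z1 addr0.
  by rewrite /= y2 z2 addr0.
- exact: no_center_T.
- exact: no_center_hc.
- exact: folded_ext_simple.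
Qed.

End CartanDatum.

(** * The types B_l^(1) and A_2l^(2) *)

Section DatumTools.
Variables (F : numClosedFieldType) (l : nat) (eps : F).
Hypothesis l_gt0 : (0 < l)%N.
Hypothesis eps2 : eps * eps = 1.
Local Notation N := (2 * l).+1.
Local Notation G := (affine (gl F N)).
Local Notation dv z := (N%:Z %| z)%Z.
Local Notation w := (w l eps2).

Lemma dv_small z : - N%:Z < z -> z < N%:Z -> dv z = (z == 0).
Proof.
move=> z1 z2; apply/idP/eqP => [|->]; last exact: dvdz0.
rewrite dvdzE /= => h; apply/eqP; rewrite -absz_eq0; apply/eqP.
have zN : (`|z| < N)%N by lia.
by have := gtnNdvd _ zN; case: `|z|%N h => // n h /(_ isT); rewrite h.
Qed.

Lemma dv_sub k z : dv z = dv (z - k * N%:Z).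
Proof. by rewrite rpredBr // dvdz_mull. Qed.

Lemma dv_subN z : dv z = dv (z - N%:Z).
Proof. by rewrite (dv_sub 1) mul1r. Qed.

Lemma w_bracket0 p m q n : ~~ dv (q - (p + m)) -> ~~ dv (p - (q + n)) ->
  ~~ dv (q - (-1 - p)) -> ~~ dv (-1 - p - m - (q + n)) -> [lie w p m, w q n] = 0.
Proof.
move=> /negPf h1 /negPf h2 /negPf h3 /negPf h4; rewrite w_bracket_dv h1 h2 h3 h4.
by rewrite !mulr0 !mul0r !mulr0 !scale0r !subr0 !addr0 scaler0 subr0.
Qed.

Lemma w_bracket1 p m q n : m + n != 0 -> dv (q - (p + m)) -> ~~ dv (p - (q + n)) ->
  ~~ dv (q - (-1 - p)) -> ~~ dv (-1 - p - m - (q + n)) ->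
  [lie w p m, w q n] = w p (m + n).
Proof.
move=> mn h1 /negPf h2 /negPf h3 /negPf h4; rewrite w_bracket_neq0 // h1 h2 h3 h4.
by rewrite !scale0r !subr0 scaler0 subr0 scale1r.
Qed.

Lemma w_bracket_bool (a b c d : bool) s p m q n : m + n = s -> s != 0 ->
  dv (q - (p + m)) = a -> dv (p - (q + n)) = b -> dv (q - (-1 - p)) = c ->
  dv (-1 - p - m - (q + n)) = d ->
  [lie w p m, w q n] = a%:R *: w p s - b%:R *: w q s
    - eps ^ m *: (c%:R *: w (-1 - p - m) s - d%:R *: w q s).
Proof. by move=> <- mn <- <- <- <-; apply: w_bracket_neq0. Qed.

Lemma w_residues m (S : subalg G) :
  (forall r : nat, (r < N)%N -> w r%:Z m \in subalg_pred S) ->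
  forall p, w p m \in subalg_pred S.
Proof.
move=> h p.
have p0 : 0 <= (p %% N%:Z)%Z by apply: modz_ge0.
have pN : (p %% N%:Z)%Z < N%:Z by apply: ltz_pmod.
have pp : dv (p - (p %% N%:Z)%Z) by rewrite {1}(divz_eq p N%:Z) addrK dvdz_mull.
by rewrite (w_dv _ _ pp); case: (p %% N%:Z)%Z p0 pN {pp} => // r _; apply: h.
Qed.

Lemma w_refl p q m : dv (q + 1 + p + m) -> w q m = - eps ^ m *: w p m.
Proof.
move=> h; rewrite -w_reflect; apply: w_dv.
by rewrite (_ : _ - _ = q + 1 + p + m) //; ring.
Qed.

Lemma w_self0 p m : dv (2 * p + m + 1) -> eps ^ m = 1 -> w p m = 0.
Proof.
move=> h em; have := @w_refl p p m; rewrite em scaleN1r => /(_ _)/eqP.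
rewrite -addr_eq0 -mulr2n -scaler_nat scaler_eq0 pnatr_eq0 /= => wp; apply/eqP/wp.
by rewrite (_ : _ + m = 2 * p + m + 1) //; ring.
Qed.

Variable pos : 'I_l -> int.

Lemma mu_dv k r s : dv (r - s) -> mu F pos k r = mu F pos k s.
Proof.
move=> h; rewrite /mu; congr (_%:R - _%:R).
  by rewrite (@dv_shift l (-1) (r - s) (pos k - r) (pos k - s)) //; ring.
by rewrite (@dv_shift l 1 (r - s) (pos k + 1 + r) (pos k + 1 + s)) //; ring.
Qed.

(** The diagonal elements are spanned by the w (pos k) 0 when pos picks one
    element of each pair exchanged by the folding. *)
Lemma w0_expand : (forall r : nat, (r < N)%N -> r = l
    \/ (exists2 k, forall j, dv (pos j - r%:Z) = (j == k) & forall j, ~~ dv (pos j + 1 + r%:Z))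
    \/ (exists2 k, forall j, dv (pos j + 1 + r%:Z) = (j == k) & forall j, ~~ dv (pos j - r%:Z)))
    -> (forall j, ~~ dv (pos j - l%:Z)) ->
  forall r, w r 0 = \sum_k mu F pos k r *: w (pos k) 0.
Proof.
move=> cover posl r.
have r0 : 0 <= (r %% N%:Z)%Z by apply: modz_ge0.
have rN : (r %% N%:Z)%Z < N%:Z by apply: ltz_pmod.
have rr : dv (r - (r %% N%:Z)%Z) by rewrite {1}(divz_eq r N%:Z) addrK dvdz_mull.
rewrite (w_dv _ _ rr); under eq_bigr => k _ do rewrite (mu_dv k rr).
case: (r %% N%:Z)%Z r0 rN => // {rr}r _ rN; have {}rN : (r < N)%N by [].
have [->|[[k k1 k2]|[k k1 k2]]] := cover r rN.
- rewrite w_self0 ?expr0z //; last first.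
    by rewrite (_ : _ + 1 = N%:Z) ?dvdzz //; lia.
  rewrite big1 // => j _; rewrite /mu (negPf (posl j)).
  rewrite (@dv_sub 1) (_ : _ - _ = pos j - l%:Z) ?(negPf (posl j)) ?subrr ?scale0r //.
  by lia.
- rewrite (bigD1 k) //= big1 => [|j jk]; rewrite /mu k1 (negPf (k2 _)) ?(negPf jk) ?eqxx.
    by rewrite subr0 scale1r addr0; apply: w_dv; rewrite -opprB rpredN k1 eqxx.
  by rewrite subrr scale0r.
- rewrite (bigD1 k) //= big1 => [|j jk]; rewrite /mu k1 (negPf (k2 _)) ?(negPf jk) ?eqxx.
    rewrite sub0r addr0 (@w_refl (pos k)) ?expr0z //.
    by rewrite addr0 (_ : _ + pos k = pos k + 1 + r%:Z) ?k1 ?eqxx //; ring.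
  by rewrite subrr scale0r.
Qed.

End DatumTools.

Lemma cartan_integral (l : nat) (a : 'rV[int]_l) :
  (a *m a^T) 0 0 = 1 \/ (a *m a^T) 0 0 = 2 -> exists v, 2 *: a = (a *m a^T) 0 0 *: v.
Proof.
case=> ->; first by exists (2 *: a); rewrite scale1r.
by exists a.
Qed.

Lemma eps_dot (l r s : nat) : (eps l r *m (eps l s)^T) 0 0 = ((r == s) && (r < l)%N)%:R.
Proof.
rewrite mxE; have [rl|rl] := ltnP r l; last first.
  rewrite andbF big1 // => k _; rewrite !mxE; case: eqP => [kr|]; rewrite ?mul0r //.
  by move: rl; rewrite -kr leqNgt ltn_ord.
rewrite andbT (bigD1 (Ordinal rl)) //= big1 => [|k kr]; rewrite !mxE /=.
  by rewrite eqxx mul1r addr0.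
by rewrite -val_eqE /= in kr; rewrite (negPf kr) mul0r.
Qed.

Lemma eps_comb_dot (l r s : nat) (c c' : int) : r != s ->
  let a := c *: eps l r + c' *: eps l s in
  (a *m a^T) 0 0 = c ^+ 2 * (r < l)%N%:R + c' ^+ 2 * (s < l)%N%:R.
Proof.
move=> rs a; rewrite /a linearD !linearZ /= !(mulmxDl, mulmxDr) -!scalemxAl -!scalemxAr.
have dotE t u : (eps l t *m (eps l u)^T) 0 0 = ((t == u) && (t < l)%N)%:R by apply: eps_dot.
move: (eps l r *m (eps l r)^T) (dotE r r) => m1 e1.
move: (eps l r *m (eps l s)^T) (dotE r s) => m2 e2.
move: (eps l s *m (eps l r)^T) (dotE s r) => m3 e3.
move: (eps l s *m (eps l s)^T) (dotE s s) => m4 e4.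
have sr : (s == r) = false by rewrite eq_sym (negPf rs).
rewrite !mxE e1 e2 e3 e4 !eqxx (negPf rs) sr /=; ring.
Qed.

Lemma sum_delta (R : pzRingType) n (f : nat -> R) k : (k < n)%N ->
  \sum_(i < n) f i * (k == i)%:R = f k.
Proof.
move=> kn; rewrite (bigD1 (Ordinal kn)) //= eqxx mulr1 big1 ?addr0 // => i.
by rewrite -val_eqE /= eq_sym => /negPf ->; rewrite mulr0.
Qed.

Lemma sum_delta_succ (R : pzRingType) n (f : nat -> R) k : (k < n)%N ->
  \sum_(i < n) f i * (k == i.+1)%:R = (0 < k)%N%:R * f k.-1.
Proof.
case: k => [|k] kn; first by rewrite mul0r big1 // => i _; rewrite mulr0.
by rewrite mul1r; apply: sum_delta (ltnW kn).
Qed.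

(** For eps = 1 the pairs {r, 2l - r} are represented by 0, ..., l - 1. The elements
    w (i - 1) 1 with i > 0 are the simple root vectors of so_N, and w (-1) 2 is a
    lowest root vector with a factor t. *)
Section TypeB.
Variables (F : numClosedFieldType) (l : nat).
Hypothesis l_gt0 : (0 < l)%N.
Local Notation N := (2 * l).+1.
Local Notation G := (affine (gl F N)).
Local Notation dv z := (N%:Z %| z)%Z.
Local Notation eps2 := (mulr1 (1 : F)).
Local Notation w := (w l eps2).

Definition aB (i : 'I_l.+1) : 'rV[int]_l :=
  if i == 0 :> nat then - (eps l 0 + eps l 1) else eps l i.-1 - eps l i.
Definition pB (i : 'I_l.+1) : int := i%:Z - 1.
Definition dB (i : 'I_l.+1) : int := if i == 0 :> nat then 2 else 1.
Definition posB (k : 'I_l) : int := k%:Z.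

Lemma aB_comb i : aB i =
  (if i == 0 :> nat then -1 else 1) *: eps l (if i == 0 :> nat then 0 else i.-1)%N
  + (-1) *: eps l (if i == 0 :> nat then 1 else i)%N.
Proof. by rewrite /aB; case: ifP => _; rewrite ?scale1r !scaleN1r ?opprD. Qed.

Lemma aB_dot i : (aB i *m (aB i)^T) 0 0 = 1 \/ (aB i *m (aB i)^T) 0 0 = 2.
Proof.
rewrite aB_comb eps_comb_dot; last by case: ifP => //; lia.
have := ltn_ord i; case: ifP => i0 il.
  by rewrite l_gt0; case: (1 < l)%N; [right|left].
have -> : (i.-1 < l)%N by lia.
by case: (i < l)%N; [right|left].
Qed.

Lemma aB_coef i k : aB i 0 k = if i == 0 :> nat then - ((k == 0 :> nat)%:R + (k == 1 :> nat)%:R)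
  else (k == i.-1 :> nat)%:R - (k == i :> nat)%:R.
Proof. by rewrite /aB; case: ifP => _; rewrite !mxE. Qed.

Lemma aB_mu i k : (aB i 0 k)%:~R = mu F posB k (pB i) - mu F posB k (pB i + dB i).
Proof.
have [il kl] := (ltn_ord i, ltn_ord k).
have natE (b : bool) : (b%:R : int)%:~R = b%:R :> F by case: b.
rewrite /mu /posB /pB /dB aB_coef; case: ifP => i0;
  rewrite !(rmorphN, rmorphD, rmorphB) /= !natE.
  have i0' : (i : nat) = 0 by apply/eqP.
  rewrite i0' (_ : dv (k%:Z - (0 - 1)) = false); last by rewrite dv_small //; lia.
  rewrite (_ : dv (k%:Z + 1 + (0 - 1)) = (k == 0 :> nat)); last by rewrite dv_small //; lia.
  rewrite (_ : dv (k%:Z - (0 - 1 + 2)) = (k == 1 :> nat)); last by rewrite dv_small //; lia.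
  rewrite (_ : dv (k%:Z + 1 + (0 - 1 + 2)) = false) /=; last by rewrite dv_small //; lia.
  by ring.
rewrite (_ : dv (k%:Z - (i%:Z - 1)) = (k == i.-1 :> nat)); last by rewrite dv_small //; lia.
rewrite (_ : dv (k%:Z + 1 + (i%:Z - 1)) = false); last by rewrite dv_small //; lia.
rewrite (_ : dv (k%:Z - (i%:Z - 1 + 1)) = (k == i :> nat)); last by rewrite dv_small //; lia.
rewrite (_ : dv (k%:Z + 1 + (i%:Z - 1 + 1)) = false) /=; last by rewrite dv_small //; lia.
by ring.
Qed.

Lemma posB_cover (r : nat) : (r < N)%N -> r = l
  \/ (exists2 k, forall j, dv (posB j - r%:Z) = (j == k) & forall j, ~~ dv (posB j + 1 + r%:Z))
  \/ (exists2 k, forall j, dv (posB j + 1 + r%:Z) = (j == k) & forall j, ~~ dv (posB j - r%:Z)).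
Proof.
move=> rN; case: (ltngtP r l) => [rl|rl|]; [right; left|right; right|by left].
  exists (Ordinal rl) => j; have := ltn_ord j; rewrite /posB -?val_eqE /= => jl;
    rewrite dv_small //; lia.
have kl : (2 * l - r < l)%N by lia.
exists (Ordinal kl) => j; have := ltn_ord j; rewrite /posB -?val_eqE /= => jl.
  by rewrite dv_subN // dv_small //; lia.
by rewrite dv_small //; lia.
Qed.

Lemma posB_l j : ~~ dv (posB j - l%:Z).
Proof. by have := ltn_ord j; rewrite /posB => jl; rewrite dv_small //; lia. Qed.

Lemma halfB i : 1 - (1 : F) ^ dB i * (dv (2 * pB i + dB i + 1))%:R != 0.
Proof.
have := ltn_ord i => il; rewrite exp1rz mul1r /pB /dB.
case: ifP => i0.
  have -> : (i : nat) = 0 by apply/eqP.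
  by rewrite dv_small //= ?subr0 ?oner_eq0 //; lia.
rewrite (_ : 2 * _ + 1 + 1 = 2 * i%:Z); last by ring.
rewrite dv_half dv_small //; try lia.
by rewrite (_ : (i%:Z == 0) = false) ?subr0 ?oner_eq0 //; lia.
Qed.

Lemma dB_ndvd i : ~~ dv (dB i).
Proof. by rewrite /dB; case: ifP => _; rewrite dv_small //; lia. Qed.

Lemma efB i j : i != j -> [lie w (pB i) (dB i), w (pB j + dB j) (- dB j)] = 0.
Proof.
rewrite -val_eqE /= => ij; have [il jl] := (ltn_ord i, ltn_ord j); rewrite /pB /dB.
case: ifP => i0; case: ifP => j0.
- by move: ij; rewrite (eqP i0) (eqP j0) eqxx.
- have i0' : (i : nat) = 0 by apply/eqP.
  rewrite i0' {il}; have [j1|j1] := eqVneq (j : nat) 1.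
    rewrite j1 w_bracket1; try by rewrite dv_small //; lia.
      by apply: w_self0; [rewrite dv_small //; lia|apply: exp1rz].
    by [].
  by apply: w_bracket0; rewrite dv_small //; lia.
- have j0' : (j : nat) = 0 by apply/eqP.
  rewrite j0' {jl}; have [i1|i1] := eqVneq (i : nat) 1.
    rewrite i1 w_bracket1; try by rewrite dv_small //; lia.
      by apply: w_self0; [rewrite dv_small //; lia|apply: exp1rz].
    by [].
  by apply: w_bracket0; rewrite dv_small //; lia.
by apply: w_bracket0; rewrite dv_small //; lia.
Qed.

(** Solving the relations of the vectors a i one coordinate after the other gives
    the marks 1, 1, 2, ..., 2 up to a scalar, and these have a nonzero total
    degree. *)
Lemma aB_free (b : 'rV[F]_l.+1) : (forall k, \sum_i b 0 i * (aB i 0 k)%:~R = 0) ->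
  \sum_i b 0 i * (dB i)%:~R = 0 -> b = 0.
Proof.
pose c n := b 0 (inord n); have bE (i : 'I_l.+1) : b 0 i = c i by rewrite /c inord_val.
have natE (e : bool) : (e%:R : int)%:~R = e%:R :> F by case: e.
move=> ba bd.
have cS k : (k < l)%N -> c k.+1 = (0 < k)%N%:R * c k + c 0 * ((k == 0)%:R + (k == 1)%:R).
  move=> kl; have := ba (Ordinal kl); rewrite big_ord_recl aB_coef /=.
  under eq_bigr => i _ do rewrite bE aB_coef /= rmorphB /= !natE mulrBr.
  rewrite sumrB (sum_delta (fun i => c i.+1) kl) (sum_delta_succ (fun i => c i.+1) kl).
  rewrite bE rmorphN rmorphD /= !natE => /eqP; rewrite mulrN addrC subr_eq add0r.
  case: k {kl} => [|k] /=; rewrite ?mul0r ?subr0 ?add0r => /eqP // h.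
  by rewrite -h mul1r addrC subrK.
have c1 : c 1 = c 0 by rewrite cS //= mul0r add0r addr0 mulr1.
have c2 k : (0 < k)%N -> (k < l)%N -> c k.+1 = 2 * c 0.
  elim: k => // k IH _ kl; rewrite cS //= mul1r.
  case: k IH kl => [|k] IH kl; first by rewrite c1 add0r mulr1; ring.
  by rewrite IH ?(ltnW kl) //= addr0 mulr0 addr0.
have tot n : (n < l)%N -> \sum_(i < n.+1) c i.+1 = (2 * n + 1)%:R * c 0.
  elim: n => [|n IH] nl; first by rewrite big_ord1 c1 mul1r.
  rewrite big_ord_recr /= IH ?(ltnW nl) // c2 // -mulrDl -natrD; congr (_%:R * _); lia.
have c0 : c 0 = 0.
  move: bd; rewrite big_ord_recl bE /dB /=.
  under eq_bigr => i _ do rewrite bE lift0 /= mulr1.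
  have -> : \sum_(i < l) c i.+1 = (2 * l.-1 + 1)%:R * c 0.
    by have := tot l.-1; rewrite prednK // leqnn => ->.
  rewrite [c _ * _]mulrC -mulrDl => /eqP; rewrite mulf_eq0 => /orP[|/eqP //].
  by rewrite -[_%:~R]/(2%:R) -natrD pnatr_eq0.
apply/rowP => i; rewrite bE mxE; case: i => [[|[|n]] ni] //=; first by rewrite c1.
by rewrite c2 ?c0 ?mulr0.
Qed.

(** The reflection reduces all residues to those of the generators, except for those
    p with w p 1 = 0 or w p (- 1) = 0. *)
Lemma genB (S : subalg G) : (forall i, w (pB i) (dB i) \in subalg_pred S) ->
  (forall i, w (pB i + dB i) (- dB i) \in subalg_pred S) ->
  forall y, y \in subalg_pred (folded l eps2) -> y \in subalg_pred S.
Proof.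
move=> Se Sf; apply: (folded_generated l_gt0).
- apply: w_residues => r rN; have [rl|rl] := ltnP r l.
    have := Se (inord r.+1); rewrite /pB /dB inordK //=.
    by rewrite (_ : r.+1%:Z - 1 = r) //; lia.
  have [->|r2] := eqVneq r (2 * l)%N.
    rewrite w_self0 ?rpred0 //.
    by rewrite (_ : _ + 1 = 2 * N%:Z) ?dvdz_mull //; lia.
  rewrite (@w_refl _ _ _ _ (2 * l - r.+1)%N%:Z); last first.
    by rewrite (_ : _ + 1 = N%:Z) ?dvdzz //; lia.
  apply: rpredZ; have := Se (inord (2 * l - r)); rewrite /pB /dB inordK; last by lia.
  rewrite (_ : (2 * l - r == 0)%N = false); last by lia.
  by rewrite (_ : (2 * l - r)%N%:Z - 1 = (2 * l - r.+1)%N) //; lia.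
- apply: w_residues => r rN; have [->|r0] := eqVneq r 0.
    have -> : w 0 (-1) = 0 by apply: w_self0; [rewrite dv_small //; lia|apply: exp1rz].
    exact: rpred0.
  have [rl|rl] := leqP r l.
    have := Sf (inord r); rewrite /pB /dB inordK // (negPf r0).
    by rewrite subrK.
  rewrite (@w_refl _ _ _ _ (N - r)%N%:Z); last first.
    by rewrite (_ : _ - 1 = N%:Z) ?dvdzz //; lia.
  apply: rpredZ; have := Sf (inord (N - r)); rewrite /pB /dB inordK; last by lia.
  by rewrite (_ : (N - r == 0)%N = false) ?subrK //; lia.
- by have := Se ord0.
- by have := Sf ord0.
Qed.

Theorem folded_B1 :
  sub_lie (km_derived F (cartan_B1 l)) ~=L sub_lie (folded l eps2).
Proof.
have dotB i := cartan_integral (aB_dot i).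
apply: (@folded_kac_moody F l 1 eps2 posB aB pB dB).
- exact: aB_mu.
- by apply: w0_expand => //; [apply: posB_cover|apply: posB_l].
- exact: dotB.
- by move=> i; case: (aB_dot i) => ->.
- exact: halfB.
- exact: dB_ndvd.
- exact: efB.
- exact: aB_free.
- exact: genB.
Qed.
End TypeB.

(** For eps = -1 the pairs {r, 2l - r} are represented by l + 1, ..., 2l, and all
    simple root vectors w (l + i) 1 have degree 1. *)
Section TypeA.
Variables (F : numClosedFieldType) (l : nat).
Hypothesis l_gt0 : (0 < l)%N.
Local Notation N := (2 * l).+1.
Local Notation G := (affine (gl F N)).
Local Notation dv z := (N%:Z %| z)%Z.

Lemma epsA2 : (-1) * (-1) = 1 :> F.
Proof. by rewrite mulrNN mulr1. Qed.
Local Notation w := (w l epsA2).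

Definition aA (i : 'I_l.+1) : 'rV[int]_l :=
  if i == 0 :> nat then - eps l 0
  else if i == l :> nat then 2 *: eps l l.-1 else eps l i.-1 - eps l i.
Definition pA (i : 'I_l.+1) : int := l%:Z + i%:Z.
Definition posA (k : 'I_l) : int := l%:Z + 1 + k%:Z.

Lemma eps_dot_self r : (r < l)%N -> (eps l r *m (eps l r)^T) 0 0 = 1.
Proof. by move=> rl; rewrite (@eps_dot l r r : _ = _) eqxx rl. Qed.

Lemma aA_integral i : exists v, 2 *: aA i = (aA i *m (aA i)^T) 0 0 *: v.
Proof.
have il := ltn_ord i; rewrite /aA; case: ifP => i0.
  apply: cartan_integral; left.
  by rewrite linearN /= mulNmx mulmxN opprK eps_dot_self.
case: ifP => iN.
  exists (eps l l.-1); have ll : (l.-1 < l)%N by lia.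
  have -> : (2 *: eps l l.-1)^T = 2 *: (eps l l.-1)^T by rewrite linearZ.
  rewrite -scalemxAl -scalemxAr scalerA.
  by move: (_ *m _) (eps_dot_self ll) => m m1; rewrite !mxE m1 mulr1.
apply: cartan_integral; right.
have -> : eps l i.-1 - eps l i = 1 *: eps l i.-1 + (-1) *: eps l i.
  by rewrite scale1r scaleN1r.
rewrite eps_comb_dot; last by clear -i0; lia.
have i1 : (i.-1 < l)%N by lia.
have i2 : (i < l)%N by clear -il iN; lia.
by rewrite i1 i2.
Qed.

Lemma aA_neq0 i : (aA i *m (aA i)^T) 0 0 != 0.
Proof.
have [v av] := aA_integral i; apply/eqP => a0.
have coef0 k : aA i 0 k = 0.
  have /matrixP/(_ 0 k) := av; rewrite a0 scale0r !mxE => /eqP.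
  by rewrite mulf_eq0 => /orP[|/eqP].
have il := ltn_ord i; have [i0|i0] := eqVneq (i : nat) 0.
  by have := coef0 (Ordinal l_gt0); rewrite /aA i0 !mxE eqxx.
have il1 : (i.-1 < l)%N by clear -il i0; lia.
have := coef0 (Ordinal il1); rewrite /aA (negPf i0); case: ifP => [/eqP iN|_].
  by rewrite !mxE /= iN eqxx.
have ii : (i.-1 == i) = false by clear -i0; lia.
by rewrite !mxE /= eqxx ii.
Qed.

Lemma aA_coef (i : 'I_l.+1) (k : 'I_l) : aA i 0 k =
  (i == k.+1 :> nat)%:R - (i == k :> nat)%:R + ((k.+1 == l) && (i == l :> nat))%:R.
Proof.
have [il kl] := (ltn_ord i, ltn_ord k); rewrite /aA; case: ifP => i0; rewrite ?mxE.
  rewrite (eqP i0) (_ : (0 == l)%N = false); last by lia.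
  by rewrite andbF addr0 sub0r eq_sym.
case: ifP => iN; rewrite !mxE.
  rewrite (eqP iN) andbT (_ : (l == k :> nat) = false); last by lia.
  rewrite (_ : (l == k.+1) = (k.+1 == l)); last by lia.
  rewrite (_ : (k == l.-1 :> nat) = (k.+1 == l)); last by lia.
  by case: (k.+1 == l).
rewrite andbF addr0; congr (_%:R - _%:R); lia.
Qed.

Lemma aA_mu i k : (aA i 0 k)%:~R = mu F posA k (pA i) - mu F posA k (pA i + 1).
Proof.
have [il kl] := (ltn_ord i, ltn_ord k).
have natE (b : bool) : (b%:R : int)%:~R = b%:R :> F by case: b.
rewrite /mu /posA /pA aA_coef rmorphD rmorphB /= !natE.
rewrite (_ : dv (_ - (l%:Z + i%:Z)) = (i == k.+1 :> nat)); last by rewrite dv_small //; lia.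
rewrite (_ : dv (_ - (l%:Z + i%:Z + 1)) = (i == k :> nat)); last by rewrite dv_small //; lia.
rewrite (_ : dv (_ + (l%:Z + i%:Z)) = false); last by rewrite dv_subN dv_small //; lia.
rewrite (_ : dv (_ + (l%:Z + i%:Z + 1)) = (k.+1 == l) && (i == l :> nat)) /=; last first.
  by rewrite (dv_sub l 2) dv_small //; lia.
by ring.
Qed.

Lemma posA_cover (r : nat) : (r < N)%N -> r = l
  \/ (exists2 k, forall j, dv (posA j - r%:Z) = (j == k) & forall j, ~~ dv (posA j + 1 + r%:Z))
  \/ (exists2 k, forall j, dv (posA j + 1 + r%:Z) = (j == k) & forall j, ~~ dv (posA j - r%:Z)).
Proof.
move=> rN; case: (ltngtP r l) => [rl|rl|]; [right; right|right; left|by left].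
  have kl : (l - r.+1 < l)%N by lia.
  exists (Ordinal kl) => j; have := ltn_ord j; rewrite /posA -?val_eqE /= => jl.
    by rewrite dv_subN // dv_small //; lia.
  by rewrite dv_small //; lia.
have kl : (r - l.+1 < l)%N by lia.
exists (Ordinal kl) => j; have := ltn_ord j; rewrite /posA -?val_eqE /= => jl.
  by rewrite dv_small //; lia.
by rewrite dv_subN // dv_small //; lia.
Qed.

Lemma posA_l j : ~~ dv (posA j - l%:Z).
Proof. by have := ltn_ord j; rewrite /posA => jl; rewrite dv_small //; lia. Qed.

Lemma halfA i : 1 - (-1 : F) ^ 1 * (dv (2 * pA i + 1 + 1))%:R != 0.
Proof. by rewrite expr1z mulN1r opprK -(natrD _ 1) pnatr_eq0. Qed.

Lemma efA i j : i != j -> [lie w (pA i) 1, w (pA j + 1) (- 1)] = 0.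
Proof.
rewrite -val_eqE /= => ij; have [il jl] := (ltn_ord i, ltn_ord j); rewrite /pA.
apply: w_bracket0; try by rewrite dv_small //; lia.
  by rewrite (dv_sub l 1) dv_small //; lia.
by rewrite (dv_sub l (- 1)) dv_small //; lia.
Qed.

(** As for type B: the marks are 2, ..., 2, 1 up to a scalar. *)
Lemma aA_free (b : 'rV[F]_l.+1) : (forall k, \sum_i b 0 i * (aA i 0 k)%:~R = 0) ->
  \sum_i b 0 i * (1 : int)%:~R = 0 -> b = 0.
Proof.
pose c n := b 0 (inord n); have bE (i : 'I_l.+1) : b 0 i = c i by rewrite /c inord_val.
have natE (e : bool) : (e%:R : int)%:~R = e%:R :> F by case: e.
move=> ba bd.
have cS k : (k < l)%N -> c k.+1 + (k.+1 == l)%:R * c l = c k.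
  move=> kl; have := ba (Ordinal kl).
  under eq_bigr => i _ do
    rewrite bE aA_coef /= !(rmorphB, rmorphD) /= !natE mulrDr mulrBr ![i == _ :> nat]eq_sym.
  rewrite big_split sumrB /= !sum_delta //; last by apply: ltnW.
  have -> : \sum_(i < l.+1) c i * ((k.+1 == l) && (l == i))%:R = (k.+1 == l)%:R * c l.
    case: (k.+1 == l) => /=; first by rewrite sum_delta // mul1r.
    by rewrite big1 ?mul0r // => i _; rewrite mulr0.
  by move/eqP; rewrite addrAC subr_eq0 => /eqP.
have ck k : (k < l)%N -> c k = c 0.
  elim: k => // k IH kl; have := cS k (ltnW kl).
  by rewrite (ltn_eqF kl) mul0r addr0 => ->; apply/IH/ltnW.
have cl : 2 * c l = c 0.
  have := cS l.-1; rewrite prednK // leqnn eqxx mul1r => /(_ isT) h.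
  by rewrite mulr_natl mulr2n h ck //; lia.
have c0 : c 0 = 0.
  have : 2 * \sum_i b 0 i * (1 : int)%:~R = 0 by rewrite bd mulr0.
  under eq_bigr => i _ do rewrite bE mulr1.
  rewrite big_ord_recr /= mulrDr cl (eq_bigr (fun=> c 0)) => [|i _]; last exact: ck.
  rewrite sumr_const card_ord -[c 0 *+ l]mulr_natl mulrA -{2}[c 0]mul1r -mulrDl => /eqP.
  by rewrite mulf_eq0 -natrM natr1 pnatr_eq0 /= => /eqP.
have cl0 : c l = 0.
  by move/eqP: cl; rewrite c0 mulf_eq0 pnatr_eq0 /= => /eqP.
apply/rowP => i; rewrite bE mxE; have [il|] := ltnP i l; first by rewrite ck.
have := ltn_ord i; rewrite ltnS => i1 i2.
by rewrite (_ : nat_of_ord i = l) //; apply/eqP; rewrite eqn_leq i1 i2.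
Qed.

(** All residues in degrees 1 and -1 are those of a generator, up to reflection;
    the elements of degree 2 and -2 are brackets of these. *)
Lemma genA (S : subalg G) : (forall i, w (pA i) 1 \in subalg_pred S) ->
  (forall i, w (pA i + 1) (- 1) \in subalg_pred S) ->
  forall y, y \in subalg_pred (folded l epsA2) -> y \in subalg_pred S.
Proof.
move=> Se Sf.
have S1 : forall p, w p 1 \in subalg_pred S.
  apply: w_residues => r rN; have [rl|rl] := leqP l r.
    have := Se (inord (r - l)); rewrite /pA inordK; last by lia.
    by rewrite (_ : l%:Z + (r - l)%N%:Z = r) //; lia.
  rewrite (@w_refl _ _ _ _ (2 * l - r.+1)%N%:Z); last first.
    by rewrite (_ : _ + 1 = N%:Z) ?dvdzz //; lia.
  apply: rpredZ; have := Se (inord (l - r.+1)); rewrite /pA inordK; last by lia.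
  by rewrite (_ : l%:Z + (l - r.+1)%N%:Z = (2 * l - r.+1)%N) //; lia.
have SN1 : forall p, w p (- 1) \in subalg_pred S.
  apply: w_residues => r rN; have [rl|rl] := ltnP l r.
    have := Sf (inord (r - l.+1)); rewrite /pA inordK; last by lia.
    by rewrite (_ : l%:Z + (r - l.+1)%N%:Z + 1 = r) //; lia.
  have [->|r0] := eqVneq r 0.
    have := Sf ord_max; rewrite /pA (@w_dv _ _ _ _ _ 0) //.
    by rewrite (_ : _ - 0 = N%:Z) ?dvdzz //= -addn1 PoszD PoszM; ring.
  rewrite (@w_refl _ _ _ _ (N - r)%N%:Z); last first.
    by rewrite (_ : _ - 1 = N%:Z) ?dvdzz //; lia.
  apply: rpredZ; have := Sf (inord (l - r)); rewrite /pA inordK; last by lia.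
  by rewrite (_ : l%:Z + (l - r)%N%:Z + 1 = (N - r)%N) //; lia.
apply: (folded_generated l_gt0) => //.
  have := subalg_bracket (S1 (-2)) (S1 (-1)).
  rewrite (@w_bracket_bool _ _ _ _ true false false true 2) //; try by rewrite dv_small //; lia.
  have -> : w (-2) 2 = - w (-1) 2.
    rewrite (@w_refl _ _ _ _ (-1)); last by rewrite dv_small //; lia.
    by rewrite -exprnP sqrrN expr1n scaleN1r.
  rewrite expr1z !scale0r !scale1r subr0 sub0r scalerN scaleN1r opprK -opprD -mulr2n.
  by rewrite rpredN -scaler_nat; apply: SZ_inv; rewrite pnatr_eq0.
have := subalg_bracket (SN1 (-1)) (SN1 0).
rewrite (@w_bracket_bool _ _ _ _ false true true false (-2)) //; try by rewrite dv_small //; lia.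
have -> : w 0 (-2) = - w 1 (-2).
  rewrite (@w_refl _ _ _ _ 1); last by rewrite dv_small //; lia.
  by rewrite (epsN epsA2 2) -exprnP sqrrN expr1n scaleN1r.
have -> : (-1 : F) ^ (- 1) = -1 by rewrite exprN1 invrN invr1.
rewrite !scale0r !scale1r subr0 sub0r opprK scaleN1r opprK -mulr2n -scaler_nat.
by apply: SZ_inv; rewrite pnatr_eq0.
Qed.

Theorem folded_A2l2 :
  sub_lie (km_derived F (cartan_A2l2 l)) ~=L sub_lie (folded l epsA2).
Proof.
apply: (@folded_kac_moody F l (-1) epsA2 posA aA pA (fun=> 1)).
- exact: aA_mu.
- by apply: w0_expand => //; [apply: posA_cover|apply: posA_l].
- exact: aA_integral.
- exact: aA_neq0.
- exact: halfA.
- by move=> _; rewrite dv1.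
- exact: efA.
- exact: aA_free.
- exact: genA.
Qed.
End TypeA.

(** * Fourier analysis on a cyclic group of odd order *)

Section OddCyclicCharacter.
Variables (F : numFieldType) (l : nat) (S : finZmodType) (chi : linear_char F S).
Hypothesis S_cyclic : cyclic [set: S].
Local Notation N := (2 * l).+1.
Hypothesis S_card : #|S| = N.
Hypothesis chi_inj : injective chi.
Local Notation "p =N q" := (p == q %[mod N%:Z])%Z (at level 70).
Local Notation dv z := (N%:Z %| z)%Z.

Lemma mulzN (a : S) k : a *~ (N%:Z * k) = 0.
Proof.
rewrite mulrzA -pmulrn (_ : a *+ N = 0) ?mul0rz //.
have := @expg_cardG S [set: S]%G a (finset.in_setT a).
by rewrite cardsT S_card => h; exact: h.
Qed.

Lemma double_eq0 (a : S) : a *~ 2 = 0 -> a = 0.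
Proof.
move=> a2; have := mulzN a 1; rewrite mulr1 (_ : N%:Z = 2 * l%:Z + 1); last first.
  by rewrite -addn1 PoszD PoszM.
by rewrite mulrzDr mulrzA a2 mul0rz add0r.
Qed.

Lemma chi_eq1 a : (chi a == 1) = (a == 0).
Proof. by rewrite -(char0 chi) (inj_eq chi_inj). Qed.

Lemma chiV a : chi (- a) = (chi a)^-1.
Proof.
by apply: (mulIf (char_neq0 chi a)); rewrite -charD addNr char0 mulVf ?char_neq0.
Qed.

Lemma chiX a n : chi (a *+ n) = chi a ^+ n.
Proof. by elim: n => [|n IH]; rewrite ?char0 // mulrS charD IH exprS. Qed.

Lemma chi_congr a p q : dv (p - q) -> chi (a *~ p) = chi (a *~ q).
Proof.
move=> /dvdzP[k pq]; rewrite (_ : p = q + N%:Z * k); last by rewrite mulrC -pq; ring.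
by rewrite mulrzDr mulzN addr0.
Qed.

(** A geometric sum with ratio chi (2 a), which differs from 1 when a does from 0:
    chi is injective and N odd. *)
Lemma sum_residues_char a c : \sum_(p < N) chi (a *~ (2 * p%:Z + c)) = N%:R * (a == 0)%:R.
Proof.
have [->|a0] := eqVneq a 0.
  under eq_bigr => p _ do rewrite mul0rz char0.
  by rewrite sumr_const card_ord mulr1.
rewrite mulr0; under eq_bigr => p _ do rewrite mulrzDr charD mulrzA -pmulrn chiX.
rewrite -mulr_suml; suff -> : \sum_(p < N) chi (a *~ 2) ^+ p = 0 by rewrite mul0r.
have a1 : chi (a *~ 2) - 1 != 0.
  by rewrite subr_eq0 chi_eq1; apply: contra a0 => /eqP/double_eq0/eqP.
apply: (mulfI a1); rewrite -subrX1 mulr0 -chiX pmulrn -mulrzA mulrC mulzN char0.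
exact: subrr.
Qed.

(** A translation by a generator g multiplies the sum by chi (k g). *)
Lemma sum_char_residue k : \sum_(a : S) chi (a *~ k) = N%:R * (dv k)%:R.
Proof.
have [kN|kN] := boolP (dv k).
  rewrite (eq_bigr (fun=> 1)) => [|a _].
    by rewrite sumr_const S_card mulr1.
  by rewrite (@chi_congr a k 0) ?subr0 // mulr0z char0.
rewrite mulr0; have [g gE] := cyclicP S_cyclic.
have gk : chi (g *~ k) - 1 != 0.
  rewrite subr_eq0 chi_eq1; apply: contra kN => /eqP gk0.
  have og : #[g]%g = N by rewrite orderE -gE cardsT.
  have gn n : g *+ n = 0 -> (N %| n)%N by move=> h; rewrite -og order_dvdn; apply/eqP.
  rewrite dvdzE /=; apply: gn; case: k gk0 => n gk0; first by rewrite pmulrn.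
  by apply: oppr_inj; rewrite oppr0 -[RHS]gk0 NegzE mulrNz pmulrn.
apply: (mulfI gk); rewrite mulr0 mulrBl mul1r mulr_sumr; apply/eqP; rewrite subr_eq0.
rewrite [X in _ == X](reindex_inj (addrI g)); apply/eqP; apply: eq_bigr => a _.
by rewrite mulrzDl charD.
Qed.
End OddCyclicCharacter.

(** * The trigonometric algebra is the affine algebra of gl_N *)

Section AffineLift.
Variables (F : fieldType) (g : quadLieType F) (W : lmodType F).
Variables (f : int -> g -> W) (w0 : W).
Hypothesis f_lin : forall n, linear (f n).

Let f0 n : f n 0 = 0.
Proof. by have := f_lin n (-1) 0 0; rewrite !scaleN1r oppr0 addr0 addNr. Qed.

Definition affine_lift (y : affine g) : W :=
  (\sum_(n \in [set: int]%classic) f n (lcoef y.1 n))%R + (y.2 : F) *: w0.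

Lemma affine_liftE (A : {fset int}) y :
  (forall n, n \notin A -> lcoef y.1 n = 0) ->
  affine_lift y = \sum_(n <- A) f n (lcoef y.1 n) + (y.2 : F) *: w0.
Proof. by move=> hA; congr (_ + _); apply: fsbigTE => n nA; rewrite hA. Qed.

Lemma affine_lift_linear : linear affine_lift.
Proof.
move=> a y z; pose A := (lsupp y.1 `|` lsupp z.1)%fset.
have hy n : n \notin A -> lcoef y.1 n = 0.
  by rewrite inE negb_or => /andP[/lsuppP].
have hz n : n \notin A -> lcoef z.1 n = 0.
  by rewrite inE negb_or => /andP[_ /lsuppP].
rewrite !(@affine_liftE A) //; last first.
  by move=> n nA; rewrite lcoefD lcoefZ hy // hz // scaler0 addr0.
rewrite scalerDr addrACA scalerA -scalerDl; congr (_ + _).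
rewrite scaler_sumr -big_split; apply: eq_bigr => n _ /=.
by rewrite -f_lin.
Qed.

Lemma affine_lift_amono a n : affine_lift (amono a n) = f n a.
Proof.
rewrite (@affine_liftE [fset n]%fset) => [|k]; last first.
  by rewrite inE lcoef_mono => /negPf ->.
by rewrite big_seq_fset1 lcoef_mono eqxx scale0r addr0.
Qed.

Lemma affine_lift_kk : affine_lift (kk g) = w0.
Proof.
rewrite (@affine_liftE fset0) => [|k _]; last exact: lcoef0.
by rewrite big_seq_fset0 add0r scale1r.
Qed.
End AffineLift.

Section TrigonometricAlgebra.
Variables (F : numFieldType) (l : nat) (S : finZmodType) (chi : linear_char F S).
Hypothesis S_cyclic : cyclic [set: S].
Local Notation N := (2 * l).+1.
Hypothesis S_card : #|S| = N.
Hypothesis chi_inj : injective chi.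
Local Notation "p =N q" := (p == q %[mod N%:Z])%Z (at level 70).
Local Notation dv z := (N%:Z %| z)%Z.
Local Notation glN := (gl F N).
Local Notation G := (affine glN).
Local Notation x := (@x F l).

Inductive trig_span : trigA chi -> Prop :=
| span_A a m : trig_span (tA chi a m)
| span_c : trig_span (tc chi)
| span_lin c y z : trig_span y -> trig_span z -> trig_span (c *: y + z).

Lemma trig_span0 : trig_span 0.
Proof. by rewrite -(addNr (tc chi)) -scaleN1r; apply/span_lin/span_c/span_c. Qed.
Lemma trig_spanZ c y : trig_span y -> trig_span (c *: y).
Proof. by rewrite -[_ *: _]addr0 => hy; apply/span_lin/trig_span0. Qed.
Lemma trig_spanD y z : trig_span y -> trig_span z -> trig_span (y + z).
Proof. by rewrite -{2}[y]scale1r; apply: span_lin. Qed.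

Lemma trig_span_bracket y z : trig_span y -> trig_span z -> trig_span [lie y, z].
Proof.
move=> + hz; elim=> {y} [a m||c y y' _ IH _ IH'].
- elim: hz => {z} [b n||c z z' _ IH _ IH'].
  + by rewrite tA_bracket; apply/span_lin; [apply: span_A|apply/trig_spanZ/span_c].
  + by rewrite bracketC tc_bracket oppr0; apply: trig_span0.
  + by rewrite bracket_linr; apply: span_lin.
- elim: hz => {z} [b n||c z z' _ IH _ IH'].
  + by rewrite tc_bracket; apply: trig_span0.
  + by rewrite bracketxx; apply: trig_span0.
  + by rewrite bracket_linr; apply: span_lin.
- by rewrite bracket_linl; apply: span_lin.
Qed.

(** Brackets of generators are combinations of generators. *)
Lemma trig_spanT y : trig_span y.
Proof.
rewrite -[y]pres_piK; move: (repr _) => {y}.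
elim=> [[|a m]||s IHs t IHt|a s IHs|s IHs t IHt].
- exact: span_c.
- exact: span_A.
- by rewrite pres_pi_zero; apply: trig_span0.
- by rewrite pres_pi_add; apply: trig_spanD.
- by rewrite pres_pi_scale; apply: trig_spanZ.
- by rewrite pres_pi_br; apply: trig_span_bracket.
Qed.

Lemma sum_at_residue (V : lmodType F) (f : int -> V) r :
  (forall p q, dv (p - q) -> f p = f q) ->
  \sum_(q < N) (q%:Z =N r)%:R *: f q%:Z = f r.
Proof.
move=> f_per; have idxr : dv ((idx l r)%:Z - r) by rewrite -eqz_mod_dvd idxE modz_mod.
rewrite (bigD1 (idx l r)) //= big1 => [|q qr].
  by rewrite eqz_mod_dvd idxr scale1r addr0 (f_per _ _ idxr).
by rewrite -idx_eq idx_ord (negPf qr) scale0r.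
Qed.

Lemma sum_reflect (V : lmodType F) (f : int -> V) c :
  (forall p q, dv (p - q) -> f p = f q) ->
  \sum_(q < N) f q%:Z = \sum_(q < N) f (c - q%:Z).
Proof.
move=> f_per; pose h (q : 'I_N) := idx l (c - q%:Z).
have hK : involutive h.
  move=> q; rewrite /h -[RHS]idx_ord; apply: idx_congr; rewrite eqz_mod_dvd idxE.
  by rewrite addrAC {1}(divz_eq (c - q%:Z) N%:Z) addrK dvdz_mull.
rewrite (reindex_inj (inv_inj hK)); apply: eq_bigr => q _; apply: f_per.
by rewrite -eqz_mod_dvd idxE modz_mod.
Qed.

Variable u : int.

(** The Fourier transform of the principal basis in the row index. The brackets
    are the same for every u, and u decides which involution corresponds to tau. *)
Definition trig_image (a : S) (m : int) : G :=
  \sum_(p < N) chi (a *~ (2 * p%:Z + u + m)) *: x p%:Z m.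

(** In the product of the characters at p and q, the condition q = p + m or
    p = q + n leaves a character of a + b times a factor that depends on the group
    elements and degrees only; these are the two structure constants. The central
    term is the sum of a character of a + b over all rows. *)
Lemma trig_image_bracket a m b n : [lie trig_image a m, trig_image b n] =
  (chi (b *~ m - a *~ n) - chi (a *~ n - b *~ m)) *: trig_image (a + b) (m + n)
    + (m%:~R * ((a + b == 0) && (m + n == 0))%:R) *: kk glN.
Proof.
have per (c : S) k : forall p q, dv (p - q) -> chi (c *~ (2 * p + k)) = chi (c *~ (2 * q + k)).
  move=> p q pq; apply: (@chi_congr _ _ _ chi S_card).
  by rewrite (_ : _ - _ = 2 * (p - q)) ?dvdz_mull //; ring.
pose cf p q := chi (a *~ (2 * p + (u + m))) * chi (b *~ (2 * q + (u + n))).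
have cfE p q k : dv (q - (p + m)) ->
    k = m + n -> cf p q = chi (b *~ m - a *~ n) * chi ((a + b) *~ (2 * p + u + k)).
  move=> h ->; rewrite /cf (per b (u + n) _ _ h) -!charD; congr (chi _).
  rewrite mulrzDl (_ : 2 * p + (u + m) = - n + (2 * p + u + (m + n))); last by ring.
  rewrite (_ : 2 * (p + m) + (u + n) = m + (2 * p + u + (m + n))); last by ring.
  move: (2 * p + u + (m + n)) => s.
  by rewrite !mulrzDr mulrNz addrACA [- _ + _]addrC.
have cfE' p q k : dv (p - (q + n)) ->
    k = m + n -> cf p q = chi (a *~ n - b *~ m) * chi ((a + b) *~ (2 * q + u + k)).
  move=> h ->; rewrite /cf (per a (u + m) _ _ h) -!charD; congr (chi _).
  rewrite mulrzDl (_ : 2 * q + (u + n) = - m + (2 * q + u + (m + n))); last by ring.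
  rewrite (_ : 2 * (q + n) + (u + m) = n + (2 * q + u + (m + n))); last by ring.
  move: (2 * q + u + (m + n)) => s.
  by rewrite !mulrzDr mulrNz addrACA.
have -> : [lie trig_image a m, trig_image b n] =
    \sum_(p < N) \sum_(q < N) cf p%:Z q%:Z *: [lie x p%:Z m, x q%:Z n].
  rewrite /trig_image bracket_suml; apply: eq_bigr => p _; rewrite bracket_sumr.
  apply: eq_bigr => q _; rewrite bracketZl bracketZr scalerA.
  by rewrite /cf !addrA.
have -> : \sum_(p < N) \sum_(q < N) cf p%:Z q%:Z *: [lie x p%:Z m, x q%:Z n] =
    \sum_(p < N) \sum_(q < N) (q%:Z =N p%:Z + m)%:R *: (cf p%:Z q%:Z *: x p%:Z (m + n))
    - \sum_(q < N) \sum_(p < N) (p%:Z =N q%:Z + n)%:R *: (cf p%:Z q%:Z *: x q%:Z (m + n))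
    + \sum_(p < N) \sum_(q < N) (q%:Z =N p%:Z + m)%:R
      *: ((cf p%:Z q%:Z * ((m + n == 0)%:R * (m%:~R / N%:R))) *: kk glN).
  rewrite [X in _ - X]exchange_big -sumrB -big_split; apply: eq_bigr => p _ /=.
  rewrite -sumrB -big_split; apply: eq_bigr => q _ /=.
  rewrite x_bracket scalerDr scalerBr !scalerA.
  have swap (b1 b2 b3 b4 : F) : b1 * (b2 * b3 * b4) = b3 * (b1 * (b2 * b4)) by ring.
  by rewrite swap ![cf _ _ * (_ =N _)%:R]mulrC.
have cf_per1 p : forall q q', dv (q - q') -> cf p q = cf p q'.
  by move=> q q' qq; rewrite /cf (per b _ _ _ qq).
have cf_per2 q : forall p p', dv (p - p') -> cf p q = cf p' q.
  by move=> p p' pp; rewrite /cf (per a _ _ _ pp).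
have dv0 r : dv (r - r) by rewrite subrr dvdz0.
pose z := m + n; rewrite -/z.
have s1 : \sum_(p < N) \sum_(q < N) (q%:Z =N p%:Z + m)%:R *: (cf p%:Z q%:Z *: x p%:Z z)
    = chi (b *~ m - a *~ n) *: trig_image (a + b) z.
  rewrite scaler_sumr; apply: eq_bigr => p _; rewrite scalerA -(cfE _ _ z (dv0 (p%:Z + m))) //.
  apply: (@sum_at_residue G (fun q => cf p%:Z q *: x p%:Z z)) => q q' qq.
  by rewrite (cf_per1 _ _ _ qq).
have s2 : \sum_(q < N) \sum_(p < N) (p%:Z =N q%:Z + n)%:R *: (cf p%:Z q%:Z *: x q%:Z z)
    = chi (a *~ n - b *~ m) *: trig_image (a + b) z.
  rewrite scaler_sumr; apply: eq_bigr => q _; rewrite scalerA -(cfE' _ _ z (dv0 (q%:Z + n))) //.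
  apply: (@sum_at_residue G (fun p => cf p q%:Z *: x q%:Z z)) => p p' pp.
  by rewrite (cf_per2 _ _ _ pp).
have s3 : \sum_(p < N) \sum_(q < N) (q%:Z =N p%:Z + m)%:R
      *: ((cf p%:Z q%:Z * ((z == 0)%:R * (m%:~R / N%:R))) *: kk glN)
    = (m%:~R * ((a + b == 0) && (z == 0))%:R) *: kk glN.
  transitivity (\sum_(p < N) (cf p%:Z (p%:Z + m) * ((z == 0)%:R * (m%:~R / N%:R))) *: kk glN).
    apply: eq_bigr => p _.
    apply: (@sum_at_residue G (fun q =>
      (cf p%:Z q * ((z == 0)%:R * (m%:~R / N%:R))) *: kk glN)) => q q' qq.
    by rewrite (cf_per1 _ _ _ qq).
  rewrite -scaler_suml -mulr_suml; congr (_ *: _).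
  have [mn|_] := eqVneq z 0; last by rewrite andbF mul0r !mulr0.
  under eq_bigr => p _ do rewrite (cfE _ _ 0) // -addrA.
  rewrite -mulr_sumr sum_residues_char // andbT mul1r.
  have [ab|_] := eqVneq (a + b) 0; last by rewrite !mulr0 mul0r.
  have -> : b *~ m - a *~ n = 0.
    have -> : n = - m by apply/eqP; rewrite -addr_eq0 addrC -/z mn.
    by rewrite mulrNz opprK -mulrzDl addrC ab mul0rz.
  by rewrite char0 mul1r !mulr1 mulrC divfK ?NF0.
by rewrite s1 s2 s3 scalerBl.
Qed.
End TrigonometricAlgebra.

Section TrigonometricIsomorphism.
Variables (F : numFieldType) (l : nat) (S : finZmodType) (chi : linear_char F S).
Hypothesis S_cyclic : cyclic [set: S].
Local Notation N := (2 * l).+1.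
Hypothesis S_card : #|S| = N.
Hypothesis chi_inj : injective chi.
Local Notation "p =N q" := (p == q %[mod N%:Z])%Z (at level 70).
Local Notation dv z := (N%:Z %| z)%Z.
Local Notation glN := (gl F N).
Local Notation G := (affine glN).
Local Notation x := (@x F l).
Variable u : int.
Local Notation Y := (@trig_image F l S chi u).

Definition fourier_gen (g : trig_gen S) : G :=
  match g with TrigC => kk glN | TrigA a m => Y a m end.

Lemma fourier_rel s t : trig_rel chi s t -> leval fourier_gen s = leval fourier_gen t.
Proof. by case=> [a m|a m b n] /=; [apply: kk_central|apply: trig_image_bracket]. Qed.

Definition fourier : lieHom (trigA chi) G := pres_lift fourier_rel.

Lemma fourier_A a m : fourier (tA chi a m) = Y a m.
Proof. exact: pres_liftE. Qed.
Lemma fourier_c : fourier (tc chi) = kk glN.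
Proof. exact: pres_liftE. Qed.

Let per k (p q : int) (a : S) : dv (p - q) -> chi (a *~ (2 * p + k)) = chi (a *~ (2 * q + k)).
Proof.
move=> pq; apply: (@chi_congr _ _ _ chi S_card).
by rewrite (_ : _ - _ = 2 * (p - q)) ?dvdz_mull //; ring.
Qed.

Lemma x_fourier p m :
  x p m = N%:R^-1 *: \sum_(a : S) (chi (a *~ (2 * p + u + m)))^-1 *: Y a m.
Proof.
under eq_bigr => a _ do rewrite scaler_sumr.
rewrite exchange_big; under eq_bigr => q _.
  under eq_bigr => a _ do rewrite scalerA -chiV -charD -mulrNz -mulrzDr.
  rewrite -scaler_suml (_ : - _ + _ = 2 * (q%:Z - p)); last by ring.
  rewrite (sum_char_residue S_cyclic S_card chi_inj) dv_half -eqz_mod_dvd -scalerA.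
  over.
rewrite -scaler_sumr scalerA mulVf ?NF0 // scale1r.
by rewrite (sum_at_residue (f := x^~ m)) // => q q' qq; apply: x_congr; rewrite eqz_mod_dvd.
Qed.

(** The Fourier inverse, as an element of the trigonometric algebra. *)
Definition theta p m : trigA chi :=
  N%:R^-1 *: \sum_(a : S) (chi (a *~ (2 * p + u + m)))^-1 *: tA chi a m.

Lemma theta_congr p q m : p =N q -> theta p m = theta q m.
Proof.
rewrite eqz_mod_dvd => pq; congr (_ *: _); apply: eq_bigr => a _.
by rewrite -!addrA (per _ _ pq).
Qed.

Lemma tA_theta a m : \sum_(p < N) chi (a *~ (2 * p%:Z + u + m)) *: theta p%:Z m = tA chi a m.
Proof.
under eq_bigr => p _ do rewrite /theta scalerA mulrC -scalerA scaler_sumr.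
rewrite -scaler_sumr exchange_big; under eq_bigr => b _.
  under eq_bigr => p _ do rewrite scalerA -chiV -charD -mulNrz -mulrzDl -addrA.
  rewrite -scaler_suml (sum_residues_char S_card chi_inj) -scalerA subr_eq0.
  over.
rewrite -scaler_sumr scalerA mulVf ?NF0 // scale1r (bigD1 a) //= eqxx scale1r big1 ?addr0 // => b.
by rewrite eq_sym => /negPf ->; rewrite scale0r.
Qed.

(** The matrix unit (i, j) times t^n is x i (j + n N - i), up to a multiple of kk. *)
Definition unfourier_loop n (a : glN) : trigA chi := \sum_i \sum_j (a : 'M_N) i j *:
  (theta i%:Z (j%:Z + n * N%:Z - i%:Z)
    - ((j%:Z + n * N%:Z == i%:Z)%:R * uc F l i%:Z) *: tc chi).

Lemma unfourier_loop_linear n : linear (unfourier_loop n).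
Proof.
move=> c a b; rewrite scaler_sumr -big_split; apply: eq_bigr => i _ /=.
rewrite scaler_sumr -big_split; apply: eq_bigr => j _ /=.
by rewrite !mxE scalerDl scalerA.
Qed.

Definition unfourier : {linear G -> trigA chi} :=
  lin_fun (affine_lift_linear (tc chi) unfourier_loop_linear).

Lemma unfourier_kk : unfourier (kk glN) = tc chi.
Proof. exact/affine_lift_kk/unfourier_loop_linear. Qed.

Lemma unfourier_x p m : unfourier (x p m) = theta p m.
Proof.
pose i := idx l p; have ip : i%:Z =N p by rewrite idxE modz_mod.
rewrite -(x_congr _ _ ip) -(theta_congr _ ip); move: i {ip} => i.
pose j := idx l (i%:Z + m); pose n := ((i%:Z + m) %/ N%:Z)%Z.
have jE : i%:Z + m = j%:Z + n * N%:Z by rewrite idxE /n [RHS]addrC -divz_eq.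
rewrite xE jE -amono_delta linearD linearZ /= unfourier_kk.
rewrite -[lin_fun _ _]/(affine_lift _ _ _) affine_lift_amono; last exact: unfourier_loop_linear.
rewrite /unfourier_loop (bigD1 i) //= (bigD1 j) //= mxE !eqxx scale1r.
rewrite big1 => [|k kj]; last by rewrite mxE (negPf kj) andbF scale0r.
rewrite big1 => [|h hi]; last first.
  by rewrite big1 // => k _; rewrite mxE (negPf hi) scale0r.
rewrite !addr0 -jE [i%:Z + m - _]addrAC subrr add0r -[X in _ == X]addr0.
by rewrite (inj_eq (addrI _)) subrK.
Qed.

Lemma fourierK : cancel fourier unfourier.
Proof.
move=> y; elim: (trig_spanT y) => {y} [a m||c y z _ IHy _ IHz].
- rewrite fourier_A /Y linear_sum -[RHS]tA_theta; apply: eq_bigr => p _.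
  by rewrite linearZ /= unfourier_x.
- by rewrite fourier_c unfourier_kk.
- by rewrite !linearP IHy IHz.
Qed.

Lemma unfourierK : cancel unfourier fourier.
Proof.
elim/principal_ind => [|y z yE zE|a y yE||p m].
- by rewrite (linear0 unfourier) linear0.
- by rewrite (linearD unfourier) linearD yE zE.
- by rewrite (linearZ_LR unfourier) linearZ_LR yE.
- by rewrite unfourier_kk fourier_c.
rewrite unfourier_x /theta linearZ linear_sum [RHS]x_fourier; congr (_ *: _).
by apply: eq_bigr => a _; rewrite linearZ /= fourier_A.
Qed.

Definition fourier_iso : lieIso (trigA chi) G := LieIso fourierK unfourierK.
End TrigonometricIsomorphism.

(** * Transport of the involutions *)

Section Involutions.
Variables (F : numFieldType) (l : nat) (S : finZmodType) (chi : linear_char F S).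
Hypothesis S_cyclic : cyclic [set: S].
Local Notation N := (2 * l).+1.
Hypothesis S_card : #|S| = N.
Hypothesis chi_inj : injective chi.
Local Notation Y := (@trig_image F l S chi).

(** The reflection p |-> -1 - m - p maps 2p + u + m to its negative plus 2u - 2. *)
Lemma tau_trig_image eps (eps2 : eps * eps = 1) u a m : tau l eps2 (Y u a m) =
  (- eps ^ m * chi (a *~ (2 * u - 2))) *: Y u (- a) m.
Proof.
rewrite /trig_image linear_sum scaler_sumr [RHS](@sum_reflect F l (affine (gl F N))
  (fun q => (- eps ^ m * chi (a *~ (2 * u - 2)))
    *: (chi (- a *~ (2 * q + u + m)) *: x F l q m)) (-1 - m)) => [|p q pq].
  apply: eq_bigr => p _; rewrite linearZ_LR tau_x.
  rewrite [LHS]scalerA [RHS]scalerA.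
  rewrite mulrC -mulrA -charD mulNrz -mulrNz -mulrzDr.
  rewrite (_ : 2 * u - 2 - _ = 2 * p%:Z + u + m); last by ring.
  by rewrite (_ : -1 - m - p%:Z = -1 - p%:Z - m) //; ring.
congr (_ *: (_ *: _)); last by apply: x_congr; rewrite eqz_mod_dvd.
apply: (@chi_congr _ _ _ chi S_card).
by rewrite (_ : _ - _ = 2 * (p - q)) ?dvdz_mull //; ring.
Qed.

Lemma fourier_tauB (e2 : (-1) * (-1) = 1 :> F) y :
  fourier S_card chi_inj 1 (tauB chi y)
  = tau l e2 (fourier S_card chi_inj 1 y).
Proof.
elim: (trig_spanT y) => {y} [a m||c y z _ IHy _ IHz].
- by rewrite tauB_A linearZ_LR !fourier_A tau_trig_image mulr0z char0 mulr1.
- by rewrite tauB_c fourier_c tau_kk.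
- by rewrite !linearP IHy IHz.
Qed.

Lemma fourier_tauD (e2 : 1 * 1 = 1 :> F) y :
  fourier S_card chi_inj 2 (tauD chi y)
  = tau l e2 (fourier S_card chi_inj 2 y).
Proof.
elim: (trig_spanT y) => {y} [a m||c y z _ IHy _ IHz].
- by rewrite tauD_A linearZ_LR !fourier_A tau_trig_image exp1rz mulN1r.
- by rewrite tauD_c fourier_c tau_kk.
- by rewrite !linearP IHy IHz.
Qed.
End Involutions.

Section OrthonormalForm.
Variables (F : numClosedFieldType) (l : nat) (eps : F).
Hypothesis eps2 : eps * eps = 1.
Local Notation N := (2 * l).+1.
Local Notation glN := (gl F N).
Local Notation G := (affine glN).

(** Up to the scaling of the rows, orth_mx is 1 + 'i R for the reversal R of the
    indices, and (1 + 'i R)^2 = 2 'i R. In the middle row the two entries add up. *)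
Definition scale_J (i : 'I_N) : F := sqrtC (eps ^ (i%:Z + l%:Z) / (2 * 'i)).
Definition orth_mx : 'M[F]_N :=
  \matrix_(i, j) (scale_J i * ((j == i)%:R + 'i * (j == rev_ord i)%:R)).

Lemma orth_mxP : orth_mx *m orth_mx^T = Jmx l eps.
Proof.
apply/matrixP => i k; rewrite !mxE.
transitivity (scale_J i * scale_J k * (2 * 'i * (k == rev_ord i)%:R)).
  pose d (u v : 'I_N) : F := (u == v)%:R.
  have dd u v : \sum_j d j u * d j v = d u v.
    rewrite (bigD1 u) //= big1 => [|j /negPf ju]; last by rewrite /d ju mul0r.
    by rewrite /d eqxx mul1r addr0.
  rewrite (eq_bigr (fun j => scale_J i * scale_J k * (d j i * d j k)
     + scale_J i * scale_J k * 'i * (d j i * d j (rev_ord k))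
     + scale_J i * scale_J k * 'i * (d j (rev_ord i) * d j k)
     + scale_J i * scale_J k * ('i * 'i) * (d j (rev_ord i) * d j (rev_ord k)))); last first.
    by move=> j _; rewrite !mxE /d; ring.
  rewrite !big_split -!mulr_sumr !dd /d (inj_eq rev_ord_inj) -expr2 sqrCi.
  rewrite -rev_ord_eq [rev_ord i == k]eq_sym.
  by rewrite /=; ring.
have [->|_] := eqVneq k (rev_ord i); last by rewrite !mulr0.
have -> : scale_J (rev_ord i) = scale_J i.
  rewrite /scale_J; congr (sqrtC (_ / _)).
  apply: (@eps_parity _ _ eps2 _ _ (l%:Z - i%:Z)).
  by rewrite /=; have := ltn_ord i; lia.
by rewrite -expr2 sqrtCK mulr1 divfK // mulf_neq0 ?neq0Ci ?pnatr_eq0.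
Qed.

Definition orth_inv : 'M[F]_N := orth_mx^T *m Jmx l eps.

Lemma orth_mxK : orth_mx *m orth_inv = 1%:M.
Proof. by rewrite /orth_inv mulmxA orth_mxP JmxK. Qed.
Lemma orth_invK : orth_inv *m orth_mx = 1%:M.
Proof. exact/mulmx1C/orth_mxK. Qed.

Let conjK (P Q : 'M[F]_N) (PQ : P *m Q = 1%:M) (QP : Q *m P = 1%:M) :
  cancel (conj_hom PQ) (conj_hom QP).
Proof.
move=> y; apply: affineP; last by rewrite !conj_hom_snd.
apply: lcoefP => m; rewrite !conj_hom_coef /conj_mx !mulmxA QP mul1mx.
by rewrite -mulmxA QP mulmx1.
Qed.

Definition orth_iso : lieIso G G := LieIso (conjK orth_mxK orth_invK) (conjK orth_invK orth_mxK).

End OrthonormalForm.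

Section Orthonormalization.
Variables (F : numClosedFieldType) (l : nat).
Local Notation N := (2 * l).+1.
Local Notation glN := (gl F N).
Local Notation P := (@orth_mx F l (-1)).
Local Notation iso := (orth_iso l (epsA2 F)).

Lemma orth_iso_coef y m : lcoef (iso y).1 m = conj_mx P (@orth_inv F l (-1)) (lcoef y.1 m).
Proof. by []. Qed.

(** With J = P P^T, the map a |-> J (P a P^-1)^T J is the conjugate of
    transposition by P. *)
Lemma orth_tauhat y : iso (tauhat F N y) = tau l (epsA2 F) (iso y).
Proof.
apply: affineP; last by rewrite twist_hom_snd !conj_hom_snd.
apply: lcoefP => m; rewrite twist_hom_coef !orth_iso_coef tauhat_coef /twist_mx /conj_mx.
rewrite mulmxN mulNmx -scalemxAr -scalemxAl /orth_inv !trmx_mul trmxK Jmx_tr; last exact: epsA2.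
by rewrite !mulmxA JmxK ?epsA2 // mul1mx.
Qed.

Lemma fixed_tauhat_lieIso :
  sub_lie (fixed_subalg (tauhat F N)) ~=L sub_lie (fixed_subalg (tau l (epsA2 F))).
Proof. exact: fixed_lieIso orth_tauhat. Qed.

Lemma twisted_sl_lieIso :
  sub_lie (twisted_affine (sl F N)) ~=L sub_lie (folded l (epsA2 F)).
Proof.
have iso_sl y : (forall m, \tr (lcoef (iso y).1 m : 'M_N) = 0)
    <-> forall m, \tr (lcoef y.1 m : 'M_N) = 0.
  by split=> h m; have := h m; rewrite orth_iso_coef (conj_mx_trace (orth_mxK _ (epsA2 F))).
apply: (@subalg_lieIso _ _ _ iso) => [|y /andP[/asboolP sly]|y /foldedP[sly tauy]].
- exact: can_inj (iso_homK iso).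
- rewrite inE => /eqP ty; apply/foldedP; split; last by rewrite -orth_tauhat ty.
  by apply/iso_sl => m; apply/eqP; have := sly m; rewrite inE.
exists (iso_inv iso y); last exact: iso_invK.
apply/andP; split.
  by apply/asboolP => m; rewrite inE; apply/eqP; move: m; apply/iso_sl; rewrite iso_invK.
rewrite inE; apply/eqP/(can_inj (iso_homK iso)).
by rewrite orth_tauhat iso_invK.
Qed.
End Orthonormalization.

(** * Splitting off the scalar matrices *)

Section TraceDecomposition.
Variables (F : numFieldType) (n : nat).
Local Notation N := n.+1.
Local Notation glN := (gl F N).
Local Notation G := (affine glN).
Local Notation tauhat := (tauhat F N).
Local Notation sl_part := (twisted_affine (sl F N)).
Local Notation scalar_part := (twisted_affine (scalars F N)).

Lemma twistedP (P : subalg glN) y : reflect ((forall m, lcoef y.1 m \in subalg_pred P) /\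
  tauhat y = y) (y \in subalg_pred (twisted_affine P)).
Proof.
apply: (iffP andP) => [[/asboolP hy /eqP ty]|[hy ty]] //; split; first exact/asboolP.
by rewrite inE ty.
Qed.

Lemma sl_scalar_commute y z : y \in subalg_pred sl_part -> z \in subalg_pred scalar_part ->
  [lie y, z] = 0.
Proof.
move=> /twistedP[sly _] /twistedP[scz _]; rewrite (affine_expand z).
rewrite bracketDr bracketZr kkC scaler0 addr0 bracket_sumr big1 // => m _.
have /is_scalar_mxP[c ->] := scz m.
apply: affineP.
  apply: lcoefP => k; rewrite bracket_amono_coef /bracket /= /gl_bracket scalar_mxC.
  exact: subrr.
rewrite bracket_amono_snd /iform /= /gl_form mul_mx_scalar mxtraceZ.
by have /eqP -> := sly (- m); rewrite !mulr0.
Qed.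

Definition scalar_mean (m : int) (a : glN) : glN := (\tr (a : 'M_N) / N%:R)%:M.

Lemma scalar_mean_linear m : linear (scalar_mean m).
Proof.
move=> c a b; rewrite /scalar_mean mxtraceD mxtraceZ mulrDl raddfD -mulrA; congr (_ + _).
by apply/matrixP => i j; rewrite !mxE mulrnAr.
Qed.

(** The traces of a fixed point of tauhat satisfy the sign rule of tauhat
    themselves, so that the two components are fixed points as well. *)
Lemma scalar_meanP y : tauhat y = y ->
  exists2 z, z \in subalg_pred scalar_part & y - z \in subalg_pred sl_part.
Proof.
move=> ty; pose z : G := degreewise 0 scalar_mean_linear y.
have zE m : lcoef z.1 m = scalar_mean m (lcoef y.1 m) by [].
have tz : tauhat z = z.
  apply: affineP => //; apply: lcoefP => m; rewrite tauhat_coef zE -{2}ty tauhat_coef.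
  rewrite /scalar_mean tr_scalar_mx raddfN /= mxtraceZ mxtrace_tr mulNr raddfN -mulrA.
  by congr (- _); apply: scale_scalar_mx.
exists z; first by apply/twistedP; split=> // m; rewrite zE; apply: scalar_mx_is_scalar.
apply/twistedP; split=> [m|]; last by rewrite linearB /= ty tz.
rewrite inE lcoefD -scaleN1r lcoefZ scaleN1r zE raddfB /= mxtrace_scalar.
by rewrite -[_ / _ *+ _]mulr_natr divfK ?subrr ?pnatr_eq0.
Qed.

Variables (L : lieType F) (phi : lieIso L (sub_lie sl_part)).

Lemma central_pair : lie_central (iso_inv phi (twisted_kk (sl F N)),
  - twisted_kk (scalars F N)).
Proof.
have kc P (y : sub_lie (twisted_affine P)) : [lie twisted_kk P, y] = 0.
  by apply: val_inj; apply: kk_central.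
move=> [a b]; congr pair; last by rewrite bracketNl kc oppr0.
by apply: (can_inj (iso_homK phi)); rewrite hom_bracket iso_invK kc linear0.
Qed.

Let fixed_val P (y : sub_lie (twisted_affine P)) : tauhat (val y) = val y.
Proof. by have /twistedP[] := valP y. Qed.

Let sum_fixed (y : L * sub_lie scalar_part) :
  subalg_pred (fixed_subalg tauhat) (val (phi y.1) + val y.2).
Proof. by rewrite /= /fixed_pred /= linearD !fixed_val. Qed.

Definition sum_fun y : sub_lie (fixed_subalg tauhat) :=
  exist (fun z => subalg_pred (fixed_subalg tauhat) z) _ (sum_fixed y).

Let sum_linear : linear sum_fun.
Proof.
move=> c y z; apply: val_inj; rewrite /= linearP /= scalerDr.
by rewrite addrACA.
Qed.

Let sum_bracket y z : sum_fun [lie y, z] = [lie sum_fun y, sum_fun z].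
Proof.
apply: val_inj; rewrite /= hom_bracket /= bracketDl !bracketDr.
rewrite (sl_scalar_commute (valP (phi y.1)) (valP z.2)) addr0.
rewrite [[lie val y.2, val (phi z.1)]]bracketC (sl_scalar_commute (valP (phi z.1)) (valP y.2)).
by rewrite oppr0 add0r.
Qed.

(** The sum of the two components is a homomorphism, as they commute, and it is onto
    by the previous decomposition. A traceless matrix that is scalar is 0, so that
    the components only share the multiples of kk. *)
Lemma fixed_quotient :
  sub_lie (fixed_subalg tauhat) ~=L quot_lie (central_line central_pair).
Proof.
pose h := build_lieHom sum_linear sum_bracket.
have hI y : y \in ideal_pred (central_line central_pair) -> h y = 0.
  case/asboolP => c ->; rewrite linearZ; apply: val_inj.
  by rewrite /= iso_invK /= subrr scaler0.
apply/lieIso_sym/(@bijective_lieIso _ _ _ (quot_map hI)).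
  apply: quot_map_inj => -[a b] /(congr1 val) /= ab0.
  have /twistedP[sla _] := valP (phi a); have /twistedP[scb _] := valP b.
  have bN : val b = - val (phi a) by apply/eqP; rewrite -addr_eq0 addrC ab0.
  have a0 m : lcoef (val (phi a)).1 m = 0.
    have := scb m; rewrite bN -scaleN1r lcoefZ scaleN1r rpredN.
    move=> /is_scalar_mxP[c cE]; have := sla m; rewrite inE cE mxtrace_scalar.
    by rewrite mulrn_eq0 /= => /eqP ->; rewrite raddf0.
  have aE : val (phi a) = (val (phi a)).2 *: kk glN.
    apply: affineP; first by apply: lcoefP => m; rewrite a0 /= scaler0 lcoef0.
    by rewrite /= /GRing.scale /= mulr1.
  apply/asboolP; exists (val (phi a)).2; congr pair; last first.
    by apply: val_inj; rewrite /= bN scalerN -aE.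
  apply: (can_inj (iso_homK phi)); rewrite linearZ iso_invK; apply: val_inj.
  by rewrite /= -aE.
move=> y; have [|z hz hyz] := @scalar_meanP (val y); first by apply/eqP; exact: (valP y).
pose z' : sub_lie scalar_part := exist (fun u => subalg_pred scalar_part u) _ hz.
pose y' : sub_lie sl_part := exist (fun u => subalg_pred sl_part u) _ hyz.
exists (quot_pi (central_line central_pair) (iso_inv phi y', z')).
transitivity (h (iso_inv phi y', z')); first exact: quot_map_pi.
apply: val_inj.
by rewrite /= iso_invK /= subrK.
Qed.
End TraceDecomposition.

(** * The isomorphisms *)

(** For eps = 1 the coefficients are antisymmetric for J, hence traceless. *)
Lemma fixed_folded (F : numClosedFieldType) (l : nat) y :
  tau l (mulr1 (1 : F)) y = y -> y \in subalg_pred (folded l (mulr1 (1 : F))).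
Proof.
move=> ty; apply/foldedP; split=> // m; apply/eqP.
have := twist_trace (mulr1 1) m (lcoef y.1 m); rewrite exp1rz mulN1r.
rewrite -[twist_mx _ _ _ _ _]/(lcoef (tau l (mulr1 (1 : F)) y).1 m) ty => /eqP.
by rewrite -addr_eq0 -mulr2n mulrn_eq0.
Qed.

Theorem theorem5p3 (R : realType) (l : nat) (l_ge1 : (1 <= l)%N)
    (S : finZmodType) (S_cyclic : cyclic [set: S]) (S_card : #|S| = (2 * l + 1)%N)
    (chi : linear_char R[i] S) (chi_inj : injective chi) :
  let N := (2 * l + 1)%N in
  let glN := gl R[i] N in
  [/\ trigA chi ~=L affine glN,
      (sub_lie (trigB chi) ~=L sub_lie (fixed_subalg (tauhat R[i] N)))
      /\ exists (phi : lieIso (sub_lie (km_derived R[i] (cartan_A2l2 l)))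
                              (sub_lie (twisted_affine (sl R[i] N))))
           (hk : lie_central (iso_inv phi (twisted_kk (sl R[i] N)),
                              - twisted_kk (scalars R[i] N))),
           sub_lie (fixed_subalg (tauhat R[i] N)) ~=L quot_lie (central_line hk)
    & sub_lie (trigD chi) ~=L sub_lie (km_derived R[i] (cartan_B1 l))].
Proof.
rewrite addn1 in S_card *; move=> N glN.
split.
- exact: (inhabits (fourier_iso S_cyclic S_card chi_inj 1)).
- split.
    apply: (lieIso_trans (M := sub_lie (fixed_subalg (tau l (epsA2 _))))).
      exact: (fixed_lieIso (h := fourier_iso S_cyclic S_card chi_inj 1)) (fourier_tauB _ _ _).
    exact/lieIso_sym/fixed_tauhat_lieIso.
  have [phi] := lieIso_trans (folded_A2l2 R[i] l_ge1) (lieIso_sym (twisted_sl_lieIso _ l)).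
  exists phi, (central_pair phi); exact: fixed_quotient.
- apply: lieIso_trans (lieIso_sym (folded_B1 R[i] l_ge1)).
  pose h := fourier_iso S_cyclic S_card chi_inj 2.
  apply: (@subalg_lieIso _ _ _ h) => [|y|y /foldedP[_ ty]].
  + exact: can_inj (iso_homK h).
  + by rewrite inE => /eqP ty; apply: fixed_folded; rewrite -fourier_tauD ty.
  exists (iso_inv h y); last exact: iso_invK.
  rewrite inE; apply/eqP/(can_inj (iso_homK h)).
  apply: (etrans (fourier_tauD S_card chi_inj (mulr1 1) _)).
  by rewrite [fourier _ _ _ _](iso_invK h) ty.
Qed.
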